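(* Let $\Bbbk$ be a unital commutative ring, let $A$ be a $\Bbbk$-algebra which is projective as a $\Bbbk$-module, let $\sigma$ be an algebra automorphism of $A$, let $\delta$ be a $\sigma$-derivation of $A$, and let $E=A[x;\sigma,\delta]$ be the Ore extension. Suppose that $A$ is $\nu$-twisted Calabi-Yau of dimension $d$. Then $E$ is twisted Calabi-Yau of dimension $d+1$, with a Nakayama automorphism $\nu'$ of $E$ satisfying $\nu'|_{A}=\sigma^{-1}\nu$ and $\nu'(x)=ux+b$ for some $u,b\in A$ with $u$ invertible.
   Context: Unadorned $\otimes$ means $\otimes_{\Bbbk}$. For an algebra $B$, $B^e=B\otimes B^{\mathrm{op}}$, and $B^e$-modules are $B$-$B$-bimodules. For an endomorphism $\nu$ of $B$ and a $B$-bimodule $M$, $M^\nu$ is $M$ with action $a\cdot m\cdot b=am\nu(b)$. An algebra $B$ is $\nu$-twisted Calabi-Yau of dimension $d$, for an automorphism $\nu$ of $B$ and an integer $d\ge 0$, if (1) $B$ is homologically smooth, i.e. as a $B^e$-module $B$ has a projective resolution of finite length with finitely generated terms; and (2) as $B^e$-modules $\mathrm{Ext}^i_{B^e}(B,B^e)=0$ for $i\ne d$ and $\mathrm{Ext}^d_{B^e}(B,B^e)\cong B^\nu$. Here Ext is computed with the outer bimodule structure $a\cdot(m\otimes n)\cdot b=am\otimes nb$ on $B\otimes B=B^e$, and the $B^e$-module structure on Ext is induced by the inner one, $a\cdot(m\otimes n)\cdot b=mb\otimes an$. The automorphism $\nu$ is called the Nakayama automorphism of $B$; it is unique up to an inner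 automorphism. $B$ is twisted Calabi-Yau of dimension $d$ if it is $\nu$-twisted Calabi-Yau of dimension $d$ for some $\nu$. A $\sigma$-derivation is a $\Bbbk$-linear map $\delta\colon A\to A$ with $\delta(ab)=\delta(a)b+\sigma(a)\delta(b)$. The Ore extension $E=A[x;\sigma,\delta]$ is the ring extension of $A$ that is a free left $A$-module with basis $\{1,x,x^2,\dots\}$ and satisfies $xa=\sigma(a)x+\delta(a)$ for all $a\in A$. *)

(* Defs.v *)
From HB Require Import structures.
From mathcomp Require Import all_boot all_order all_algebra.
From mathcomp Require Import boolp.

Set Implicit Arguments.
Unset Strict Implicit.
Unset Printing Implicit Defensive.

Import GRing.Theory.
Local Open Scope ring_scope.
Local Open Scope quotient_scope.

(* Associative unital k-algebras.  The library's algType only covers algebras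
   with 1 != 0; here k and the algebra are allowed to be zero. *)
Record pzAlgType (k : comPzRingType) := PzAlgebra {
  pz_ring : pzRingType;
  pz_scale : k -> pz_ring -> pz_ring;
  pz_scaleA : forall c e x, pz_scale c (pz_scale e x) = pz_scale (c * e) x;
  pz_scale1 : left_id 1 pz_scale;
  pz_scaleDr : right_distributive pz_scale +%R;
  pz_scaleDl : forall x, {morph pz_scale^~ x : c e / c + e};
  pz_scaleMl : forall c x y, pz_scale c (x * y) = pz_scale c x * y;
  pz_scaleMr : forall c x y, pz_scale c (x * y) = x * pz_scale c y }.

Definition alg_sort (k : comPzRingType) (A : pzAlgType k) : Type := pz_ring A.
Coercion alg_sort : pzAlgType >-> Sortclass.

HB.instance Definition _ (k : comPzRingType) (A : pzAlgType k) :=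
  GRing.PzRing.copy (alg_sort A) (pz_ring A).
HB.instance Definition _ (k : comPzRingType) (A : pzAlgType k) :=
  GRing.Zmodule_isLmodule.Build k (alg_sort A)
    (@pz_scaleA k A) (@pz_scale1 k A) (@pz_scaleDr k A) (@pz_scaleDl k A).

Lemma pz_scalerAl (k : comPzRingType) (A : pzAlgType k) (c : k) (x y : A) :
  c *: (x * y) = c *: x * y.
Proof. exact: pz_scaleMl. Qed.

Lemma pz_scalerAr (k : comPzRingType) (A : pzAlgType k) (c : k) (x y : A) :
  c *: (x * y) = x * (c *: y).
Proof. exact: pz_scaleMr. Qed.

Definition pzAlg_of_algType (k : comPzRingType) (A : algType k) : pzAlgType k :=
  PzAlgebra (@scalerA k A) (@scale1r k A) (@scalerDr k A)
    (fun x c e => scalerDl x c e) (@scalerAl k A) (@scalerAr k A).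

Definition is_alg_hom (k : comPzRingType) (A B : pzAlgType k) (f : A -> B) :
    Prop :=
  linear f /\ monoid_morphism f.

Record alg_aut (k : comPzRingType) (A : pzAlgType k) := AlgAut {
  aut_fun :> A -> A;
  aut_inv : A -> A;
  aut_hom : is_alg_hom aut_fun;
  autK : cancel aut_fun aut_inv;
  autVK : cancel aut_inv aut_fun }.

Definition projective_lmod (k : pzRingType) (V : lmodType k) : Prop :=
  forall (M N : lmodType k) (g : {linear M -> N}) (f : {linear V -> N}),
    (forall y, exists x, g x = y) ->
  exists h : {linear V -> M}, forall v, g (h v) = f v.

Definition is_skew_derivation (k : comPzRingType) (A : pzAlgType k)
    (sigma delta : A -> A) : Prop :=
  linear delta /\
  forall a b : A, delta (a * b) = delta a * b + sigma a * delta b.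

(* E, with structure map iota : A -> E and distinguished element x, is the Ore
   extension A[x; sigma, delta].  In ore_gen and ore_free, finitely supported
   families of coefficients are represented by sequences. *)
Record is_ore_extension (k : comPzRingType) (A : pzAlgType k)
    (sigma delta : A -> A) (E : pzAlgType k) (iota : A -> E) (x : E) : Prop :=
  IsOreExtension {
  ore_hom : is_alg_hom iota;
  ore_gen : forall e : E, exists s : seq A,
    e = \sum_(i < size s) iota s`_i * x ^+ i;
  ore_free : forall s : seq A,
    \sum_(i < size s) iota s`_i * x ^+ i = 0 -> forall i, s`_i = 0;
  ore_comm : forall a : A, x * iota a = iota (sigma a) * x + iota (delta a) }.

(* V (x)_k W is the abelian group of formal sums of pairs, two formal sums being
   identified when every k-balanced biadditive map takes the same value on
   them; see tensor_lift_tens and tensor_lift_uniq for the universal property. *)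
Section Tensor.
Variables (k : comPzRingType) (V W : lmodType k).

Record balanced (G : zmodType) (f : V -> W -> G) : Prop := Balanced {
  balancedDl : forall v v' w, f (v + v') w = f v w + f v' w;
  balancedDr : forall v w w', f v (w + w') = f v w + f v w';
  balancedZ : forall (c : k) v w, f (c *: v) w = f v (c *: w) }.

Definition formal_eval (G : zmodType) (f : V -> W -> G) (s : seq (V * W)) : G :=
  \sum_(p <- s) f p.1 p.2.

Definition tensor_equiv (s t : seq (V * W)) : bool :=
  `[< forall (G : zmodType) (f : V -> W -> G),
        balanced f -> formal_eval f s = formal_eval f t >].

Lemma tensor_equiv_is_equiv : equiv_class_of tensor_equiv.
Proof.
split=> [s|s t|t s u]; first by apply/asboolP.
  by apply/asboolP/asboolP => st G f fb; rewrite st.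
by move=> /asboolP st /asboolP tu; apply/asboolP => G f fb; rewrite st // tu.
Qed.

Canonical tensor_equiv_equiv := EquivRelPack tensor_equiv_is_equiv.
Canonical tensor_equiv_encModRel := defaultEncModRel tensor_equiv.

Definition tensor := {eq_quot tensor_equiv}.

HB.instance Definition _ := Choice.on tensor.

Lemma tensor_eqP (s t : seq (V * W)) :
  (\pi_tensor s = \pi_tensor t) <->
  (forall (G : zmodType) (f : V -> W -> G),
     balanced f -> formal_eval f s = formal_eval f t).
Proof.
split=> [/eqP|st]; first by rewrite eqmodE => /asboolP.
by apply/eqP; rewrite eqmodE; apply/asboolP.
Qed.

Definition tensor_lift (G : zmodType) (f : V -> W -> G) (t : tensor) : G :=
  formal_eval f (repr t).

Lemma tensor_lift_pi (G : zmodType) (f : V -> W -> G) s :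
  balanced f -> tensor_lift f (\pi_tensor s) = formal_eval f s.
Proof. by move=> fb; apply: (tensor_eqP _ _).1 => //; rewrite reprK. Qed.

Lemma tensor_eq (t u : tensor) :
  (forall (G : zmodType) (f : V -> W -> G),
     balanced f -> tensor_lift f t = tensor_lift f u) -> t = u.
Proof. by move=> tu; rewrite -[t]reprK -[u]reprK; apply/tensor_eqP. Qed.

Definition tensor_zero : tensor := \pi_tensor [::].
Definition tensor_opp (t : tensor) : tensor :=
  \pi_tensor [seq (- p.1, p.2) | p <- repr t].
Definition tensor_add (t u : tensor) : tensor := \pi_tensor (repr t ++ repr u).

Lemma balancedNl (G : zmodType) (f : V -> W -> G) v w :
  balanced f -> f (- v) w = - f v w.
Proof.
move=> fb; apply: (addrI (f v w)); rewrite -(balancedDl fb) !subrr.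
by apply: (addrI (f 0 w)); rewrite -(balancedDl fb) !addr0.
Qed.

Lemma lift_zero (G : zmodType) (f : V -> W -> G) :
  balanced f -> tensor_lift f tensor_zero = 0.
Proof. by move=> fb; rewrite tensor_lift_pi // /formal_eval big_nil. Qed.

Lemma lift_opp (G : zmodType) (f : V -> W -> G) t :
  balanced f -> tensor_lift f (tensor_opp t) = - tensor_lift f t.
Proof.
move=> fb; rewrite tensor_lift_pi // /tensor_lift /formal_eval big_map /=.
by rewrite -sumrN; apply: eq_bigr => p _; rewrite balancedNl.
Qed.

Lemma lift_add (G : zmodType) (f : V -> W -> G) t u :
  balanced f ->
  tensor_lift f (tensor_add t u) = tensor_lift f t + tensor_lift f u.
Proof. by move=> fb; rewrite tensor_lift_pi // /formal_eval big_cat. Qed.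

Lemma tensor_addA : associative tensor_add.
Proof.
by move=> t u v; apply: tensor_eq => G f fb; rewrite !lift_add // addrA.
Qed.

Lemma tensor_addC : commutative tensor_add.
Proof.
by move=> t u; apply: tensor_eq => G f fb; rewrite !lift_add // addrC.
Qed.

Lemma tensor_add0 : left_id tensor_zero tensor_add.
Proof.
by move=> t; apply: tensor_eq => G f fb; rewrite lift_add // lift_zero // add0r.
Qed.

Lemma tensor_addN : left_inverse tensor_zero tensor_opp tensor_add.
Proof.
move=> t; apply: tensor_eq => G f fb.
by rewrite lift_add // lift_opp // lift_zero // addNr.
Qed.

HB.instance Definition _ :=
  GRing.isZmodule.Build tensor tensor_addA tensor_addC tensor_add0 tensor_addN.

Definition tens (v : V) (w : W) : tensor := \pi_tensor [:: (v, w)].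

Lemma tensor_lift_tens (G : zmodType) (f : V -> W -> G) v w :
  balanced f -> tensor_lift f (tens v w) = f v w.
Proof. by move=> fb; rewrite tensor_lift_pi // /formal_eval big_seq1. Qed.

Lemma tensor_liftD (G : zmodType) (f : V -> W -> G) t u :
  balanced f -> tensor_lift f (t + u) = tensor_lift f t + tensor_lift f u.
Proof. exact: lift_add. Qed.

Lemma tens_balanced : balanced tens.
Proof.
split=> *; apply: tensor_eq => G f fb; rewrite ?tensor_liftD //.
all: by rewrite !tensor_lift_tens // (balancedDl fb, balancedDr fb, balancedZ fb).
Qed.

Lemma pi_tensorE s : \pi_tensor s = \sum_(p <- s) tens p.1 p.2.
Proof.
elim: s => [|[v w] s IH]; first by rewrite big_nil.
rewrite big_cons -IH; apply: tensor_eq => G f fb; rewrite tensor_liftD //.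
by rewrite !tensor_lift_pi // /formal_eval big_cons big_seq1.
Qed.

Lemma tensor_lift_uniq (G : zmodType) (g h : tensor -> G) :
    {morph g : t u / t + u} -> {morph h : t u / t + u} ->
    (forall v w, g (tens v w) = h (tens v w)) -> g =1 h.
Proof.
move=> gD hD gh t; rewrite -[t]reprK pi_tensorE.
have z (f : tensor -> G) : {morph f : t u / t + u} -> f 0 = 0.
  by move=> fD; apply: (addrI (f 0)); rewrite -fD !addr0.
elim: (repr t) => [|p s IH]; first by rewrite !big_nil !z.
by rewrite !big_cons gD hD gh IH.
Qed.

End Tensor.

Section TensorMap.
Variables (k : comPzRingType) (V W : lmodType k).

Definition tensor_map (g : V -> V) (h : W -> W) : tensor V W -> tensor V W :=
  tensor_lift (fun v w => tens (g v) (h w)).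

Lemma tensor_map_balanced (g : V -> V) (h : W -> W) :
  linear g -> linear h -> balanced (fun v w => tens (g v) (h w)).
Proof.
move=> gl hl.
have gD v v' : g (v + v') = g v + g v' by rewrite -[v]scale1r gl !scale1r.
have hD v v' : h (v + v') = h v + h v' by rewrite -[v]scale1r hl !scale1r.
have g0 : g 0 = 0 by apply: (addrI (g 0)); rewrite -gD !addr0.
have h0 : h 0 = 0 by apply: (addrI (h 0)); rewrite -hD !addr0.
have gZ c v : g (c *: v) = c *: g v by rewrite -[c *: v]addr0 gl g0 addr0.
have hZ c v : h (c *: v) = c *: h v by rewrite -[c *: v]addr0 hl h0 addr0.
have tb := @tens_balanced k V W.
split=> *; rewrite ?gD ?hD ?gZ ?hZ.
- exact: (balancedDl tb).
- exact: (balancedDr tb).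
- exact: (balancedZ tb).
Qed.

Lemma tensor_mapE (g : V -> V) (h : W -> W) v w :
  linear g -> linear h -> tensor_map g h (tens v w) = tens (g v) (h w).
Proof.
by move=> gl hl; rewrite /tensor_map tensor_lift_tens //;
  exact: tensor_map_balanced.
Qed.

Lemma tensor_mapD (g : V -> V) (h : W -> W) :
  linear g -> linear h -> {morph tensor_map g h : t u / t + u}.
Proof.
by move=> gl hl t u; rewrite /tensor_map tensor_liftD //; exact: tensor_map_balanced.
Qed.

End TensorMap.

Section Bimodules.
Variables (k : comPzRingType) (B : pzAlgType k).

(* By bimod_central the two k-actions induced from B agree, so that these are
   exactly the B^e-modules. *)
Record bimodule := Bimodule {
  bimod_carrier :> zmodType;
  lact : B -> bimod_carrier -> bimod_carrier;
  ract : bimod_carrier -> B -> bimod_carrier;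
  lactDl : forall a b m, lact (a + b) m = lact a m + lact b m;
  lactDr : forall a m n, lact a (m + n) = lact a m + lact a n;
  lact1 : forall m, lact 1 m = m;
  lactM : forall a b m, lact (a * b) m = lact a (lact b m);
  ractDr : forall m a b, ract m (a + b) = ract m a + ract m b;
  ractDl : forall m n a, ract (m + n) a = ract m a + ract n a;
  ract1 : forall m, ract m 1 = m;
  ractM : forall m a b, ract m (a * b) = ract (ract m a) b;
  lractA : forall a m b, ract (lact a m) b = lact a (ract m b);
  bimod_central : forall (c : k) m, lact (c *: (1 : B)) m = ract m (c *: (1 : B)) }.

Record is_bimod_hom (M N : bimodule) (f : M -> N) : Prop := IsBimodHom {
  bhomD : forall m n, f (m + n) = f m + f n;
  bhom_l : forall a m, f (lact a m) = lact a (f m);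
  bhom_r : forall m a, f (ract m a) = ract (f m) a }.

Record bimod_hom (M N : bimodule) := BimodHom {
  bhom_fun :> M -> N;
  bhomP : is_bimod_hom bhom_fun }.

Definition bimod_iso (M N : bimodule) : Prop :=
  exists f : bimod_hom M N, bijective f.

Definition bimod_zero (M : bimodule) : Prop := forall m : M, m = 0.

Definition bimod_projective (P : bimodule) : Prop :=
  forall (M N : bimodule) (g : bimod_hom M N) (f : bimod_hom P N),
    (forall y, exists x, g x = y) ->
  exists h : bimod_hom P M, forall p, g (h p) = f p.

Definition bimod_fg (M : bimodule) : Prop :=
  exists gens : seq M, forall m : M,
  exists t : seq (B * 'I_(size gens) * B),
    m = \sum_(z <- t) ract (lact z.1.1 gens`_z.1.2) z.2.

Lemma lact0 (M : bimodule) a : lact a (0 : M) = 0.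
Proof. by apply: (addrI (lact a 0)); rewrite -lactDr !addr0. Qed.

Lemma ract0 (M : bimodule) a : ract (0 : M) a = 0.
Proof. by apply: (addrI (ract 0 a)); rewrite -ractDl !addr0. Qed.

Lemma lactB (M : bimodule) a (m n : M) : lact a (m - n) = lact a m - lact a n.
Proof. by apply: (addIr (lact a n)); rewrite -lactDr !subrK. Qed.

Lemma ractB (M : bimodule) (m n : M) a : ract (m - n) a = ract m a - ract n a.
Proof. by apply: (addIr (ract n a)); rewrite -ractDl !subrK. Qed.

Lemma lactN (M : bimodule) a (m : M) : lact a (- m) = - lact a m.
Proof. by rewrite -sub0r lactB lact0 sub0r. Qed.

Lemma ractN (M : bimodule) (m : M) a : ract (- m) a = - ract m a.
Proof. by rewrite -sub0r ractB ract0 sub0r. Qed.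

Lemma bhom0 (M N : bimodule) (f : bimod_hom M N) : f 0 = 0.
Proof. by apply: (addrI (f 0)); rewrite -(bhomD (bhomP f)) !addr0. Qed.

Lemma bhom_eq (M N : bimodule) (f g : bimod_hom M N) : f =1 g -> f = g.
Proof.
case: f g => [f fP] [g gP] /= /funext fg; subst g.
by congr BimodHom; exact: Prop_irrelevance.
Qed.

Record sub_bimodule (M : bimodule) := SubBimodule {
  sub_pred :> M -> Prop;
  sub0 : sub_pred 0;
  subB : forall m n, sub_pred m -> sub_pred n -> sub_pred (m - n);
  sub_l : forall a m, sub_pred m -> sub_pred (lact a m);
  sub_r : forall m a, sub_pred m -> sub_pred (ract m a) }.

Section SubBimodule.
Variables (M : bimodule) (S : sub_bimodule M).

Record sub_type := SubType { sub_val :> M; sub_valP : S sub_val }.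

HB.instance Definition _ := gen_eqMixin sub_type.
HB.instance Definition _ := gen_choiceMixin sub_type.

Lemma sub_val_inj : injective sub_val.
Proof.
case=> [m mS] [n nS] /= mn; subst n.
by congr SubType; exact: Prop_irrelevance.
Qed.

Lemma subN m : S m -> S (- m).
Proof. by move=> mS; rewrite -sub0r; apply: subB => //; exact: sub0. Qed.

Lemma subD m n : S m -> S n -> S (m + n).
Proof. by move=> mS nS; rewrite -[n]opprK; apply: subB => //; exact: subN. Qed.

Definition sub_zero := SubType (sub0 S).
Definition sub_opp (m : sub_type) := SubType (subN (sub_valP m)).
Definition sub_add (m n : sub_type) := SubType (subD (sub_valP m) (sub_valP n)).

Lemma sub_addA : associative sub_add.
Proof. by move=> m n p; apply: sub_val_inj; exact: addrA. Qed.
Lemma sub_addC : commutative sub_add.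
Proof. by move=> m n; apply: sub_val_inj; exact: addrC. Qed.
Lemma sub_add0 : left_id sub_zero sub_add.
Proof. by move=> m; apply: sub_val_inj; exact: add0r. Qed.
Lemma sub_addN : left_inverse sub_zero sub_opp sub_add.
Proof. by move=> m; apply: sub_val_inj; exact: addNr. Qed.

HB.instance Definition _ :=
  GRing.isZmodule.Build sub_type sub_addA sub_addC sub_add0 sub_addN.

Definition sub_lact a (m : sub_type) := SubType (sub_l a (sub_valP m)).
Definition sub_ract (m : sub_type) a := SubType (sub_r a (sub_valP m)).

Definition sub_bimod : bimodule.
Proof.
by refine (@Bimodule sub_type sub_lact sub_ract _ _ _ _ _ _ _ _ _ _) => *;
  apply: sub_val_inj;
  [ exact: lactDl | exact: lactDr | exact: lact1 | exact: lactM
  | exact: ractDr | exact: ractDl | exact: ract1 | exact: ractM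
  | exact: lractA | exact: bimod_central].
Defined.

End SubBimodule.

Section QuotientBimodule.
Variables (M : bimodule) (S : sub_bimodule M).

Definition sub_bool : {pred M} := fun m => `[< S m >].

Lemma sub_bool_closed : zmod_closed sub_bool.
Proof.
split=> [|m n /asboolP mS /asboolP nS]; apply/asboolP; first exact: sub0.
exact: subB.
Qed.

HB.instance Definition _ := GRing.isZmodClosed.Build (bimod_carrier M) sub_bool sub_bool_closed.

Definition quot_type := Quotient.quot (sub_bool : zmodClosed M).

HB.instance Definition _ := GRing.Zmodule.on quot_type.

Definition quot_pi (m : M) : quot_type := \pi m.

Lemma quot_piP m n : quot_pi m = quot_pi n <-> S (m - n).
Proof.
rewrite /quot_pi; split=> [/eqP|mn].
  by rewrite -Quotient.idealrBE => /asboolP.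
by apply/eqP; rewrite -Quotient.idealrBE; apply/asboolP.
Qed.

Lemma quot_piD m n : quot_pi (m + n) = quot_pi m + quot_pi n.
Proof. exact: (Quotient.pi_add (sub_bool : zmodClosed M)). Qed.

Definition quot_lact a (t : quot_type) := quot_pi (lact a (repr t)).
Definition quot_ract (t : quot_type) a := quot_pi (ract (repr t) a).

Lemma quot_reprK (t : quot_type) : quot_pi (repr t) = t.
Proof. exact: reprK. Qed.

Lemma quot_lactE a m : quot_lact a (quot_pi m) = quot_pi (lact a m).
Proof.
by apply/quot_piP; rewrite -lactB; apply: sub_l; apply/quot_piP/quot_reprK.
Qed.

Lemma quot_ractE m a : quot_ract (quot_pi m) a = quot_pi (ract m a).
Proof.
by apply/quot_piP; rewrite -ractB; apply: sub_r; apply/quot_piP/quot_reprK.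
Qed.

Lemma quot_ind (P : quot_type -> Prop) :
  (forall m, P (quot_pi m)) -> forall t, P t.
Proof. by move=> Pm t; rewrite -[t]quot_reprK. Qed.

Definition quot_bimod : bimodule.
Proof.
refine (@Bimodule quot_type quot_lact quot_ract _ _ _ _ _ _ _ _ _ _).
- by move=> a b; elim/quot_ind=> m; rewrite !quot_lactE lactDl quot_piD.
- move=> a; elim/quot_ind=> m; elim/quot_ind=> n.
  by rewrite -quot_piD !quot_lactE lactDr quot_piD.
- by elim/quot_ind=> m; rewrite quot_lactE lact1.
- by move=> a b; elim/quot_ind=> m; rewrite !quot_lactE lactM.
- by elim/quot_ind=> m a b; rewrite !quot_ractE ractDr quot_piD.
- elim/quot_ind=> m; elim/quot_ind=> n a.
  by rewrite -quot_piD !quot_ractE ractDl quot_piD.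
- by elim/quot_ind=> m; rewrite quot_ractE ract1.
- by elim/quot_ind=> m a b; rewrite !quot_ractE ractM.
- move=> a; elim/quot_ind=> m b.
  by rewrite quot_lactE !quot_ractE quot_lactE lractA.
- by move=> c; elim/quot_ind=> m; rewrite quot_lactE quot_ractE bimod_central.
Defined.

End QuotientBimodule.

Definition regular_bimod : bimodule.
Proof.
refine (@Bimodule B (fun a m => a * m) (fun m b => m * b) _ _ _ _ _ _ _ _ _ _).
- by move=> *; rewrite mulrDl.
- by move=> *; rewrite mulrDr.
- by move=> *; rewrite mul1r.
- by move=> *; rewrite mulrA.
- by move=> *; rewrite mulrDr.
- by move=> *; rewrite mulrDl.
- by move=> *; rewrite mulr1.
- by move=> *; rewrite mulrA.
- by move=> *; rewrite mulrA.
- by move=> *; rewrite -pz_scalerAl -pz_scalerAr mul1r mulr1.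
Defined.

Lemma alg_homZ1 (nu : B -> B) (c : k) : is_alg_hom nu -> nu (c *: (1 : B)) = c *: (1 : B).
Proof.
move=> [nul [nu1 _]].
have nu0 : nu 0 = 0.
  by apply: (addrI (nu 0)); rewrite addr0 -{1}[nu 0]scale1r -nul scale1r addr0.
by rewrite -[c *: (1 : B)]addr0 nul nu0 nu1.
Qed.

(* M^nu, with action a . m . b = a m nu(b) *)
Definition twist_bimod (M : bimodule) (nu : alg_aut B) : bimodule.
Proof.
refine (@Bimodule M (@lact M) (fun m b => ract m (nu b)) _ _ _ _ _ _ _ _ _ _).
- exact: lactDl.
- exact: lactDr.
- exact: lact1.
- exact: lactM.
- move=> m a b; have [nul _] := aut_hom nu.
  by rewrite -[a]scale1r nul !scale1r ractDr.
- by move=> *; exact: ractDl.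
- by move=> m; have [_ [nu1 _]] := aut_hom nu; rewrite nu1 ract1.
- by move=> m a b; have [_ [_ nuM]] := aut_hom nu; rewrite nuM ractM.
- by move=> *; exact: lractA.
- by move=> c m; rewrite (alg_homZ1 _ (aut_hom nu)) bimod_central.
Defined.

Lemma mull_linear (a : B) : linear (fun m : B => a * m).
Proof. by move=> c m n; rewrite mulrDr pz_scalerAr. Qed.
Lemma mulr_linear (b : B) : linear (fun m : B => m * b).
Proof. by move=> c m n; rewrite mulrDl pz_scalerAl. Qed.
Lemma id_linear : linear (fun m : B => m).
Proof. by []. Qed.

Local Notation BB := (tensor B B).

(* tm acts on the first tensor factor and tn on the second, by left (l) or
   right (r) multiplication. *)
Definition tmull (a : B) : BB -> BB :=
  tensor_map (fun m : B => a * m) (fun n : B => n).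
Definition tmulr (b : B) : BB -> BB :=
  tensor_map (fun m : B => m * b) (fun n : B => n).
Definition tnull (a : B) : BB -> BB :=
  tensor_map (fun m : B => m) (fun n : B => a * n).
Definition tnulr (b : B) : BB -> BB :=
  tensor_map (fun m : B => m) (fun n : B => n * b).

Lemma tmullE a m n : tmull a (tens m n) = tens (a * m) n.
Proof. exact: tensor_mapE (mull_linear a) id_linear. Qed.
Lemma tmulrE a m n : tmulr a (tens m n) = tens (m * a) n.
Proof. exact: tensor_mapE (mulr_linear a) id_linear. Qed.
Lemma tnullE a m n : tnull a (tens m n) = tens m (a * n).
Proof. exact: tensor_mapE id_linear (mull_linear a). Qed.
Lemma tnulrE a m n : tnulr a (tens m n) = tens m (n * a).
Proof. exact: tensor_mapE id_linear (mulr_linear a). Qed.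

Lemma tmullD a : {morph tmull a : t u / t + u}.
Proof. exact: tensor_mapD (mull_linear a) id_linear. Qed.
Lemma tmulrD a : {morph tmulr a : t u / t + u}.
Proof. exact: tensor_mapD (mulr_linear a) id_linear. Qed.
Lemma tnullD a : {morph tnull a : t u / t + u}.
Proof. exact: tensor_mapD id_linear (mull_linear a). Qed.
Lemma tnulrD a : {morph tnulr a : t u / t + u}.
Proof. exact: tensor_mapD id_linear (mulr_linear a). Qed.

Lemma tens_ext (g h : BB -> BB) :
  {morph g : t u / t + u} -> {morph h : t u / t + u} ->
  (forall m n, g (tens m n) = h (tens m n)) -> forall t, g t = h t.
Proof. exact: tensor_lift_uniq. Qed.

Local Ltac tens_additive :=
  let t := fresh "t" in let u := fresh "u" in
  move=> t u; rewrite ?(tmullD, tmulrD, tnullD, tnulrD) //; exact: addrACA.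
Local Ltac tens_by :=
  apply: tens_ext; [tens_additive | tens_additive | move=> m n].

Let tensD := @tens_balanced k B B.

Lemma tmull_addl a b t : tmull (a + b) t = tmull a t + tmull b t.
Proof. by move: t; tens_by; rewrite !tmullE mulrDl (balancedDl tensD). Qed.
Lemma tmull1 t : tmull 1 t = t.
Proof. by move: t; tens_by; rewrite tmullE mul1r. Qed.
Lemma tmullM a b t : tmull (a * b) t = tmull a (tmull b t).
Proof. by move: t; tens_by; rewrite !tmullE mulrA. Qed.
Lemma tmulr_addr a b t : tmulr (a + b) t = tmulr a t + tmulr b t.
Proof. by move: t; tens_by; rewrite !tmulrE mulrDr (balancedDl tensD). Qed.
Lemma tmulr1 t : tmulr 1 t = t.
Proof. by move: t; tens_by; rewrite tmulrE mulr1. Qed.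
Lemma tmulrM a b t : tmulr (a * b) t = tmulr b (tmulr a t).
Proof. by move: t; tens_by; rewrite !tmulrE mulrA. Qed.
Lemma tnull_addl a b t : tnull (a + b) t = tnull a t + tnull b t.
Proof. by move: t; tens_by; rewrite !tnullE mulrDl (balancedDr tensD). Qed.
Lemma tnull1 t : tnull 1 t = t.
Proof. by move: t; tens_by; rewrite tnullE mul1r. Qed.
Lemma tnullM a b t : tnull (a * b) t = tnull a (tnull b t).
Proof. by move: t; tens_by; rewrite !tnullE mulrA. Qed.
Lemma tnulr_addr a b t : tnulr (a + b) t = tnulr a t + tnulr b t.
Proof. by move: t; tens_by; rewrite !tnulrE mulrDr (balancedDr tensD). Qed.
Lemma tnulr1 t : tnulr 1 t = t.
Proof. by move: t; tens_by; rewrite tnulrE mulr1. Qed.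
Lemma tnulrM a b t : tnulr (a * b) t = tnulr b (tnulr a t).
Proof. by move: t; tens_by; rewrite !tnulrE mulrA. Qed.

Lemma tmull_tnulr a b t : tmull a (tnulr b t) = tnulr b (tmull a t).
Proof. by move: t; tens_by; rewrite !(tmullE, tnulrE). Qed.
Lemma tmulr_tnull a b t : tmulr a (tnull b t) = tnull b (tmulr a t).
Proof. by move: t; tens_by; rewrite !(tmulrE, tnullE). Qed.
Lemma tmull_tmulr a b t : tmull a (tmulr b t) = tmulr b (tmull a t).
Proof. by move: t; tens_by; rewrite !(tmullE, tmulrE) mulrA. Qed.
Lemma tmull_tnull a b t : tmull a (tnull b t) = tnull b (tmull a t).
Proof. by move: t; tens_by; rewrite !(tmullE, tnullE). Qed.
Lemma tnulr_tmulr a b t : tnulr a (tmulr b t) = tmulr b (tnulr a t).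
Proof. by move: t; tens_by; rewrite !(tnulrE, tmulrE). Qed.
Lemma tnulr_tnull a b t : tnulr a (tnull b t) = tnull b (tnulr a t).
Proof. by move: t; tens_by; rewrite !(tnulrE, tnullE) mulrA. Qed.
Lemma tmull_tnulrZ (c : k) t :
  tmull (c *: (1 : B)) t = tnulr (c *: (1 : B)) t.
Proof.
move: t; tens_by; rewrite tmullE tnulrE -pz_scalerAl -pz_scalerAr mul1r mulr1.
exact: (balancedZ tensD).
Qed.
Lemma tnull_tmulrZ (c : k) t :
  tnull (c *: (1 : B)) t = tmulr (c *: (1 : B)) t.
Proof.
move: t; tens_by; rewrite tnullE tmulrE -pz_scalerAl -pz_scalerAr mul1r mulr1.
by rewrite (balancedZ tensD).
Qed.

(* B (x) B with a . (m (x) n) . b = am (x) nb *)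
Definition outer_bimod : bimodule :=
  @Bimodule BB tmull (fun t b => tnulr b t)
    tmull_addl tmullD tmull1 tmullM
    (fun t a b => tnulr_addr a b t) (fun t u b => tnulrD b t u)
    tnulr1 (fun t a b => tnulrM a b t)
    (fun a t b => esym (tmull_tnulr a b t)) tmull_tnulrZ.

(* B (x) B with a . (m (x) n) . b = mb (x) an *)
Definition inner_bimod : bimodule :=
  @Bimodule BB tnull (fun t b => tmulr b t)
    tnull_addl tnullD tnull1 tnullM
    (fun t a b => tmulr_addr a b t) (fun t u b => tmulrD b t u)
    tmulr1 (fun t a b => tmulrM a b t)
    (fun a t b => tmulr_tnull b a t) tnull_tmulrZ.

(* Hom_{B^e}(M, B (x) B), taken with respect to the outer structure, as a
   bimodule through the inner structure. *)
Section Dual.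
Variable M : bimodule.

Definition dual_type := bimod_hom M outer_bimod.

HB.instance Definition _ := gen_eqMixin dual_type.
HB.instance Definition _ := gen_choiceMixin dual_type.

Lemma dual_zeroP : @is_bimod_hom M outer_bimod (fun=> 0).
Proof.
split=> [m n|a m|m a]; first by rewrite addr0.
  by rewrite (lact0 outer_bimod).
by rewrite (ract0 outer_bimod).
Qed.
Lemma dual_oppP (f : dual_type) : @is_bimod_hom M outer_bimod (fun m => - f m).
Proof.
have [fD fl fr] := bhomP f; split=> [m n|a m|m a].
- by rewrite fD opprD.
- by rewrite fl lactN.
- by rewrite fr ractN.
Qed.
Lemma dual_addP (f g : dual_type) :
  @is_bimod_hom M outer_bimod (fun m => f m + g m).
Proof.
have [fD fl fr] := bhomP f; have [gD gl gr] := bhomP g.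
split=> [m n|a m|m a].
- by rewrite fD gD addrACA.
- by rewrite fl gl lactDr.
- by rewrite fr gr ractDl.
Qed.

Definition dual_zero : dual_type := BimodHom dual_zeroP.
Definition dual_opp (f : dual_type) : dual_type := BimodHom (dual_oppP f).
Definition dual_add (f g : dual_type) : dual_type := BimodHom (dual_addP f g).

Lemma dual_addA : associative dual_add.
Proof. by move=> f g h; apply: bhom_eq => m; exact: addrA. Qed.
Lemma dual_addC : commutative dual_add.
Proof. by move=> f g; apply: bhom_eq => m; exact: addrC. Qed.
Lemma dual_add0 : left_id dual_zero dual_add.
Proof. by move=> f; apply: bhom_eq => m; exact: add0r. Qed.
Lemma dual_addN : left_inverse dual_zero dual_opp dual_add.
Proof. by move=> f; apply: bhom_eq => m; exact: addNr. Qed.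

HB.instance Definition _ :=
  GRing.isZmodule.Build dual_type dual_addA dual_addC dual_add0 dual_addN.

Lemma dual_lactP a (f : dual_type) :
  @is_bimod_hom M outer_bimod (fun m => tnull a (f m)).
Proof.
have [fD fl fr] := bhomP f; split=> [m n|b m|m b].
- by rewrite fD tnullD.
- by rewrite fl /= tmull_tnull.
- by rewrite fr /= tnulr_tnull.
Qed.
Lemma dual_ractP (f : dual_type) a :
  @is_bimod_hom M outer_bimod (fun m => tmulr a (f m)).
Proof.
have [fD fl fr] := bhomP f; split=> [m n|b m|m b].
- by rewrite fD tmulrD.
- by rewrite fl /= tmull_tmulr.
- by rewrite fr /= tnulr_tmulr.
Qed.

Definition dual_lact a (f : dual_type) : dual_type := BimodHom (dual_lactP a f).
Definition dual_ract (f : dual_type) a : dual_type := BimodHom (dual_ractP f a).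

Definition dual_bimod : bimodule.
Proof.
by refine (@Bimodule dual_type dual_lact dual_ract _ _ _ _ _ _ _ _ _ _) => *;
  apply: bhom_eq => p;
  [ exact: (@lactDl inner_bimod) | exact: (@lactDr inner_bimod)
  | exact: (@lact1 inner_bimod) | exact: (@lactM inner_bimod)
  | exact: (@ractDr inner_bimod) | exact: (@ractDl inner_bimod)
  | exact: (@ract1 inner_bimod) | exact: (@ractM inner_bimod)
  | exact: (@lractA inner_bimod)
  | exact: (@bimod_central inner_bimod)].
Defined.

End Dual.

Lemma bhom_compP (M N P : bimodule) (g : bimod_hom N P) (f : bimod_hom M N) :
  is_bimod_hom (fun m => g (f m)).
Proof.
by split=> *; rewrite ?(bhomD (bhomP _)) ?(bhom_l (bhomP _)) ?(bhom_r (bhomP _)).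
Qed.

Definition bhom_comp (M N P : bimodule) (g : bimod_hom N P)
  (f : bimod_hom M N) : bimod_hom M P := BimodHom (bhom_compP g f).

Record proj_resolution (M : bimodule) := ProjResolution {
  res_obj :> nat -> bimodule;
  res_d : forall n, bimod_hom (res_obj n.+1) (res_obj n);
  res_aug : bimod_hom (res_obj 0%N) M;
  res_proj : forall n, bimod_projective (res_obj n);
  res_aug_surj : forall m, exists p, res_aug p = m;
  res_exact0 : forall p, res_aug p = 0 <-> exists q, res_d 0%N q = p;
  res_exactS : forall n p,
    res_d n p = 0 <-> exists q, res_d n.+1 q = p }.

(* Ext_env P n is the n-th cohomology of Hom_{B^e}(P, B (x) B), that is
   Ext^n_{B^e}(M, B^e), computed with the projective resolution P of M. *)
Section Ext.
Variables (M : bimodule) (P : proj_resolution M) (n : nat).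

Definition is_cocycle (f : dual_bimod (P n)) : Prop :=
  forall p, f (res_d P n p) = 0.

Definition is_coboundary : dual_bimod (P n) -> Prop :=
  match n with
  | 0%N => fun f => f = 0
  | m.+1 => fun f => exists g : dual_bimod (P m), f = bhom_comp g (res_d P m)
  end.

Lemma is_cocycle_closed :
  [/\ is_cocycle 0, forall f g, is_cocycle f -> is_cocycle g -> is_cocycle (f - g),
      forall a f, is_cocycle f -> is_cocycle (lact a f)
    & forall f a, is_cocycle f -> is_cocycle (ract f a)].
Proof.
split=> [p|f g fz gz p|a f fz p|f a fz p] //=.
- by rewrite fz gz subrr.
- by rewrite fz; exact: (@lact0 inner_bimod a).
- by rewrite fz; exact: (@ract0 inner_bimod a).
Qed.

Definition cocycles : sub_bimodule (dual_bimod (P n)).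
Proof.
by refine (@SubBimodule (dual_bimod (P n)) is_cocycle _ _ _ _);
  case: is_cocycle_closed.
Defined.

Lemma is_coboundary_closed :
  [/\ is_coboundary 0,
      forall f g, is_coboundary f -> is_coboundary g -> is_coboundary (f - g),
      forall a f, is_coboundary f -> is_coboundary (lact a f)
    & forall f a, is_coboundary f -> is_coboundary (ract f a)].
Proof.
rewrite /is_coboundary; case: n => [|m].
  split=> [|f g -> ->|a f ->|f a ->] //; first exact: subrr.
    exact: lact0.
  exact: ract0.
split=> [|f g [f' ->] [g' ->]|a f [f' ->]|f a [f' ->]].
- by exists 0; apply: bhom_eq.
- by exists (f' - g'); apply: bhom_eq.
- by exists (lact a f'); apply: bhom_eq.
- by exists (ract f' a); apply: bhom_eq.
Qed.

Definition coboundaries : sub_bimodule (sub_bimod cocycles).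
Proof.
by refine (@SubBimodule (sub_bimod cocycles)
    (fun z => is_coboundary (sub_val z)) _ _ _ _);
  case: is_coboundary_closed => b0 bB bl br *;
  [exact: b0 | exact: bB | exact: bl | exact: br].
Defined.

Definition Ext_env : bimodule := quot_bimod coboundaries.

End Ext.

Definition homologically_smooth : Prop :=
  exists P : proj_resolution regular_bimod,
    (exists N : nat, forall n, (N < n)%N -> bimod_zero (P n)) /\
    (forall n, bimod_fg (P n)).

Definition twisted_CY (nu : alg_aut B) (d : nat) : Prop :=
  homologically_smooth /\
  forall P : proj_resolution regular_bimod,
    (forall i, i <> d -> bimod_zero (Ext_env P i)) /\
    bimod_iso (Ext_env P d) (twist_bimod regular_bimod nu).

End Bimodules.

Arguments twisted_CY {k B} nu d.
Arguments homologically_smooth {k} B.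

(* Main.v *)
From HB Require Import structures.
Require Import Defs.
From mathcomp Require Import all_boot all_order all_algebra.
From mathcomp Require Import boolp.

(** The idea. Write [t] for the inverse of [sigma], and
    [F M = E (x)_A M (x)_A E] for the [E]-bimodule induced from an [A]-bimodule
    [M]. There is a Koszul sequence of [E]-bimodules
      [0 -> F (tA) -> F A -> E -> 0],
    where [tA] is [A] with its left action twisted by [t], the first map sends
    [1 (x) 1 (x) 1] to [x (x) 1 (x) 1 - 1 (x) 1 (x) x], and the second is the
    multiplication; it is exact by [koszul_inj], [mult_surj] and [mult_exact].
    The algebra [E] is free on the powers of [x] both as a left and as a right
    [A]-module, so [F] is exact ([ind_exact]). Hence a resolution [P] of [A] by
    finitely generated projectives gives such resolutions of [F A] and of
    [F (tA)], and the mapping cone of a lift of the Koszul map resolves [E]. This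
    proves that [E] is homologically smooth.

    For its outer structure [E (x) E] is the direct sum of the copies
    [A x^i (x) x^j A] of [A (x) A], so a cochain on [F P] with values in
    [E (x) E] amounts to finitely many cochains on [P] with values in
    [A (x) A]. It follows that the cohomology of [F P] vanishes outside degree
    [d] ([ind_ext_vanish]), and that in degree [d] it is a free left [E]-module
    on the elements [W0 x^i], where [W0] comes from the generator [w] of
    [Ext^d(A, A^e)] ([ind_ext_span], [ind_ext_free]). The same holds for the
    twist of [P], with another generator [W]. By the long exact sequence of the
    cone, everything is decided by the map [psi] between these two modules: if
    it is injective, then Ext of [E] vanishes outside degree [d + 1], where it
    is the cokernel of [psi] ([cone_vanish], [cone_connecting]).

    To compute [psi], the Koszul map is lifted to a chain map with values in the
    elements of degree at most one in [x]. It has the form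
    [p |-> x alpha(p) + gamma(p) - beta(p) x], where [alpha] lifts the identity
    of [A] and [beta], which is semilinear over [sigma], lifts [sigma]. Both are
    homotopy equivalences, so the two cocycles obtained from [w alpha] and
    [w beta] are free generators of the same left [A]-module and differ by a
    unit [u]. With [W] taken from [beta], this gives
    [psi W0 = u W x + (c - x) W] for some [c] in [A] ([pull_generator_class]).
    As [u] is a unit, division by the leading term shows that [psi] is
    injective and that its cokernel is the free left module on the image [om] of
    [W] ([ore_cokernel_free], [ore_cokernel_span]).

    A bimodule that is free of rank one on [om] as a left module is a twist of
    the regular one by the endomorphism [nu'] with [om e = nu'(e) om]
    ([right_action_endo], [twist_iso]). Here [nu'(a) = t(nu(a))] for [a] in [A],
    since [beta] is semilinear, and the relation [psi W0 = 0] in the cokernel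
    gives [nu'(x) = v x - v c], where [v] is the inverse of [u]. An endomorphism
    of this form is bijective, by comparison of leading coefficients
    ([ore_endo_bij]). *)

Set Implicit Arguments.
Unset Strict Implicit.
Unset Printing Implicit Defensive.

Import GRing.Theory.
Local Open Scope ring_scope.
Local Open Scope quotient_scope.

(** * Algebra homomorphisms *)

Section AlgHom.
Variables (k : comPzRingType) (A B : pzAlgType k) (f : A -> B).
Hypothesis fP : is_alg_hom f.

Lemma alg_homD a b : f (a + b) = f a + f b.
Proof. by case: fP => fl _; rewrite -[a]scale1r fl !scale1r. Qed.
Lemma alg_hom0 : f 0 = 0.
Proof. by apply: (addrI (f 0)); rewrite -alg_homD !addr0. Qed.
Lemma alg_homN a : f (- a) = - f a.
Proof. by apply: (addrI (f a)); rewrite -alg_homD !subrr alg_hom0. Qed.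
Lemma alg_homB a b : f (a - b) = f a - f b.
Proof. by rewrite alg_homD alg_homN. Qed.
Lemma alg_hom1 : f 1 = 1.
Proof. by case: fP => _ []. Qed.
Lemma alg_homM a b : f (a * b) = f a * f b.
Proof. by case: fP => _ [_ fM]; exact: fM. Qed.
Lemma alg_homZ c a : f (c *: a) = c *: f a.
Proof. by case: fP => fl _; rewrite -[c *: a]addr0 fl alg_hom0 addr0. Qed.
Lemma alg_homX a n : f (a ^+ n) = f a ^+ n.
Proof. by elim: n => [|n IH]; rewrite ?expr0 ?alg_hom1 // !exprS alg_homM IH. Qed.
Lemma alg_hom_sum (I : Type) (r : seq I) (F : I -> A) :
  f (\sum_(i <- r) F i) = \sum_(i <- r) f (F i).
Proof. exact: (big_morph f alg_homD alg_hom0). Qed.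

End AlgHom.

Section Aut.
Variables (k : comPzRingType) (A : pzAlgType k).

Lemma aut_inv_hom (nu : alg_aut A) : is_alg_hom (aut_inv nu).
Proof.
have nuP := aut_hom nu; have nuI := can_inj (autK nu).
split=> [c a b|]; last split=> [|a b]; apply: nuI.
- by rewrite (alg_homD nuP) (alg_homZ nuP) !autVK.
- by rewrite autVK (alg_hom1 nuP).
- by rewrite (alg_homM nuP) !autVK.
Qed.

Definition inv_aut (nu : alg_aut A) : alg_aut A :=
  AlgAut (aut_inv_hom nu) (autVK nu) (autK nu).

Lemma id_alg_hom : is_alg_hom (@id A).
Proof. by []. Qed.

Definition id_aut : alg_aut A :=
  @AlgAut k A id id id_alg_hom (fun=> erefl) (fun=> erefl).

End Aut.

(** * Constructions on bimodules *)

Section BimodHoms.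
Variables (k : comPzRingType) (B : pzAlgType k).
Implicit Types M N P : bimodule B.

Lemma bhomB M N (f : bimod_hom M N) m n : f (m - n) = f m - f n.
Proof. by apply: (addIr (f n)); rewrite -(bhomD (bhomP f)) !subrK. Qed.
Lemma bhomN M N (f : bimod_hom M N) m : f (- m) = - f m.
Proof. by rewrite -sub0r bhomB bhom0 sub0r. Qed.
Lemma bhomDE M N (f : bimod_hom M N) m n : f (m + n) = f m + f n.
Proof. exact: bhomD (bhomP f) m n. Qed.
Lemma bhom_lE M N (f : bimod_hom M N) a m : f (lact a m) = lact a (f m).
Proof. exact: bhom_l (bhomP f) a m. Qed.
Lemma bhom_rE M N (f : bimod_hom M N) a m : f (ract m a) = ract (f m) a.
Proof. exact: bhom_r (bhomP f) m a. Qed.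
Lemma bhom_sum M N (f : bimod_hom M N) (I : Type) (r : seq I) (F : I -> M) :
  f (\sum_(i <- r) F i) = \sum_(i <- r) f (F i).
Proof. exact: (big_morph f (bhomDE f) (bhom0 f)). Qed.
Lemma lact0l M (m : M) : lact 0 m = 0.
Proof. by apply: (addrI (lact 0 m)); rewrite -lactDl !addr0. Qed.
Lemma ract0r M (m : M) : ract m 0 = 0.
Proof. by apply: (addrI (ract m 0)); rewrite -ractDr !addr0. Qed.
Lemma lactNl M a (m : M) : lact (- a) m = - lact a m.
Proof. by apply: (addrI (lact a m)); rewrite -lactDl !subrr lact0l. Qed.
Lemma lactBl M a b (m : M) : lact (a - b) m = lact a m - lact b m.
Proof. by rewrite lactDl lactNl. Qed.

Lemma bhom_idP M : is_bimod_hom (fun m : M => m).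
Proof. by []. Qed.
Definition bhom_id M := BimodHom (bhom_idP M).

Lemma bhom_zeroP M N : is_bimod_hom (fun _ : M => 0 : N).
Proof. by split=> *; rewrite ?addr0 ?lact0 ?ract0. Qed.
Definition bhom_zero M N := BimodHom (bhom_zeroP M N).

Lemma bhom_addP M N (f g : bimod_hom M N) : is_bimod_hom (fun m => f m + g m).
Proof.
split=> *; rewrite ?bhomDE ?bhom_lE ?bhom_rE ?lactDr ?ractDl //.
exact: addrACA.
Qed.
Definition bhom_add M N (f g : bimod_hom M N) := BimodHom (bhom_addP f g).

Lemma bhom_oppP M N (f : bimod_hom M N) : is_bimod_hom (fun m => - f m).
Proof. by split=> *; rewrite ?bhomDE ?bhom_lE ?bhom_rE ?lactN ?ractN ?opprD. Qed.
Definition bhom_opp M N (f : bimod_hom M N) := BimodHom (bhom_oppP f).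
Definition bhom_sub M N (f g : bimod_hom M N) := bhom_add f (bhom_opp g).

Lemma bimod_iso_trans M N P : bimod_iso M N -> bimod_iso N P -> bimod_iso M P.
Proof.
move=> [f fb] [g gb]; exists (bhom_comp g f).
exact: (bij_comp gb fb).
Qed.

(** Projectivity only provides lifts against surjections; after replacing the
    target by the image of [g] it provides the lifts from which chain maps and
    homotopies are built. *)
Lemma projective_lift M N P (g : bimod_hom M N) (f : bimod_hom P N) :
  bimod_projective P -> (forall p, exists m, g m = f p) ->
  exists h : bimod_hom P M, forall p, g (h p) = f p.
Proof.
move=> Pproj gf.
have imP : [/\ exists m, g m = 0,
    forall n n', (exists m, g m = n) -> (exists m, g m = n') ->
                 exists m, g m = n - n',
    forall a n, (exists m, g m = n) -> exists m, g m = lact a n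
  & forall n a, (exists m, g m = n) -> exists m, g m = ract n a].
  split=> [|n n' [m <-] [m' <-]|a n [m <-]|n a [m <-]].
  - by exists 0; exact: bhom0.
  - by exists (m - m'); exact: bhomB.
  - by exists (lact a m); exact: bhom_lE.
  - by exists (ract m a); exact: bhom_rE.
case: imP => s0 sB sl sr.
pose S := @SubBimodule _ _ N (fun n => exists m, g m = n) s0 sB sl sr.
have gS m : S (g m) by exists m.
have fS p : S (f p) by exact: gf.
have g'P : @is_bimod_hom _ _ M (sub_bimod S) (fun m => Defs.SubType (gS m)).
  by split=> *; apply: sub_val_inj; rewrite /= ?bhomDE ?bhom_lE ?bhom_rE.
have f'P : @is_bimod_hom _ _ P (sub_bimod S) (fun p => Defs.SubType (fS p)).
  by split=> *; apply: sub_val_inj; rewrite /= ?bhomDE ?bhom_lE ?bhom_rE.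
have g'_surj (y : sub_bimod S) : exists m, BimodHom g'P m = y.
  have [m gm] : exists m, g m = sub_val y by exact: (sub_valP y).
  by exists m; apply: sub_val_inj.
have [h hP] := Pproj _ _ (BimodHom g'P) (BimodHom f'P) g'_surj.
by exists h => p; have /(congr1 (fun z => sub_val z)) := hP p.
Qed.

End BimodHoms.

(** Allowing both actions to be twisted covers the left twist of the Koszul
    sequence, and also turns maps that are semilinear over an automorphism into
    homomorphisms, so that the comparison theorem produces them. *)
Section Bitwist.
Variables (k : comPzRingType) (B : pzAlgType k) (l r : alg_aut B).

Definition bitwist (M : bimodule B) : bimodule B.
Proof.
refine (@Bimodule _ _ M (fun a m => lact (l a) m) (fun m b => ract m (r b))
  _ _ _ _ _ _ _ _ _ _) => *.
- by rewrite (alg_homD (aut_hom l)) lactDl.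
- exact: lactDr.
- by rewrite (alg_hom1 (aut_hom l)) lact1.
- by rewrite (alg_homM (aut_hom l)) lactM.
- by rewrite (alg_homD (aut_hom r)) ractDr.
- exact: ractDl.
- by rewrite (alg_hom1 (aut_hom r)) ract1.
- by rewrite (alg_homM (aut_hom r)) ractM.
- exact: lractA.
- by rewrite (alg_homZ1 _ (aut_hom l)) (alg_homZ1 _ (aut_hom r)) bimod_central.
Defined.

Lemma bitwist_homP (M N : bimodule B) (f : bimod_hom M N) :
  @is_bimod_hom _ _ (bitwist M) (bitwist N) f.
Proof. by split=> *; rewrite /= ?bhomDE ?bhom_lE ?bhom_rE. Qed.
Definition bitwist_hom (M N : bimodule B) (f : bimod_hom M N) :
  bimod_hom (bitwist M) (bitwist N) := BimodHom (bitwist_homP f).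

Lemma bitwist_fg (M : bimodule B) : bimod_fg M -> bimod_fg (bitwist M).
Proof.
move=> [gens gensP]; exists gens => m; have [t ->] := gensP m.
exists [seq (aut_inv l z.1.1, z.1.2, aut_inv r z.2) | z <- t].
by rewrite big_map; apply: eq_bigr => z _ /=; rewrite !autVK.
Qed.

End Bitwist.

Lemma bitwist_projective (k : comPzRingType) (B : pzAlgType k)
    (l r : alg_aut B) (P : bimodule B) :
  bimod_projective P -> bimod_projective (bitwist l r P).
Proof.
move=> Pproj M N g f gsurj.
have f'P : @is_bimod_hom _ _ P (bitwist (inv_aut l) (inv_aut r) N) f.
  split=> [m n|a m|m a] /=; first exact: (bhomDE f).
    by rewrite -(bhom_lE f) /= autVK.
  by rewrite -(bhom_rE f) /= autVK.
have [h hP] :=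
  Pproj _ _ (bitwist_hom (inv_aut l) (inv_aut r) g) (BimodHom f'P) gsurj.
have h'P : @is_bimod_hom _ _ (bitwist l r P) M h.
  split=> [m n|a m|m a] /=; first exact: (bhomDE h).
    by rewrite bhom_lE /= autK.
  by rewrite bhom_rE /= autK.
by exists (BimodHom h'P).
Qed.

Section DirectSum.
Variables (k : comPzRingType) (B : pzAlgType k).

Section Dsum.
Variables (M N : bimodule B).

Definition dsum : bimodule B.
Proof.
refine (@Bimodule _ _ (M * N)%type (fun a m => (lact a m.1, lact a m.2))
  (fun m a => (ract m.1 a, ract m.2 a)) _ _ _ _ _ _ _ _ _ _) => *.
- by rewrite !lactDl.
- by rewrite !lactDr.
- by rewrite !lact1 -surjective_pairing.
- by rewrite !lactM.
- by rewrite !ractDr.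
- by rewrite !ractDl.
- by rewrite !ract1 -surjective_pairing.
- by rewrite !ractM.
- by rewrite /= !lractA.
- by rewrite !bimod_central.
Defined.

Lemma dsum_inlP : @is_bimod_hom _ _ M dsum (fun m => (m, 0)).
Proof. by split=> *; rewrite /= ?lact0 ?ract0 //; congr pair; rewrite addr0. Qed.
Lemma dsum_inrP : @is_bimod_hom _ _ N dsum (fun n => (0, n)).
Proof. by split=> *; rewrite /= ?lact0 ?ract0 //; congr pair; rewrite addr0. Qed.
Definition dsum_inl : bimod_hom M dsum := BimodHom dsum_inlP.
Definition dsum_inr : bimod_hom N dsum := BimodHom dsum_inrP.

Lemma dsum_copairP (L : bimodule B) (f : bimod_hom M L) (g : bimod_hom N L) :
  @is_bimod_hom _ _ dsum L (fun m => f m.1 + g m.2).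
Proof.
split=> [m n|a m|m a] /=.
- by rewrite !bhomDE addrACA.
- by rewrite !bhom_lE lactDr.
- by rewrite !bhom_rE ractDl.
Qed.
Definition dsum_copair (L : bimodule B) (f : bimod_hom M L) (g : bimod_hom N L)
  : bimod_hom dsum L := BimodHom (dsum_copairP f g).

Lemma dsum_copair_eta (L : bimodule B) (f : bimod_hom dsum L) :
  f = dsum_copair (bhom_comp f dsum_inl) (bhom_comp f dsum_inr).
Proof.
apply: bhom_eq => -[m n] /=; rewrite -bhomDE; congr (bhom_fun f _).
by congr pair; rewrite ?addr0 ?add0r.
Qed.

Lemma dsum_projective :
  bimod_projective M -> bimod_projective N -> bimod_projective dsum.
Proof.
move=> Mp Np K L g f gsurj.
have [h hP] := Mp _ _ g (bhom_comp f dsum_inl) gsurj.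
have [h' h'P] := Np _ _ g (bhom_comp f dsum_inr) gsurj.
exists (dsum_copair h h') => p.
by rewrite [f]dsum_copair_eta /= bhomDE hP h'P.
Qed.

Lemma dsum_zero : bimod_zero M -> bimod_zero N -> bimod_zero dsum.
Proof. by move=> M0 N0 [m n]; rewrite (M0 m) (N0 n). Qed.

End Dsum.

Definition in_span (M : bimodule B) (gens : seq M) (m : M) : Prop :=
  exists t : seq (B * 'I_(size gens) * B),
    m = \sum_(z <- t) ract (lact z.1.1 gens`_z.1.2) z.2.

Lemma in_spanD (M : bimodule B) (gens : seq M) m n :
  in_span gens m -> in_span gens n -> in_span gens (m + n).
Proof. by move=> [s ->] [t ->]; exists (s ++ t); rewrite big_cat. Qed.

Lemma in_span_sub (M N : bimodule B) (f : bimod_hom M N) (gens : seq M)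
    (gens' : seq N) m :
  {subset [seq f g | g <- gens] <= gens'} ->
  in_span gens m -> in_span gens' (f m).
Proof.
move=> sub [t ->].
have idx (i : 'I_(size gens)) : exists j : 'I_(size gens'), gens'`_j = f gens`_i.
  have: f gens`_i \in gens' by apply/sub/map_f/mem_nth.
  by move=> /(nthP 0)[j js <-]; exists (Ordinal js).
exists [seq (z.1.1, sval (cid (idx z.1.2)), z.2) | z <- t].
rewrite big_map bhom_sum; apply: eq_bigr => z _ /=.
by rewrite bhom_rE bhom_lE; case: cid => j /= ->.
Qed.

Lemma dsum_fg (M N : bimodule B) : bimod_fg M -> bimod_fg N -> bimod_fg (dsum M N).
Proof.
move=> [gm gmP] [gn gnP].
pose gens := [seq dsum_inl M N g | g <- gm] ++ [seq dsum_inr M N g | g <- gn].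
exists gens => -[m n].
have -> : (m, n) = dsum_inl M N m + dsum_inr M N n.
  by congr pair; rewrite ?addr0 ?add0r.
apply: (@in_spanD (dsum M N)).
- by apply: (in_span_sub (f := dsum_inl M N)) (gmP m) => g gin; rewrite mem_cat gin.
- by apply: (in_span_sub (f := dsum_inr M N)) (gnP n) => g gin; rewrite mem_cat gin orbT.
Qed.

Lemma zero_sub_closed (M : bimodule B) :
  [/\ (0 : M) = 0, forall m n : M, m = 0 -> n = 0 -> m - n = 0,
      forall a (m : M), m = 0 -> lact a m = 0
    & forall (m : M) a, m = 0 -> ract m a = 0].
Proof.
by split=> [//|m n -> ->|a m ->|m a ->]; rewrite ?subrr ?lact0 ?ract0.
Qed.

Definition zero_bimod : bimodule B :=
  let: And4 s0 sB sl sr := zero_sub_closed (regular_bimod B) in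
  sub_bimod (@SubBimodule _ _ _ (fun m => m = 0) s0 sB sl sr).

Lemma zero_bimodP : bimod_zero zero_bimod.
Proof.
rewrite /zero_bimod; case: zero_sub_closed => s0 sB sl sr [m term0].
by apply: sub_val_inj.
Qed.

Lemma bimod_zero_projective (Z : bimodule B) : bimod_zero Z -> bimod_projective Z.
Proof.
move=> Z0 M N g f _; exists (bhom_zero Z M) => p.
by rewrite /= bhom0 (Z0 p) bhom0.
Qed.

Lemma bimod_zero_fg (Z : bimodule B) : bimod_zero Z -> bimod_fg Z.
Proof. by move=> Z0; exists [::] => m; exists [::]; rewrite big_nil (Z0 m). Qed.

End DirectSum.

(** * Comparison of resolutions *)

Section Complexes.
Variables (k : comPzRingType) (B : pzAlgType k).

Lemma res_dd (M : bimodule B) (P : proj_resolution M) n p :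
  res_d P n (res_d P n.+1 p) = 0.
Proof. by apply/res_exactS; exists p. Qed.

Lemma res_aug_d (M : bimodule B) (P : proj_resolution M) p :
  res_aug P (res_d P 0 p) = 0.
Proof. by apply/res_exact0; exists p. Qed.

Definition chain_map (S T : nat -> bimodule B)
    (dS : forall n, bimod_hom (S n.+1) (S n))
    (dT : forall n, bimod_hom (T n.+1) (T n))
    (phi : forall n, bimod_hom (S n) (T n)) : Prop :=
  forall n p, dT n (phi n.+1 p) = phi n (dS n p).

Section ChainLift.
Variables (M N : bimodule B) (P : proj_resolution M).
Variables (T : nat -> bimodule B) (dT : forall n, bimod_hom (T n.+1) (T n)).
Variable aT : bimod_hom (T 0%N) N.
Hypothesis aT_surj : forall y, exists t, aT t = y.
Hypothesis exact0 : forall t, aT t = 0 -> exists u, dT 0 u = t.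
Hypothesis exactS : forall n t, dT n t = 0 -> exists u, dT n.+1 u = t.
Variable f : bimod_hom M N.

Local Notation square n := {h : bimod_hom (P n) (T n) * bimod_hom (P n.+1) (T n.+1)
  | forall p, dT n (h.2 p) = h.1 (res_d P n p)}.

Lemma chain_lift_start : exists h : bimod_hom (P 0%N) (T 0%N),
  forall p, aT (h p) = f (res_aug P p).
Proof.
exact: (@projective_lift _ _ _ _ _ aT (bhom_comp f (res_aug P)) (@res_proj _ _ _ P 0)).
Qed.

Lemma chain_lift_next0 (h : bimod_hom (P 0%N) (T 0%N)) :
  (forall p, aT (h p) = f (res_aug P p)) ->
  exists h' : bimod_hom (P 1%N) (T 1%N), forall p, dT 0 (h' p) = h (res_d P 0 p).
Proof.
move=> hP.
apply: (@projective_lift _ _ _ _ _ (dT 0) (bhom_comp h (res_d P 0)) (@res_proj _ _ _ P 1)).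
by move=> p; apply: exact0; rewrite /= hP res_aug_d bhom0.
Qed.

Lemma chain_lift_next n (s : square n) :
  exists h : bimod_hom (P n.+2) (T n.+2),
    forall p, dT n.+1 (h p) = (sval s).2 (res_d P n.+1 p).
Proof.
apply: (@projective_lift _ _ _ _ _ (dT n.+1)
  (bhom_comp (sval s).2 (res_d P n.+1)) (@res_proj _ _ _ P n.+2)).
by move=> p; apply: exactS; rewrite /= (svalP s) res_dd bhom0.
Qed.

(** The target is an exact complex whose terms need not be projective: it will
    also be the subcomplex of elements of degree at most one of an induced
    resolution. *)
Lemma chain_lift : exists phi : forall n, bimod_hom (P n) (T n),
  (forall p, aT (phi 0%N p) = f (res_aug P p)) /\ chain_map (res_d P) dT phi.
Proof.
have [h0 h0P] := chain_lift_start.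
have [h1 h1P] := chain_lift_next0 h0P.
pose step n (s : square n) : square n.+1 :=
  let h := cid (chain_lift_next s) in
  exist _ ((sval s).2, sval h) (svalP h).
pose squares := fix F n : square n :=
  match n with 0%N => exist _ (h0, h1) h1P | n'.+1 => step n' (F n') end.
exists (fun n => (sval (squares n)).1); split=> // n p.
exact: (svalP (squares n)).
Qed.

End ChainLift.

Section Homotopy.
Variables (M N : bimodule B) (P : proj_resolution M) (T : proj_resolution N).
Variable phi : forall n, bimod_hom (P n) (T n).
Hypothesis phi_chain : chain_map (res_d P) (res_d T) phi.
Hypothesis phi_aug : forall p, res_aug T (phi 0 p) = 0.

Lemma null_homotopy0 : exists s : bimod_hom (P 0%N) (T 1%N),
  forall p, res_d T 0 (s p) = phi 0 p.
Proof.
by apply: (projective_lift (@res_proj _ _ _ P 0)) => p; apply/res_exact0.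
Qed.

Lemma null_homotopy_next n (s : bimod_hom (P n) (T n.+1)) :
  (forall p, res_d T n (s (res_d P n p)) = phi n (res_d P n p)) ->
  exists s' : bimod_hom (P n.+1) (T n.+2), forall p,
    phi n.+1 p = res_d T n.+1 (s' p) + s (res_d P n p).
Proof.
move=> sP.
have [|s' s'P] := @projective_lift _ _ _ _ _ (res_d T n.+1)
    (bhom_sub (phi n.+1) (bhom_comp s (res_d P n))) (@res_proj _ _ _ P n.+1).
  by move=> p; apply/res_exactS; rewrite /= bhomB phi_chain sP subrr.
by exists s' => p; rewrite s'P /= subrK.
Qed.

(** Induction on the degree: [phi - s d] takes values in the cycles as soon as
    the preceding stage satisfies the homotopy equation on boundaries, and then
    projectivity gives the next [s]. *)
Lemma null_homotopyS n :
  exists s : bimod_hom (P n) (T n.+1), exists s' : bimod_hom (P n.+1) (T n.+2),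
  forall p, phi n.+1 p = res_d T n.+1 (s' p) + s (res_d P n p).
Proof.
elim: n => [|n [s [s' s'P]]].
  have [s sP] := null_homotopy0; exists s.
  by apply: null_homotopy_next => p; rewrite sP.
exists s'; apply: null_homotopy_next => p.
by rewrite s'P res_dd bhom0 addr0.
Qed.

End Homotopy.

End Complexes.

(** * Functoriality of Ext *)

Section ExtClasses.
Variables (k : comPzRingType) (B : pzAlgType k).

Section Classes.
Variables (M : bimodule B) (P : proj_resolution M) (n : nat).

Lemma is_coboundary0 : is_coboundary (0 : dual_bimod (P n)).
Proof. by case: (is_coboundary_closed P n). Qed.
Lemma is_coboundaryB (f g : dual_bimod (P n)) :
  is_coboundary f -> is_coboundary g -> is_coboundary (f - g).
Proof. by case: (is_coboundary_closed P n) => _ + _ _; exact. Qed.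
Lemma is_coboundaryN (f : dual_bimod (P n)) :
  is_coboundary f -> is_coboundary (- f).
Proof. by move=> fb; rewrite -sub0r; exact: is_coboundaryB is_coboundary0 fb. Qed.
Lemma is_coboundaryD (f g : dual_bimod (P n)) :
  is_coboundary f -> is_coboundary g -> is_coboundary (f + g).
Proof.
by move=> fb gb; rewrite -[g]opprK; exact: is_coboundaryB fb (is_coboundaryN gb).
Qed.
Lemma is_coboundary_l a (f : dual_bimod (P n)) :
  is_coboundary f -> is_coboundary (lact a f).
Proof. by case: (is_coboundary_closed P n) => _ _ + _; exact. Qed.
Lemma is_coboundary_r (f : dual_bimod (P n)) a :
  is_coboundary f -> is_coboundary (ract f a).
Proof. by case: (is_coboundary_closed P n) => _ _ _; exact. Qed.
Lemma is_coboundary_sum (I : Type) (r : seq I) (F : I -> dual_bimod (P n)) :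
  (forall i, is_coboundary (F i)) -> is_coboundary (\sum_(i <- r) F i).
Proof.
by move=> Fb; apply: (big_ind (@is_coboundary k B M P n));
  [exact: is_coboundary0 | exact: is_coboundaryD | move=> i _; exact: Fb].
Qed.

Lemma is_cocycle_l a (f : dual_bimod (P n)) :
  is_cocycle f -> is_cocycle (lact a f).
Proof. by case: (is_cocycle_closed P n) => _ _ + _; exact. Qed.
Lemma is_cocycle_r (f : dual_bimod (P n)) a :
  is_cocycle f -> is_cocycle (ract f a).
Proof. by case: (is_cocycle_closed P n) => _ _ _; exact. Qed.
Lemma is_cocycleB (f g : dual_bimod (P n)) :
  is_cocycle f -> is_cocycle g -> is_cocycle (f - g).
Proof. by case: (is_cocycle_closed P n) => _ + _ _; exact. Qed.
Lemma is_cocycle0 : is_cocycle (0 : dual_bimod (P n)).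
Proof. by case: (is_cocycle_closed P n). Qed.

Lemma is_cocycleD (f g : dual_bimod (P n)) :
  is_cocycle f -> is_cocycle g -> is_cocycle (f + g).
Proof.
move=> fz gz; rewrite -[g]opprK -[- g]sub0r.
by do 2?apply: is_cocycleB => //; exact: is_cocycle0.
Qed.

Lemma coboundary_cocycle (f : dual_bimod (P n)) : is_coboundary f -> is_cocycle f.
Proof.
move: f; rewrite /is_coboundary; case: n => [f ->|m f [g ->]]; first by [].
by move=> p /=; rewrite res_dd bhom0.
Qed.

Definition ext_cls (f : dual_bimod (P n)) (fz : is_cocycle f) : Ext_env P n :=
  @quot_pi _ _ _ (coboundaries P n) (@Defs.SubType _ _ _ (cocycles P n) f fz).

Lemma ext_cls_eq f g (fz : is_cocycle f) (gz : is_cocycle g) :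
  ext_cls fz = ext_cls gz <-> is_coboundary (f - g).
Proof. exact: quot_piP. Qed.

Lemma ext_clsP (t : Ext_env P n) : exists f, exists fz : is_cocycle f, t = ext_cls fz.
Proof.
by move: t; apply: (@quot_ind _ _ _ (coboundaries P n)) => -[f fz]; exists f, fz.
Qed.

Lemma ext_clsD f g (fz : is_cocycle f) (gz : is_cocycle g) fgz :
  ext_cls fz + ext_cls gz = @ext_cls (f + g) fgz.
Proof.
rewrite -[LHS](@quot_piD _ _ _ (coboundaries P n)); apply/quot_piP.
rewrite /=; have -> : f + g - (f + g) = 0 by rewrite subrr.
exact: is_coboundary0.
Qed.

Lemma ext_cls_l a f (fz : is_cocycle f) afz :
  lact a (ext_cls fz) = @ext_cls (lact a f) afz.
Proof.
rewrite [LHS](@quot_lactE _ _ _ (coboundaries P n)); apply/quot_piP => /=.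
have -> : lact a f - lact a f = 0 by rewrite subrr.
exact: is_coboundary0.
Qed.

Lemma ext_cls_r a f (fz : is_cocycle f) afz :
  ract (ext_cls fz) a = @ext_cls (ract f a) afz.
Proof.
rewrite [LHS](@quot_ractE _ _ _ (coboundaries P n)); apply/quot_piP => /=.
have -> : ract f a - ract f a = 0 by rewrite subrr.
exact: is_coboundary0.
Qed.

Lemma ext_cls0 f (fz : is_cocycle f) : ext_cls fz = 0 <-> is_coboundary f.
Proof.
have z0 : is_cocycle (0 + 0 : dual_bimod (P n)) by rewrite addr0; exact: is_cocycle0.
have -> : 0 = ext_cls is_cocycle0.
  apply: (addrI (ext_cls is_cocycle0)); rewrite addr0 (ext_clsD _ _ z0).
  by apply/ext_cls_eq; rewrite addr0 subr0; exact: is_coboundary0.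
by rewrite ext_cls_eq subr0.
Qed.

Lemma ext_zeroP : bimod_zero (Ext_env P n) <->
  (forall f : dual_bimod (P n), is_cocycle f -> is_coboundary f).
Proof.
split=> [E0 f fz|fb t]; first by apply/(ext_cls0 fz).
by have [f [fz ->]] := ext_clsP t; apply/ext_cls0/fb.
Qed.

End Classes.

Section ExtMap.
Variables (M N : bimodule B) (P : proj_resolution M) (T : proj_resolution N).

(** The degrees [n] and [m] may differ, so this covers both pullbacks along
    chain maps and connecting maps. *)
Lemma ext_induced n m (u : bimod_hom (dual_bimod (T n)) (dual_bimod (P m)))
    (uz : forall f, is_cocycle f -> is_cocycle (u f)) :
  (forall f, is_coboundary f -> is_coboundary (u f)) ->
  exists v : bimod_hom (Ext_env T n) (Ext_env P m),
    forall f (fz : is_cocycle f), v (ext_cls fz) = ext_cls (uz f fz).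
Proof.
move=> ub.
pose rp (t : Ext_env T n) : sub_bimod (cocycles T n) := repr t.
pose v t := ext_cls (uz _ (@sub_valP _ _ _ _ (rp t))).
have vE f (fz : is_cocycle f) : v (ext_cls fz) = ext_cls (uz f fz).
  apply/ext_cls_eq; rewrite -[_ - _](bhomB u); apply: ub.
  have : ext_cls (@sub_valP _ _ _ _ (rp (ext_cls fz))) = ext_cls fz.
    rewrite -[RHS](@quot_reprK _ _ _ (coboundaries T n)) /ext_cls.
    by congr quot_pi; exact: sub_val_inj.
  by move/ext_cls_eq.
have vP : is_bimod_hom v.
  split=> [s t|a t|t a].
  - have [f [fz ->]] := ext_clsP s; have [g [gz ->]] := ext_clsP t.
    have fgz := is_cocycleD fz gz.
    rewrite (ext_clsD _ _ fgz) !vE; symmetry.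
    have ufgz : is_cocycle (u f + u g) by rewrite -bhomDE; exact: (uz).
    rewrite (ext_clsD _ _ ufgz); apply/ext_cls_eq.
    by rewrite bhomDE subrr; exact: is_coboundary0.
  - have [f [fz ->]] := ext_clsP t.
    rewrite (ext_cls_l _ (is_cocycle_l a fz)) !vE.
    rewrite (ext_cls_l _ (is_cocycle_l a (uz f fz))); apply/ext_cls_eq.
    by rewrite bhom_lE subrr; exact: is_coboundary0.
  - have [f [fz ->]] := ext_clsP t.
    rewrite (ext_cls_r _ (is_cocycle_r a fz)) !vE.
    rewrite (ext_cls_r _ (is_cocycle_r a (uz f fz))); apply/ext_cls_eq.
    by rewrite bhom_rE subrr; exact: is_coboundary0.
by exists (BimodHom vP).
Qed.

Lemma dual_pullP n (h : bimod_hom (P n) (T n)) :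
  @is_bimod_hom _ _ (dual_bimod (T n)) (dual_bimod (P n)) (fun f => bhom_comp f h).
Proof. by split=> *; apply: bhom_eq. Qed.
Definition dual_pull n (h : bimod_hom (P n) (T n)) := BimodHom (dual_pullP h).

Section Pull.
Variable phi : forall n, bimod_hom (P n) (T n).
Hypothesis phi_chain : chain_map (res_d P) (res_d T) phi.

Lemma pull_cocycle n (f : dual_bimod (T n)) :
  is_cocycle f -> is_cocycle (dual_pull (phi n) f).
Proof. by move=> fz p; rewrite /= -phi_chain fz. Qed.

Lemma pull_coboundary n (f : dual_bimod (T n)) :
  is_coboundary f -> is_coboundary (dual_pull (phi n) f).
Proof.
move: f; rewrite /is_coboundary; case: n => [f ->|n f [g ->]].
  by apply: bhom_eq.
by exists (bhom_comp g (phi n)); apply: bhom_eq => p /=; rewrite phi_chain.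
Qed.

Lemma ext_pull n : exists v : bimod_hom (Ext_env T n) (Ext_env P n),
  forall f (fz : is_cocycle f), v (ext_cls fz) = ext_cls (pull_cocycle fz).
Proof. exact/ext_induced/pull_coboundary. Qed.

End Pull.

(** Chain maps over the same map of modules are homotopic, so they pull a
    cocycle back to cohomologous cocycles. *)
Lemma pull_homotopic (phi psi : forall n, bimod_hom (P n) (T n)) n
    (f : dual_bimod (T n)) :
  chain_map (res_d P) (res_d T) phi -> chain_map (res_d P) (res_d T) psi ->
  (forall p, res_aug T (phi 0%N p) = res_aug T (psi 0%N p)) ->
  is_cocycle f -> is_coboundary (dual_pull (phi n) f - dual_pull (psi n) f).
Proof.
move=> phiC psiC aug fz.
pose chi m := bhom_sub (phi m) (psi m).
have chiC : chain_map (res_d P) (res_d T) chi.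
  by move=> m p; rewrite /= !bhomB phiC psiC.
have chi_aug p : res_aug T (chi 0 p) = 0 by rewrite /= bhomB aug subrr.
have fchi p : (dual_pull (phi n) f - dual_pull (psi n) f : dual_bimod _) p = f (chi n p).
  by rewrite /= bhomB.
move: f fz fchi; rewrite /is_coboundary; case: n => [|n] f fz fchi.
  have [s sP] := null_homotopy0 chi_aug.
  by apply: bhom_eq => p; rewrite fchi -sP fz.
have [s [s' sP]] := null_homotopyS chiC chi_aug n.
exists (bhom_comp f s); apply: bhom_eq => p.
by rewrite fchi sP bhomDE fz add0r.
Qed.

End ExtMap.

(** Resolutions of the same bimodule are homotopy equivalent. *)
Theorem Ext_env_unique (M : bimodule B) (P T : proj_resolution M) n :
  bimod_iso (Ext_env P n) (Ext_env T n).
Proof.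
have lift (Q R : proj_resolution M) :=
  @chain_lift _ _ _ _ Q R _ _ (@res_aug_surj _ _ _ R)
    (fun t => (res_exact0 t).1) (fun n t => (res_exactS t).1) (bhom_id M).
have [phi [phi_aug phiC]] := lift T P; have [psi [psi_aug psiC]] := lift P T.
have [v vE] := ext_pull phiC n; have [u uE] := ext_pull psiC n.
have compK (Q R : proj_resolution M) (alpha : forall n, bimod_hom (Q n) (R n))
    (beta : forall n, bimod_hom (R n) (Q n)) (f : dual_bimod (Q n)) :
    (forall p, res_aug R (alpha 0 p) = res_aug Q p) ->
    (forall p, res_aug Q (beta 0 p) = res_aug R p) ->
    chain_map (res_d Q) (res_d R) alpha -> chain_map (res_d R) (res_d Q) beta ->
    is_cocycle f ->
    is_coboundary (dual_pull (alpha n) (dual_pull (beta n) f) - f).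
  move=> aa ba ac bc fz.
  have := @pull_homotopic _ _ Q Q (fun n => bhom_comp (beta n) (alpha n))
    (fun n => bhom_id (Q n)) n f.
  have -> : dual_pull (bhom_id (Q n)) f = f by apply: bhom_eq.
  have -> : dual_pull (bhom_comp (beta n) (alpha n)) f =
     dual_pull (alpha n) (dual_pull (beta n) f) by apply: bhom_eq.
  by apply=> // [m p|p] /=; rewrite ?bc ?ac // ba aa.
exists v; exists u => t; have [f [fz ->]] := ext_clsP t.
  rewrite vE uE; apply/ext_cls_eq.
  exact: (compK P T).
rewrite uE vE; apply/ext_cls_eq.
exact: (compK T P).
Qed.

Lemma bimod_zero_iso (M N : bimodule B) :
  bimod_iso M N -> bimod_zero M -> bimod_zero N.
Proof.
move=> [f [g _ gK]] M0 n; rewrite -[n]gK [g n]M0; exact: bhom0.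
Qed.

End ExtClasses.

(** * Mapping cones *)

Section Cone.
Variables (k : comPzRingType) (B : pzAlgType k) (M' M M'' : bimodule B).
Variables (R' : proj_resolution M') (R : proj_resolution M).
Variables (i : bimod_hom M' M) (pi : bimod_hom M M'').
Hypothesis i_inj : forall m, i m = 0 -> m = 0.
Hypothesis pi_surj : forall y, exists m, pi m = y.
Hypothesis pi_exact : forall m, pi m = 0 <-> exists m', i m' = m.
Variable phi : forall n, bimod_hom (R' n) (R n).
Hypothesis phi_chain : chain_map (res_d R') (res_d R) phi.
Hypothesis phi_aug : forall r, res_aug R (phi 0 r) = i (res_aug R' r).

(** Padding the shifted complex with a zero bimodule in degree [0] lets the cone
    have the same shape in all degrees. *)
Definition shift_obj n : bimodule B :=
  match n with 0%N => zero_bimod B | m.+1 => R' m end.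
Definition shift_d n : bimod_hom (shift_obj n.+1) (shift_obj n) :=
  match n return bimod_hom (shift_obj n.+1) (shift_obj n) with
  | 0%N => bhom_zero _ _
  | m.+1 => res_d R' m
  end.
Definition shift_phi n : bimod_hom (shift_obj n.+1) (R n) := phi n.

Definition cone_obj n := dsum (R n) (shift_obj n).

Lemma cone_d_homP n : @is_bimod_hom _ _ (cone_obj n.+1) (cone_obj n)
  (fun p => (res_d R n p.1 + shift_phi n p.2, - shift_d n p.2)).
Proof.
split=> [p q|a p|p a]; rewrite /= !(bhomDE, bhom_lE, bhom_rE).
- by congr pair; rewrite ?opprD // addrACA.
- by rewrite lactDr -lactN.
- by rewrite ractDl -ractN.
Qed.
Definition cone_d n : bimod_hom (cone_obj n.+1) (cone_obj n) :=
  BimodHom (@cone_d_homP n).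
Definition cone_aug : bimod_hom (cone_obj 0) M'' :=
  dsum_copair (bhom_comp pi (res_aug R)) (bhom_zero _ _).

Lemma cone_dE n p :
  cone_d n p = (res_d R n p.1 + shift_phi n p.2, - shift_d n p.2).
Proof. by []. Qed.

Lemma cone_objE n (f : bimod_hom (cone_obj n) (outer_bimod B)) r r' :
  f (r, r') = f (r, 0) + f (0, r').
Proof. by rewrite -bhomDE; congr (bhom_fun f (_, _)); rewrite ?addr0 ?add0r. Qed.

Lemma cone_projective n : bimod_projective (cone_obj n).
Proof.
apply: dsum_projective; first exact: res_proj.
case: n => [|n]; last exact: res_proj.
exact: bimod_zero_projective (@zero_bimodP k B).
Qed.

Lemma cone_aug_surj m : exists p, cone_aug p = m.
Proof.
have [n <-] := pi_surj m; have [p <-] := res_aug_surj R n.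
by exists (p, 0); rewrite /= addr0.
Qed.

Lemma cone_exact0 p : cone_aug p = 0 <-> exists q, cone_d 0 q = p.
Proof.
case: p => [r z]; rewrite (zero_bimodP z); split=> [|[[r1 r'] <-]].
  rewrite /= addr0 => /pi_exact[m' im'].
  have [r' r'P] := res_aug_surj R' m'.
  have [|r1 r1P] := (res_exact0 (r - phi 0 r')).1.
    by rewrite bhomB phi_aug r'P im' subrr.
  by exists (r1, r'); rewrite r1P subrK /= oppr0.
rewrite cone_dE /= addr0; apply/pi_exact.
by rewrite bhomDE res_aug_d add0r phi_aug; eexists.
Qed.

Lemma cone_exactS n p : cone_d n p = 0 <-> exists q, cone_d n.+1 q = p.
Proof.
case: p => [r r']; split=> [|[[r1 r1'] <-]]; rewrite cone_dE.
  case=> dr dr'.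
  have [s sP] : exists s, res_d R' n s = - r'.
    case: n r r' dr dr' => [|n] r r' /= dr dr'; last first.
      by apply/res_exactS; rewrite bhomN.
    apply/res_exact0; rewrite bhomN; apply/eqP; rewrite oppr_eq0; apply/eqP.
    apply: i_inj; rewrite -phi_aug.
    by move/(congr1 (res_aug R)): dr; rewrite bhomDE res_aug_d add0r bhom0.
  have [|r1 r1P] := (res_exactS (r - phi n.+1 s)).1.
    by rewrite bhomB phi_chain sP bhomN opprK.
  exists (r1, s); rewrite cone_dE r1P subrK /=.
  by rewrite sP opprK.
rewrite cone_dE bhomDE res_dd add0r; congr pair.
  by rewrite bhomN [X in X - _]phi_chain subrr.
rewrite bhomN opprK {r}; case: n r' r1 r1' => [|n] r' r1 r1' //=.
by rewrite res_dd.
Qed.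

(** Exactness is the usual diagram chase: the second component of a cycle is a
    cycle of [R'], hence a boundary (in the lowest degree because [i] is
    injective), and after subtracting it the first component is a boundary of
    [R]. *)
Definition cone : proj_resolution M'' :=
  ProjResolution cone_projective cone_aug_surj cone_exact0 cone_exactS.

Lemma cone_bounded N :
  (forall n, (N < n)%N -> bimod_zero (R n)) ->
  (forall n, (N < n)%N -> bimod_zero (R' n)) ->
  forall n, (N.+1 < n)%N -> bimod_zero (cone n).
Proof.
move=> R0 R'0 [|n] // Nn; apply: dsum_zero; last exact: R'0.
exact/R0/ltnW.
Qed.

Lemma cone_fg : (forall n, bimod_fg (R n)) -> (forall n, bimod_fg (R' n)) ->
  forall n, bimod_fg (cone n).
Proof.
move=> Rfg R'fg n; apply: dsum_fg => //.
by case: n => [|n]; [exact: (bimod_zero_fg (@zero_bimodP k B)) | exact: R'fg].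
Qed.

(** ** The long exact sequence, when Ext is concentrated in one degree *)

Lemma shift_coboundary n (f : dual_bimod (R' n)) : is_coboundary f ->
  exists g : dual_bimod (shift_obj n), forall r, f r = g (shift_d n r).
Proof.
rewrite /is_coboundary; move: f; case: n => [|n] f; last by case=> g ->; exists g.
by move=> ->; exists (bhom_zero _ _).
Qed.

Lemma coboundary_shift n (f : dual_bimod (R' n)) (g : dual_bimod (shift_obj n)) :
  (forall r, f r = g (shift_d n r)) -> is_coboundary f.
Proof.
rewrite /is_coboundary; move: f g; case: n => [|n] f g fg.
  by apply: bhom_eq => r; rewrite fg /= bhom0.
by exists g; apply: bhom_eq.
Qed.

Lemma cone_cocycle n (f : dual_bimod (cone n)) : is_cocycle f ->
  (forall r, f (res_d R n r, 0) = 0) /\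
  (forall r, f (phi n r, 0) = f (0, shift_d n r)).
Proof.
move=> fz; split=> r.
  have := fz (r, 0); rewrite [res_d cone n _]cone_dE.
  by rewrite !bhom0 oppr0 addr0.
have := fz (0, r); rewrite [res_d cone n _]cone_dE bhom0 add0r cone_objE.
have -> : (0, - shift_d n r) = - (0, shift_d n r) :> cone_obj n.
  by congr pair; rewrite oppr0.
by rewrite bhomN => /subr0_eq.
Qed.

Lemma cone_coboundary n (f : dual_bimod (cone n.+1))
    (g0 : dual_bimod (R n)) (g1 : dual_bimod (shift_obj n)) :
  (forall r, f (r, 0) = g0 (res_d R n r)) ->
  (forall r, f (0, r) = g0 (phi n r) - g1 (shift_d n r)) -> is_coboundary f.
Proof.
move=> f0 f1; exists (dsum_copair g0 g1); apply: bhom_eq => -[r r'].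
by rewrite cone_objE f0 f1 /= bhomDE bhomN addrA.
Qed.

Definition cone_connect n : dual_bimod (R' n) -> dual_bimod (cone n.+1) :=
  fun f => dsum_copair (bhom_zero _ _) f.

Lemma cone_connectP n : is_bimod_hom (@cone_connect n).
Proof.
split=> [f g|a f|f a]; apply: bhom_eq => -[r r'] /=.
- by rewrite !add0r.
- by rewrite !add0r.
- by rewrite !add0r.
Qed.

Variable d : nat.
Hypothesis R_vanish : forall n (f : dual_bimod (R n)),
  n <> d -> is_cocycle f -> is_coboundary f.
Hypothesis R'_vanish : forall n (f : dual_bimod (R' n)),
  n <> d -> is_cocycle f -> is_coboundary f.

(** A cocycle whose first component is the coboundary of [g0] is cohomologous to
    one supported on the second component, namely [f1]. *)
Lemma cone_cocycle_split n (f : dual_bimod (cone n.+1)) (g0 : dual_bimod (R n)) :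
  is_cocycle f -> (forall r, f (r, 0) = g0 (res_d R n r)) ->
  exists f1 : dual_bimod (R' n), is_cocycle f1 /\
    forall r, f (0, r) = g0 (phi n r) + f1 r.
Proof.
move=> /cone_cocycle[_ fphi] fg.
pose f1 : dual_bimod (R' n) :=
  bhom_sub (bhom_comp f (dsum_inr _ _)) (bhom_comp g0 (phi n)).
exists f1; split=> r; last by rewrite /= addrC subrK.
by rewrite /= -[f _]fphi fg phi_chain subrr.
Qed.

(** The first component of a cocycle is a coboundary: by the vanishing of Ext if
    [n <> d], and for [n = d] because its pullback to [R'] is the coboundary of
    the second component. What is left is a cocycle of [R'] in degree
    [n - 1 <> d]. *)
Lemma cone_vanish n (f : dual_bimod (cone n)) :
  (forall f : dual_bimod (R d), is_cocycle f ->
     is_coboundary (dual_pull (phi d) f) -> is_coboundary f) ->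
  n <> d.+1 -> is_cocycle f -> is_coboundary f.
Proof.
move=> phi_inj nd fz; have [fd fphi] := cone_cocycle fz.
have f0z : is_cocycle (bhom_comp f (dsum_inl _ _) : dual_bimod (R n)) by exact: fd.
have f0b : is_coboundary (bhom_comp f (dsum_inl _ _) : dual_bimod (R n)).
  have [nd'|nd'] := pselect (n = d); last exact: R_vanish.
  subst n; apply: phi_inj => //.
  by apply: (@coboundary_shift _ _ (bhom_comp f (dsum_inr _ _))) => r; exact: fphi.
move: f fz fd fphi f0z f0b.
case: n nd => [|n] nd f fz fd fphi f0z f0b.
  rewrite /is_coboundary; apply: bhom_eq => -[r z]; rewrite (zero_bimodP z).
  by move: f0b => /(congr1 (fun g : dual_bimod (R 0%N) => g r)).
case: f0b => g0 /(congr1 (fun g : dual_bimod (R n.+1) => (g : R n.+1 -> _))) fg0.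
have fg r : f (r, 0) = g0 (res_d R n r) by move: fg0 => /(congr1 (@^~ r)).
have [f1 [f1z f1P]] := cone_cocycle_split fz fg.
have [|g1 g1P] := shift_coboundary (R'_vanish (n := n) _ f1z); first by move=> nd'; apply: nd; rewrite nd'.
apply: (@cone_coboundary _ _ g0 (bhom_opp g1)) => // r.
by rewrite f1P g1P /= opprK.
Qed.

(** The end of the long exact sequence: Ext of the cone in degree [d + 1] is the
    cokernel of the pullback along [phi]. *)
Theorem cone_connecting : exists delta : bimod_hom (Ext_env R' d) (Ext_env cone d.+1),
  (forall t, exists s, delta s = t) /\
  forall f1 (f1z : is_cocycle f1), delta (ext_cls f1z) = 0 <->
    exists f0 : dual_bimod (R d), is_cocycle f0 /\
      is_coboundary (f1 - dual_pull (phi d) f0).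
Proof.
pose u : bimod_hom (dual_bimod (R' d)) (dual_bimod (cone d.+1)) := BimodHom (@cone_connectP d).
have uz (f : dual_bimod (R' d)) : is_cocycle f -> is_cocycle (u f).
  by move=> fz [r r'] /=; rewrite !add0r bhomN fz oppr0.
have ub (f : dual_bimod (R' d)) : is_coboundary f -> is_coboundary (u f).
  move=> /shift_coboundary[g gP].
  apply: (@cone_coboundary _ _ (bhom_zero _ _) (bhom_opp g)) => r /=.
    by rewrite bhom0 addr0.
  by rewrite gP opprK.
have [delta deltaE] := @ext_induced _ _ _ _ cone R' d d.+1 u uz ub.
exists delta; split=> [t|f1 f1z].
  have [f [fz ->]] := ext_clsP t; have [fd _] := cone_cocycle fz.
  have [|g0 g0P] := R_vanish (n := d.+1) (f := bhom_comp f (dsum_inl _ _)) _ fd.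
    by move/eqP; rewrite eqn_leq ltnn.
  have fg r : f (r, 0) = g0 (res_d R d r).
    by move: g0P => /(congr1 (fun g : dual_bimod (R d.+1) => g r)).
  have [f1 [f1z f1P]] := cone_cocycle_split fz fg.
  exists (ext_cls f1z); rewrite deltaE; apply/ext_cls_eq.
  apply: (@cone_coboundary _ _ (bhom_opp g0) (bhom_zero _ _)) => r /=.
    by rewrite bhom0 addr0 fg add0r.
  by rewrite f1P add0r opprD addrCA subrr addr0 subr0.
rewrite deltaE ext_cls0; split.
  case=> h hP.
  pose f0 : dual_bimod (R d) := bhom_comp h (dsum_inl _ _).
  have hP' r r' : h (res_d R d r + phi d r', - shift_d d r') = f1 r'.
    move/(congr1 (fun g : dual_bimod (cone d.+1) => g (r, r'))): hP.
    by rewrite [in RHS]/= -[X in _ = h X]/(cone_d d (r, r')) cone_dE /= add0r => ->.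
  exists f0; split=> [r|].
    by have := hP' r 0; rewrite !bhom0 oppr0 addr0.
  apply: (@coboundary_shift _ _ (bhom_opp (bhom_comp h (dsum_inr _ _)))) => r.
  have f1E : f1 r = h (phi d r, 0) + h (0, - shift_d d r).
    by rewrite -(hP' 0 r) bhom0 add0r -cone_objE.
  transitivity (f1 r - h (phi d r, 0)); first by [].
  rewrite f1E addrAC subrr add0r.
  transitivity (- h (0, shift_d d r)); last by [].
  have -> : (0, - shift_d d r) = - (0, shift_d d r) :> cone_obj d.
    by congr pair; rewrite oppr0.
  exact: bhomN.
move=> [f0 [f0z f1b]].
have -> : u f1 = u (f1 - dual_pull (phi d) f0) + u (dual_pull (phi d) f0).
  by rewrite -bhomDE subrK.
apply: is_coboundaryD; first exact: ub.
apply: (@cone_coboundary _ _ f0 (bhom_zero _ _)) => r /=.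
  by rewrite !bhom0 addr0 f0z.
by rewrite add0r subr0.
Qed.

End Cone.

(** * Bases indexed by degree *)

Section Graded.
Variables (C N : zmodType) (m : nat -> C -> N).
Hypothesis termD : forall i c c', m i (c + c') = m i c + m i c'.

Definition gsum n (c : nat -> C) := \sum_(i < n) m i (c i).

Lemma term0 i : m i 0 = 0.
Proof. by apply: (addrI (m i 0)); rewrite -termD !addr0. Qed.
Lemma termN i c : m i (- c) = - m i c.
Proof. by apply: (addrI (m i c)); rewrite -termD !subrr term0. Qed.

Lemma gsum0 c : gsum 0 c = 0.
Proof. exact: big_ord0. Qed.
Lemma gsum_recr n c : gsum n.+1 c = gsum n c + m n (c n).
Proof. exact: big_ord_recr. Qed.

Lemma gsumD n c c' : gsum n c + gsum n c' = gsum n (fun i => c i + c' i).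
Proof. by rewrite /gsum -big_split; apply: eq_bigr => i _; rewrite termD. Qed.
Lemma gsumN n c : - gsum n c = gsum n (fun i => - c i).
Proof. by rewrite /gsum -sumrN; apply: eq_bigr => i _; rewrite termN. Qed.
Lemma gsum_widen n n' c : (n <= n')%N -> (forall i, (n <= i)%N -> c i = 0) ->
  gsum n' c = gsum n c.
Proof.
move=> nn' c0; rewrite /gsum -(subnKC nn').
rewrite big_split_ord /= [X in _ + X]big1 ?addr0 // => i _.
by rewrite c0 ?leq_addr // term0.
Qed.
Lemma gsum_trunc n n' c : (n <= n')%N ->
  gsum n c = gsum n' (fun i => if (i < n)%N then c i else 0).
Proof.
move=> nn'; rewrite (@gsum_widen n n') // => [|i ni].
  by apply: eq_bigr => i _; rewrite ltn_ord.
by rewrite ltnNge ni.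
Qed.

(** The elements of degree less than [n]. *)
Definition low n z := exists c, z = gsum n c.

Lemma low0 n : low n 0.
Proof. by exists (fun=> 0); rewrite /gsum big1 // => i _; rewrite term0. Qed.
Lemma lowD n z z' : low n z -> low n z' -> low n (z + z').
Proof. by move=> [c ->] [c' ->]; rewrite gsumD; eexists. Qed.
Lemma lowN n z : low n z -> low n (- z).
Proof. by move=> [c ->]; rewrite gsumN; eexists. Qed.
Lemma lowB n z z' : low n z -> low n z' -> low n (z - z').
Proof. by move=> ? ?; apply: lowD => //; exact: lowN. Qed.
Lemma low_sum n (I : finType) (F : I -> N) :
  (forall i, low n (F i)) -> low n (\sum_i F i).
Proof.
by move=> Fl; apply: (big_ind (low n)); [exact: low0|exact: lowD|move=> i _; exact: Fl].
Qed.
Lemma low_widen n n' z : (n <= n')%N -> low n z -> low n' z.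
Proof. by move=> nn' [c ->]; rewrite (gsum_trunc _ nn'); eexists. Qed.
Lemma low_term n i c : (i < n)%N -> low n (m i c).
Proof.
move=> ni; exists (fun j => if j == i then c else 0).
rewrite /gsum (bigD1 (Ordinal ni)) //= eqxx big1 ?addr0 // => j.
by rewrite -val_eqE /= => /negPf->; rewrite term0.
Qed.
Lemma low_recr n z : low n.+1 z -> exists c, low n (z - m n c).
Proof.
move=> [c ->]; exists (c n); rewrite /gsum big_ord_recr /= addrK.
by exists c.
Qed.

Hypothesis term_free : forall n c, gsum n c = 0 -> forall i, (i < n)%N -> c i = 0.

Lemma low_top n c z : low n z -> m n c + z = 0 -> c = 0.
Proof.
move=> [c' zE] mz; pose c'' i := if (i < n)%N then c' i else c.
have := @term_free n.+1 c'' _ n (leqnn _); rewrite /c'' ltnn; apply.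
rewrite /gsum big_ord_recr /= ltnn addrC -[RHS]mz zE /gsum; congr (_ + _).
by apply: eq_bigr => i _; rewrite ltn_ord.
Qed.

(** Compare top terms, and descend: at the largest index everything else is of
    lower degree. It is used with terms that are monomials only up to lower
    degree. *)
Lemma triangular_free (t : nat -> N) (l : nat -> C) n :
  (forall i, l i = 0 -> t i = 0) ->
  (forall i, low i (t i - m i (l i))) -> \sum_(i < n) t i = 0 ->
  forall i, (i < n)%N -> l i = 0.
Proof.
move=> lt tl; elim: n => [|n IH] // t0.
have ln : l n = 0.
  apply: (@low_top n _ ((t n - m n (l n)) + \sum_(i < n) t i)); last first.
    by rewrite addrA [m n _ + _]addrC subrK -[RHS]t0 big_ord_recr addrC.
  apply: lowD => //; apply: low_sum => i.
  rewrite -[t i](subrK (m i (l i))); apply: lowD; last exact: low_term.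
  by apply: low_widen (tl i); exact/ltnW.
move=> i; rewrite ltnS leq_eqVlt => /orP[/eqP->//|]; apply: IH.
by move: t0; rewrite big_ord_recr /= (lt n ln) addr0.
Qed.

Hypothesis term_gen : forall z, exists n, low n z.

(** Coordinates are chosen once and characterised by uniqueness, which is what
    makes them additive and natural below. *)
Lemma coordinates_exist : exists co : nat -> N -> C,
  (forall z, exists n, (forall i, (n <= i)%N -> co i z = 0) /\
                       z = gsum n (fun i => co i z)) /\
  (forall z n c, (forall i, (n <= i)%N -> c i = 0) -> z = gsum n c ->
                 forall i, co i z = c i).
Proof.
have uniq n n' c c' : (forall i, (n <= i)%N -> c i = 0) ->
    (forall i, (n' <= i)%N -> c' i = 0) -> gsum n c = gsum n' c' -> c =1 c'.
  move=> c0 c'0 cc' i; apply/eqP; rewrite -subr_eq0; apply/eqP.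
  have [ni|ni] := leqP (maxn n n') i.
    by move: ni; rewrite geq_max => /andP[/c0-> /c'0->]; rewrite subrr.
  apply: (@term_free (maxn n n') (fun i => c i - c' i)) => //.
  rewrite -gsumD -gsumN (gsum_widen (leq_maxl _ _)) //.
  by rewrite (gsum_widen (leq_maxr _ _)) // cc' subrr.
have ex z : exists c, exists n, (forall i, (n <= i)%N -> c i = 0) /\ z = gsum n c.
  have [n [c zE]] := term_gen z.
  exists (fun i => if (i < n)%N then c i else 0); exists n.
  by rewrite -gsum_trunc //; split=> // i ni; rewrite ltnNge ni.
exists (fun i z => sval (cid (ex z)) i).
split=> [z|z n c c0 zE]; case: cid => // c' [n' [c'0 zE']] /=.
by apply: (uniq n' n) => //; rewrite -zE' -zE.
Qed.

Section Coordinates.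
Variable co : nat -> N -> C.
Hypothesis coE : forall z, exists n,
  (forall i, (n <= i)%N -> co i z = 0) /\ z = gsum n (fun i => co i z).
Hypothesis co_uniq : forall z n c, (forall i, (n <= i)%N -> c i = 0) ->
  z = gsum n c -> forall i, co i z = c i.

Lemma co_expand z : exists n, forall n', (n <= n')%N ->
  z = gsum n' (fun i => co i z).
Proof.
have [n [z0 zE]] := coE z; exists n => n' nn'.
by rewrite (gsum_widen nn').
Qed.

Lemma co_term j c i : co i (m j c) = if i == j then c else 0.
Proof.
apply: (@co_uniq _ j.+1 (fun i => if i == j then c else 0)) => [i' ji'|]; first by rewrite gtn_eqF.
rewrite /gsum big_ord_recr /= eqxx big1 ?add0r // => i' _.
by rewrite ltn_eqF // term0.
Qed.

Lemma coD z z' i : co i (z + z') = co i z + co i z'.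
Proof.
have [n [z0 zE]] := coE z; have [n' [z'0 z'E]] := coE z'.
apply: (@co_uniq _ (maxn n n') (fun i => co i z + co i z')) => [j|].
  by rewrite geq_max => /andP[/z0-> /z'0->]; rewrite addr0.
rewrite -gsumD (gsum_widen (leq_maxl _ _)) //.
by rewrite (gsum_widen (leq_maxr _ _)) // -zE -z'E.
Qed.

Lemma co_morph (h : N -> N) (g : C -> C) :
  {morph h : a b / a + b} -> {morph g : a b / a + b} ->
  (forall i c, h (m i c) = m i (g c)) -> forall z i, co i (h z) = g (co i z).
Proof.
move=> hD gD hg z i.
have h0 : h 0 = 0 by apply: (addrI (h 0)); rewrite -hD !addr0.
have g0 : g 0 = 0 by apply: (addrI (g 0)); rewrite -gD !addr0.
have [n [z0 zE]] := coE z.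
apply: (@co_uniq _ n (fun i => g (co i z))) => [j nj|]; first by rewrite z0.
rewrite {1}zE /gsum (big_morph h hD h0).
by apply: eq_bigr => j _; rewrite hg.
Qed.

End Coordinates.
End Graded.

(** * Ore extensions *)

Section Ore.
Variables (k : comPzRingType) (A : pzAlgType k) (sigma : alg_aut A) (delta : A -> A).
Hypothesis delta_der : is_skew_derivation sigma delta.
Variables (E : pzAlgType k) (iota : A -> E) (x : E).
Hypothesis E_ore : is_ore_extension sigma delta iota x.

Let iotaP := ore_hom E_ore.
Let sigmaP := aut_hom sigma.
Local Notation tau := (aut_inv sigma).

Lemma ore_comm_inv a : iota a * x = x * iota (tau a) - iota (delta (tau a)).
Proof. by rewrite (ore_comm E_ore) autVK addrK. Qed.

Definition lmono i a := iota a * x ^+ i.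
Definition rmono i a := x ^+ i * iota a.

Lemma lmonoD i a b : lmono i (a + b) = lmono i a + lmono i b.
Proof. by rewrite /lmono (alg_homD iotaP) mulrDl. Qed.
Lemma rmonoD i a b : rmono i (a + b) = rmono i a + rmono i b.
Proof. by rewrite /rmono (alg_homD iotaP) mulrDr. Qed.

Lemma lmono_free n c : gsum lmono n c = 0 -> forall i, (i < n)%N -> c i = 0.
Proof.
move=> c0 i ni; rewrite -(nth_mkseq 0 c ni); apply: (ore_free E_ore).
rewrite size_mkseq -[RHS]c0 /gsum; apply: eq_bigr => j _.
by rewrite nth_mkseq.
Qed.

Lemma lmono_gen z : exists n, low lmono n z.
Proof.
by have [s ->] := ore_gen E_ore z; exists (size s), (fun i => s`_i).
Qed.

Lemma lowl_iota n a z : low lmono n z -> low lmono n (iota a * z).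
Proof.
move=> [c ->]; exists (fun i => a * c i).
by rewrite mulr_sumr; apply: eq_bigr => i _; rewrite /lmono (alg_homM iotaP) mulrA.
Qed.

Lemma lmono_x i a : x * lmono i a = lmono i.+1 (sigma a) + lmono i (delta a).
Proof. by rewrite /lmono mulrA (ore_comm E_ore) mulrDl exprS mulrA. Qed.

Lemma lowl_x n z : low lmono n z -> low lmono n.+1 (x * z).
Proof.
move=> [c ->]; rewrite mulr_sumr; apply: (low_sum lmonoD) => i.
rewrite lmono_x; apply: (lowD lmonoD); apply: (low_term lmonoD); first by rewrite ltnS.
exact: leqW.
Qed.

(** Moving [a] across [x^i] only changes it into [sigma^i a], up to terms of
    lower degree; hence the monomials [x^i a] are triangular in terms of the
    monomials [a x^i]. *)
Lemma rmono_lead i a : low lmono i (rmono i a - lmono i (iter i sigma a)).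
Proof.
elim: i => [|i IH].
  by rewrite /rmono /lmono !expr0 mul1r mulr1 subrr; exact: (low0 lmonoD).
have -> : rmono i.+1 a = x * rmono i a by rewrite /rmono exprS mulrA.
rewrite -[rmono i a](subrK (lmono i (iter i sigma a))) mulrDr lmono_x.
rewrite iterS -addrA [X in _ + X]addrAC subrr add0r.
apply: (lowD lmonoD); first exact: lowl_x.
exact: (low_term lmonoD).
Qed.

(** Freeness of [E] as a right [A]-module: the leading coefficient of
    [x^n a] vanishes only if [a] does, as [sigma] is injective. *)
Lemma rmono_free n c : gsum rmono n c = 0 -> forall i, (i < n)%N -> c i = 0.
Proof.
have inj i a : iter i sigma a = 0 -> a = 0.
  elim: i => //= i IH /(congr1 tau); rewrite autK => H; apply: IH.
  by rewrite H (alg_hom0 (aut_inv_hom sigma)).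
move=> c0 i ni; apply: (inj i).
apply: (triangular_free lmonoD lmono_free _ _ c0 (l := fun i => iter i sigma (c i))
  (t := fun i => rmono i (c i))) => //.
  by move=> j /inj->; exact: (term0 rmonoD).
by move=> j; exact: rmono_lead.
Qed.

(** Generation of [E] as a right [A]-module: right multiplication by [x]
    preserves the span of the [x^i a] since [a x = x t(a) - delta(t(a))] for the
    inverse [t] of [sigma]. *)
Lemma rmono_gen z : exists n, low rmono n z.
Proof.
have rx n y : low rmono n y -> low rmono n.+1 (y * x).
  move=> [c ->]; rewrite mulr_suml; apply: (low_sum rmonoD) => i.
  have -> : rmono i (c i) * x =
      rmono i.+1 (tau (c i)) - rmono i (delta (tau (c i))).
    by rewrite /rmono -mulrA ore_comm_inv mulrBr mulrA exprSr.
  apply: (lowB rmonoD); apply: (low_term rmonoD); first by rewrite ltnS.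
  exact: leqW.
have rl i a : low rmono i.+1 (lmono i a).
  elim: i => [|i IH]; last by rewrite /lmono exprSr mulrA; exact: rx.
  have -> : lmono 0 a = rmono 0 a by rewrite /lmono /rmono expr0 mul1r mulr1.
  exact: (low_term rmonoD).
have [n [c ->]] := lmono_gen z; exists n; apply: (low_sum rmonoD) => i.
by apply: (low_widen rmonoD _ (rl i (c i))).
Qed.

Definition lco_exists := coordinates_exist lmonoD lmono_free lmono_gen.
Definition rco_exists := coordinates_exist rmonoD rmono_free rmono_gen.
Definition lco := sval (cid lco_exists).
Definition rco := sval (cid rco_exists).

Lemma lcoP : 
  (forall z, exists n, (forall i, (n <= i)%N -> lco i z = 0) /\
                       z = gsum lmono n (fun i => lco i z)) /\
  (forall z n c, (forall i, (n <= i)%N -> c i = 0) -> z = gsum lmono n c ->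
                 forall i, lco i z = c i).
Proof. exact: (svalP (cid lco_exists)). Qed.
Lemma rcoP : 
  (forall z, exists n, (forall i, (n <= i)%N -> rco i z = 0) /\
                       z = gsum rmono n (fun i => rco i z)) /\
  (forall z n c, (forall i, (n <= i)%N -> c i = 0) -> z = gsum rmono n c ->
                 forall i, rco i z = c i).
Proof. exact: (svalP (cid rco_exists)). Qed.

Lemma lcoD i z z' : lco i (z + z') = lco i z + lco i z'.
Proof. exact: (coD lmonoD lcoP.1 lcoP.2). Qed.
Lemma rcoD i z z' : rco i (z + z') = rco i z + rco i z'.
Proof. exact: (coD rmonoD rcoP.1 rcoP.2). Qed.

Lemma lco_l i a z : lco i (iota a * z) = a * lco i z.
Proof.
apply: (co_morph lcoP.1 lcoP.2 (h := fun z => iota a * z) (g := fun b => a * b)).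
- by move=> *; rewrite mulrDr.
- by move=> *; rewrite mulrDr.
- by move=> j b; rewrite /lmono (alg_homM iotaP) mulrA.
Qed.
Lemma rco_r i a z : rco i (z * iota a) = rco i z * a.
Proof.
apply: (co_morph rcoP.1 rcoP.2 (h := fun z => z * iota a) (g := fun b => b * a)).
- by move=> *; rewrite mulrDl.
- by move=> *; rewrite mulrDl.
- by move=> j b; rewrite /rmono (alg_homM iotaP) mulrA.
Qed.

Lemma lcoZ i c z : lco i (c *: z) = c *: lco i z.
Proof.
have -> : c *: z = iota (c *: (1 : A)) * z.
  by rewrite (alg_homZ iotaP) (alg_hom1 iotaP) -pz_scalerAl mul1r.
by rewrite lco_l -pz_scalerAl mul1r.
Qed.
Lemma rcoZ i c z : rco i (c *: z) = c *: rco i z.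
Proof.
have -> : c *: z = z * iota (c *: (1 : A)).
  by rewrite (alg_homZ iotaP) (alg_hom1 iotaP) -pz_scalerAr mulr1.
by rewrite rco_r -pz_scalerAr mulr1.
Qed.

Lemma lco_mono i j a : lco i (iota a * x ^+ j) = if i == j then a else 0.
Proof. exact: (co_term lmonoD lcoP.2). Qed.
Lemma rco_mono i j a : rco i (x ^+ j * iota a) = if i == j then a else 0.
Proof. exact: (co_term rmonoD rcoP.2). Qed.
Lemma lco_X i j : lco i (x ^+ j) = if i == j then 1 else 0.
Proof. by rewrite -[x ^+ j]mul1r -(alg_hom1 iotaP) lco_mono. Qed.
Lemma rco_X i j : rco i (x ^+ j) = if i == j then 1 else 0.
Proof. by rewrite -[x ^+ j]mulr1 -(alg_hom1 iotaP) rco_mono. Qed.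

Lemma lco_expand z : exists n, forall n', (n <= n')%N ->
  z = \sum_(i < n') iota (lco i z) * x ^+ i.
Proof. exact: (co_expand lmonoD lcoP.1). Qed.
Lemma rco_expand z : exists n, forall n', (n <= n')%N ->
  z = \sum_(i < n') x ^+ i * iota (rco i z).
Proof. exact: (co_expand rmonoD rcoP.1). Qed.

(** An endomorphism that restricts to an automorphism [rho] of [A] and sends [x]
    to a polynomial of degree one with unit leading coefficient preserves
    degrees: it replaces a leading coefficient by a unit multiple of its image
    under [rho]. *)
Section Automorphism.
Variables (nu : E -> E) (rho : alg_aut A) (u v b : A).
Hypothesis nuP : is_alg_hom nu.
Hypothesis nu_iota : forall a, nu (iota a) = iota (rho a).
Hypothesis uv : u * v = 1.
Hypothesis vu : v * u = 1.
Hypothesis nu_x : nu x = iota u * x + iota b.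

(** The leading coefficient of [nu(x)^i] is a product of twists of [u] by powers
    of [sigma], which is a unit. *)
Lemma nu_xn_lead i : exists w w', w * w' = 1 /\
  low lmono i (nu x ^+ i - lmono i w).
Proof.
elim: i => [|i [w [w' [ww' IH]]]].
  exists 1, 1; rewrite mulr1 /lmono !expr0 mulr1 (alg_hom1 iotaP) subrr.
  by split=> //; exact: (low0 lmonoD).
exists (u * sigma w), (sigma w' * v); split.
  rewrite -mulrA [sigma w * _]mulrA -(alg_homM sigmaP) ww' (alg_hom1 sigmaP).
  by rewrite mul1r.
have -> : nu x ^+ i.+1 - lmono i.+1 (u * sigma w) =
    iota u * (x * (nu x ^+ i - lmono i w)) + iota u * lmono i (delta w)
    + iota b * (nu x ^+ i - lmono i w) + iota b * lmono i w.
  rewrite -!addrA -mulrDr subrK addrA -mulrDr exprS {1}nu_x mulrDl.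
  rewrite addrAC; congr (_ + _); rewrite mulrBr lmono_x opprD addrA subrK.
  by rewrite mulrBr mulrA /lmono (alg_homM iotaP) !mulrA.
apply: (lowD lmonoD); last exact/lowl_iota/(low_term lmonoD).
apply: (lowD lmonoD); last first.
  by apply: (low_widen lmonoD (leqnSn i)); exact: lowl_iota.
apply: (lowD lmonoD); last exact/lowl_iota/(low_term lmonoD).
exact/lowl_iota/lowl_x.
Qed.

Lemma ore_endo_bij : bijective nu.
Proof.
have nu_inj z : nu z = 0 -> z = 0.
  have [n [c ->]] := lmono_gen z.
  rewrite (alg_hom_sum nuP) => z0.
  suff c0 i : (i < n)%N -> c i = 0.
    by apply: big1 => i _; rewrite c0 //; exact: (term0 lmonoD).
  pose lead i := sval (cid (nu_xn_lead i)).
  have leadP j : exists w', lead j * w' = 1 /\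
      low lmono j (nu x ^+ j - lmono j (lead j)).
    exact: (svalP (cid (nu_xn_lead j))).
  have rho0 a j : rho a * lead j = 0 -> a = 0.
    have [w' [lw _]] := leadP j.
    move/(congr1 ( *%R^~ w')); rewrite -mulrA lw mulr1 mul0r.
    by move/(congr1 (aut_inv rho)); rewrite autK (alg_hom0 (aut_inv_hom rho)).
  have nuE j : nu (lmono j (c j)) = iota (rho (c j)) * nu x ^+ j.
    by rewrite /lmono (alg_homM nuP) (alg_homX nuP) nu_iota.
  move=> ni; apply: (rho0 _ i).
  apply: (triangular_free lmonoD lmono_free _ _ z0 (l := fun j => rho (c j) * lead j)
    (t := fun j => nu (lmono j (c j)))) => // j.
    by move/rho0->; rewrite (term0 lmonoD) (alg_hom0 nuP).
  have [w' [_ low]] := leadP j.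
  rewrite nuE.
  have -> : lmono j (rho (c j) * lead j) = iota (rho (c j)) * lmono j (lead j).
    by rewrite /lmono (alg_homM iotaP) mulrA.
  by rewrite -mulrBr; exact: lowl_iota.
have nu_surj z : exists y, nu y = z.
  have nuK a : nu (iota (aut_inv rho a)) = iota a by rewrite nu_iota autVK.
  have [y yP] : exists y, nu y = x.
    exists (iota (aut_inv rho v) * (x - iota (aut_inv rho b))).
    rewrite (alg_homM nuP) (alg_homB nuP) !nuK nu_x addrK.
    by rewrite mulrA -(alg_homM iotaP) vu (alg_hom1 iotaP) mul1r.
  have [n [c ->]] := lmono_gen z.
  exists (\sum_(i < n) iota (aut_inv rho (c i)) * y ^+ i).
  rewrite (alg_hom_sum nuP); apply: eq_bigr => i _.
  by rewrite (alg_homM nuP) (alg_homX nuP) nuK yP.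
exists (fun z => sval (cid (nu_surj z))) => z; last exact: (svalP (cid (nu_surj z))).
apply: subr0_eq; apply: nu_inj; rewrite (alg_homB nuP).
by rewrite (svalP (cid (nu_surj (nu z)))) subrr.
Qed.

End Automorphism.

(** * Bimodules that are free over the powers of the variable *)

Section OreCokernel.
Variables (N0 N : bimodule E) (phi : bimod_hom N0 N) (w0 : N0) (w : N).
Variables (al al' be : E).
Hypothesis al_r : al * al' = 1.
Hypothesis al_l : al' * al = 1.

(** The term [e v x^i]: with [E] acting on the left, bimodules induced from a
    twist of [A] are free on the elements [v x^i]. *)
Definition xmono (L : bimodule E) (v : L) i (e : E) := ract (lact e v) (x ^+ i).

Lemma xmonoD (L : bimodule E) (v : L) i a b :
  xmono v i (a + b) = xmono v i a + xmono v i b.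
Proof. by rewrite /xmono lactDl ractDl. Qed.

Hypothesis span0 : forall z, exists n, low (xmono w0) n z.
Hypothesis span : forall z, exists n, low (xmono w) n z.
Hypothesis free : forall n c, gsum (xmono w) n c = 0 ->
  forall i, (i < n)%N -> c i = 0.
Hypothesis phi_w0 : phi w0 = lact al (ract w x) + lact be w.

Lemma phi_xmono i e :
  phi (xmono w0 i e) = xmono w i.+1 (e * al) + xmono w i (e * be).
Proof.
rewrite /xmono bhom_rE bhom_lE phi_w0 lactDr ractDl -!lactM; congr (_ + _).
by rewrite -lractA -ractM -exprS.
Qed.

(** The image of [e w0 x^i] has leading term [e al w x^(i+1)], of positive degree
    and nonzero unless [e] is; so nothing nonzero maps to the degree zero part
    [E w]. Taking [e = 0] gives injectivity of [phi]. *)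
Lemma ore_cokernel_free z e : phi z = lact e w -> z = 0 /\ e = 0.
Proof.
have [n [c ->]] := span0 z; rewrite bhom_sum => ze.
suff c0 i : (i < n)%N -> c i = 0.
  have z0 : gsum (xmono w0) n c = 0.
    by apply: big1 => i _; rewrite c0 // (term0 (@xmonoD _ w0)).
  split=> //; apply: (@free 1%N (fun=> e) _ 0%N) => //.
  rewrite /gsum big_ord1 /xmono expr0 ract1 -ze -bhom_sum.
  by rewrite -[X in phi X]/(gsum _ _ _) z0 bhom0.
elim: n i ze => [|n IH] // i ze.
have cn : c n = 0.
  have : c n * al = 0.
    pose r := xmono w n (c n * be) + (\sum_(j < n) phi (xmono w0 j (c j)) - lact e w).
    apply: (low_top free (n := n.+1) (z := r)).
      have D := @xmonoD _ w; apply: (lowD D); first exact: (low_term D).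
      apply: (lowB D); last first.
        have -> : lact e w = xmono w 0 e by rewrite /xmono expr0 ract1.
        exact: (low_term D).
      apply: (low_sum D) => j; rewrite phi_xmono.
      by apply: (lowD D); apply: (low_term D); rewrite !ltnS // ltnW.
    by rewrite /r !addrA -phi_xmono [X in X - _]addrC -ze big_ord_recr subrr.
  by move/(congr1 ( *%R^~ al')); rewrite -mulrA al_r mulr1 mul0r.
rewrite ltnS leq_eqVlt => /orP[/eqP->//|]; apply: IH.
by rewrite -ze big_ord_recr /= cn (term0 (@xmonoD _ w0)) bhom0 addr0.
Qed.

(** Division: as [al] is a unit, [e w x^(i+1)] can be replaced by terms of lower
    degree modulo the image of [phi]. *)
Lemma ore_cokernel_span z : exists y e, z = phi y + lact e w.
Proof.
have [n] := span z; elim: n z => [|n IH] z.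
  move=> [c ->]; exists 0, 0; rewrite bhom0 lact0l addr0.
  by rewrite /gsum big_ord0.
move=> /(low_recr)[c]; case: n IH => [|n] IH zl.
  exists 0, c; have [c' /eqP] := zl; rewrite /gsum big_ord0 subr_eq0 => /eqP->.
  by rewrite bhom0 add0r /xmono expr0 ract1.
have [|y [e yE]] := IH (z - phi (xmono w0 n (c * al'))).
  rewrite phi_xmono -mulrA al_l mulr1 opprD addrA.
  apply: (lowB (@xmonoD _ w)) => //.
  exact: (low_term (@xmonoD _ w)).
exists (y + xmono w0 n (c * al')), e.
by rewrite bhomDE addrAC -yE subrK.
Qed.

End OreCokernel.

End Ore.

(** * Induction of bimodules along an algebra homomorphism *)

Section Induction.
Variables (k : comPzRingType) (A E : pzAlgType k) (iota : A -> E).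
Hypothesis iotaP : is_alg_hom iota.

Definition res_bimod (N : bimodule E) : bimodule A.
Proof.
refine (@Bimodule _ _ N (fun a m => lact (iota a) m) (fun m b => ract m (iota b))
  _ _ _ _ _ _ _ _ _ _) => *.
- by rewrite (alg_homD iotaP) lactDl.
- exact: lactDr.
- by rewrite (alg_hom1 iotaP) lact1.
- by rewrite (alg_homM iotaP) lactM.
- by rewrite (alg_homD iotaP) ractDr.
- exact: ractDl.
- by rewrite (alg_hom1 iotaP) ract1.
- by rewrite (alg_homM iotaP) ractM.
- exact: lractA.
- by rewrite (alg_homZ iotaP) (alg_hom1 iotaP) bimod_central.
Defined.

Lemma res_homP (N L : bimodule E) (f : bimod_hom N L) :
  @is_bimod_hom _ _ (res_bimod N) (res_bimod L) f.
Proof. by split=> *; rewrite /= ?bhomDE ?bhom_lE ?bhom_rE. Qed.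
Definition res_hom (N L : bimodule E) (f : bimod_hom N L) :
  bimod_hom (res_bimod N) (res_bimod L) := BimodHom (res_homP f).

Section Obj.
Variable M : bimodule A.

(** The maps [E x M x E -> G] that factor through [E (x)_A M (x)_A E]. *)
Record ind_balanced (G : zmodType) (f : E -> M -> E -> G) : Prop := IndBalanced {
  ind_balDl : forall e e' m c, f (e + e') m c = f e m c + f e' m c;
  ind_balDm : forall e m m' c, f e (m + m') c = f e m c + f e m' c;
  ind_balDr : forall e m c c', f e m (c + c') = f e m c + f e m c';
  ind_ball : forall e a m c, f (e * iota a) m c = f e (lact a m) c;
  ind_balr : forall e m a c, f e (ract m a) c = f e m (iota a * c) }.

Definition ind_eval (G : zmodType) (f : E -> M -> E -> G) (s : seq (E * M * E)) : G :=
  \sum_(p <- s) f p.1.1 p.1.2 p.2.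

(** As for the tensor product over [k]: [E (x)_A M (x)_A E] is realised by formal
    sums, identified when all balanced maps agree on them. This gives the
    universal property at once; the explicit description of the elements comes
    later, from the bases of an Ore extension. *)
Definition ind_equiv (s t : seq (E * M * E)) : bool :=
  `[< forall (G : zmodType) (f : E -> M -> E -> G),
        ind_balanced f -> ind_eval f s = ind_eval f t >].

Lemma ind_equiv_is_equiv : equiv_class_of ind_equiv.
Proof.
split=> [s|s t|t s u]; first by apply/asboolP.
  by apply/asboolP/asboolP => st G f fb; rewrite st.
by move=> /asboolP st /asboolP tu; apply/asboolP => G f fb; rewrite st // tu.
Qed.

Canonical ind_equiv_equiv := EquivRelPack ind_equiv_is_equiv.
Canonical ind_equiv_encModRel := defaultEncModRel ind_equiv.

Definition ind_type := {eq_quot ind_equiv}.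

HB.instance Definition _ := Choice.on ind_type.

Definition ind_lift (G : zmodType) (f : E -> M -> E -> G) (t : ind_type) : G :=
  ind_eval f (repr t).

Lemma ind_lift_pi (G : zmodType) (f : E -> M -> E -> G) s :
  ind_balanced f -> ind_lift f (\pi_ind_type s) = ind_eval f s.
Proof.
move=> fb; have : \pi_ind_type (repr (\pi_ind_type s)) = \pi_ind_type s.
  exact: reprK.
by move/eqP; rewrite eqmodE => /asboolP/(_ _ _ fb).
Qed.

Lemma ind_eq (t u : ind_type) :
  (forall (G : zmodType) (f : E -> M -> E -> G),
     ind_balanced f -> ind_lift f t = ind_lift f u) -> t = u.
Proof.
move=> tu; rewrite -[t]reprK -[u]reprK; apply/eqP.
by rewrite eqmodE; apply/asboolP.
Qed.

Definition ind_zero : ind_type := \pi_ind_type [::].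
Definition ind_opp (t : ind_type) : ind_type :=
  \pi_ind_type [seq (- p.1.1, p.1.2, p.2) | p <- repr t].
Definition ind_add (t u : ind_type) : ind_type := \pi_ind_type (repr t ++ repr u).

Lemma ind_lift_zero (G : zmodType) (f : E -> M -> E -> G) :
  ind_balanced f -> ind_lift f ind_zero = 0.
Proof. by move=> fb; rewrite ind_lift_pi // /ind_eval big_nil. Qed.

Lemma ind_lift_opp (G : zmodType) (f : E -> M -> E -> G) t :
  ind_balanced f -> ind_lift f (ind_opp t) = - ind_lift f t.
Proof.
move=> fb; rewrite ind_lift_pi // /ind_lift /ind_eval big_map -sumrN.
apply: eq_bigr => p _ /=; apply: (addrI (f p.1.1 p.1.2 p.2)).
rewrite -(ind_balDl fb) !subrr; apply: (addrI (f 0 p.1.2 p.2)).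
by rewrite -(ind_balDl fb) !addr0.
Qed.

Lemma ind_lift_add (G : zmodType) (f : E -> M -> E -> G) t u :
  ind_balanced f -> ind_lift f (ind_add t u) = ind_lift f t + ind_lift f u.
Proof. by move=> fb; rewrite ind_lift_pi // /ind_eval big_cat. Qed.

Lemma ind_addA : associative ind_add.
Proof. by move=> t u v; apply: ind_eq => G f fb; rewrite !ind_lift_add // addrA. Qed.
Lemma ind_addC : commutative ind_add.
Proof. by move=> t u; apply: ind_eq => G f fb; rewrite !ind_lift_add // addrC. Qed.
Lemma ind_add0 : left_id ind_zero ind_add.
Proof.
by move=> t; apply: ind_eq => G f fb; rewrite ind_lift_add // ind_lift_zero // add0r.
Qed.
Lemma ind_addN : left_inverse ind_zero ind_opp ind_add.
Proof.
move=> t; apply: ind_eq => G f fb.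
by rewrite ind_lift_add // ind_lift_opp // ind_lift_zero // addNr.
Qed.

HB.instance Definition _ :=
  GRing.isZmodule.Build ind_type ind_addA ind_addC ind_add0 ind_addN.

Definition ind_gen (e : E) (m : M) (c : E) : ind_type := \pi_ind_type [:: (e, m, c)].

Lemma ind_lift_gen (G : zmodType) (f : E -> M -> E -> G) e m c :
  ind_balanced f -> ind_lift f (ind_gen e m c) = f e m c.
Proof. by move=> fb; rewrite ind_lift_pi // /ind_eval big_seq1. Qed.

Lemma ind_liftD (G : zmodType) (f : E -> M -> E -> G) : ind_balanced f ->
  {morph ind_lift f : t u / t + u}.
Proof. by move=> fb t u; exact: ind_lift_add. Qed.

Lemma ind_gen_balanced : ind_balanced ind_gen.
Proof.
split=> *; apply: ind_eq => G f fb; rewrite ?(ind_liftD fb) !(ind_lift_gen _ _ _ fb).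
- exact: (ind_balDl fb).
- exact: (ind_balDm fb).
- exact: (ind_balDr fb).
- exact: (ind_ball fb).
- exact: (ind_balr fb).
Qed.

Lemma ind_piE s : \pi_ind_type s = \sum_(p <- s) ind_gen p.1.1 p.1.2 p.2.
Proof.
elim: s => [|[[e m] c] s IH]; first by rewrite big_nil.
rewrite big_cons -IH; apply: ind_eq => G f fb; rewrite (ind_liftD fb).
by rewrite !ind_lift_pi // /ind_eval big_cons big_seq1.
Qed.

Lemma ind_elim (Q : ind_type -> Prop) :
  Q 0 -> (forall t u, Q t -> Q u -> Q (t + u)) ->
  (forall e m c, Q (ind_gen e m c)) -> forall t, Q t.
Proof.
by move=> Q0 QD Qg t; rewrite -[t]reprK ind_piE; apply: (big_ind Q).
Qed.

Lemma morph_add0 (G H : zmodType) (g : G -> H) : {morph g : t u / t + u} -> g 0 = 0.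
Proof. by move=> gD; apply: (addrI (g 0)); rewrite -gD !addr0. Qed.

Lemma ind_ext (G : zmodType) (g h : ind_type -> G) :
  {morph g : t u / t + u} -> {morph h : t u / t + u} ->
  (forall e m c, g (ind_gen e m c) = h (ind_gen e m c)) -> forall t, g t = h t.
Proof.
move=> gD hD gh; apply: ind_elim => // [|t u gt gu].
  by rewrite (morph_add0 gD) (morph_add0 hD).
by rewrite gD hD gt gu.
Qed.

Let gb := ind_gen_balanced.

Lemma ind_gen0 e c : ind_gen e 0 c = 0.
Proof.
apply: (addrI (ind_gen e 0 c)); by rewrite -(ind_balDm gb) !addr0.
Qed.
Lemma ind_genN e m c : ind_gen e (- m) c = - ind_gen e m c.
Proof.
by apply: (addrI (ind_gen e m c)); rewrite -(ind_balDm gb) !subrr ind_gen0.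
Qed.

Lemma ind_l_balanced e : ind_balanced (fun a m c => ind_gen (e * a) m c).
Proof.
split=> *; rewrite ?mulrDr ?mulrA.
- exact: (ind_balDl gb).
- exact: (ind_balDm gb).
- exact: (ind_balDr gb).
- exact: (ind_ball gb).
- exact: (ind_balr gb).
Qed.
Lemma ind_r_balanced e : ind_balanced (fun a m c => ind_gen a m (c * e)).
Proof.
split=> *; rewrite ?mulrDl -?mulrA.
- exact: (ind_balDl gb).
- exact: (ind_balDm gb).
- exact: (ind_balDr gb).
- exact: (ind_ball gb).
- exact: (ind_balr gb).
Qed.

Definition ind_lact e := ind_lift (fun a m c => ind_gen (e * a) m c).
Definition ind_ract t e := ind_lift (fun a m c => ind_gen a m (c * e)) t.

Lemma ind_lactD e : {morph ind_lact e : t u / t + u}.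
Proof. exact: ind_liftD (ind_l_balanced e). Qed.
Lemma ind_ractD e : {morph ind_ract^~ e : t u / t + u}.
Proof. exact: ind_liftD (ind_r_balanced e). Qed.
Lemma ind_lactE e a m c : ind_lact e (ind_gen a m c) = ind_gen (e * a) m c.
Proof. exact: ind_lift_gen (ind_l_balanced e). Qed.
Lemma ind_ractE e a m c : ind_ract (ind_gen a m c) e = ind_gen a m (c * e).
Proof. exact: ind_lift_gen (ind_r_balanced e). Qed.

Local Ltac by_gen :=
  apply: ind_ext => [t u|t u|a m c];
  [ rewrite ?(ind_lactD, ind_ractD) //; exact: addrACA
  | rewrite ?(ind_lactD, ind_ractD) //; exact: addrACA
  | rewrite ?(ind_lactE, ind_ractE) ].

Definition ind_bimod : bimodule E.
Proof.
refine (@Bimodule _ _ ind_type ind_lact ind_ract _ _ _ _ _ _ _ _ _ _).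
- by move=> e e'; by_gen; rewrite mulrDl (ind_balDl gb).
- exact: ind_lactD.
- by by_gen; rewrite mul1r.
- by move=> e e'; by_gen; rewrite mulrA.
- by move=> + e e'; by_gen; rewrite mulrDr (ind_balDr gb).
- by move=> t u e; exact: ind_ractD.
- by by_gen; rewrite mulr1.
- by move=> + e e'; by_gen; rewrite mulrA.
- by move=> e + e'; by_gen.
- move=> z; by_gen.
  rewrite -pz_scalerAl mul1r -{1}[a]mulr1 pz_scalerAr -pz_scalerAr.
  have zE : z *: (1 : E) = iota (z *: (1 : A)).
    by rewrite (alg_homZ iotaP) (alg_hom1 iotaP).
  rewrite pz_scalerAr {1}zE (ind_ball gb) bimod_central (ind_balr gb) -zE.
  by rewrite -pz_scalerAl mul1r -pz_scalerAr mulr1.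
Defined.

Definition ind_unit_fun (m : M) : ind_bimod := ind_gen 1 m 1.

Lemma ind_unitP : @is_bimod_hom _ _ M (res_bimod ind_bimod) ind_unit_fun.
Proof.
split=> [m n|a m|m a].
- exact: (ind_balDm gb).
- by rewrite /= ind_lactE mulr1 -[iota a]mul1r (ind_ball gb).
- by rewrite /= ind_ractE mul1r -[iota a]mulr1 -(ind_balr gb).
Qed.
Definition ind_unit : bimod_hom M (res_bimod ind_bimod) := BimodHom ind_unitP.

Lemma ind_genE e m c : ind_gen e m c = ract (lact e (ind_unit m : ind_bimod)) c.
Proof. by rewrite /= ind_lactE ind_ractE mulr1 mul1r. Qed.

Section Extension.
Variables (N : bimodule E) (h : bimod_hom M (res_bimod N)).

Lemma ind_h_balanced : ind_balanced (fun e m c => ract (lact e (h m : N)) c).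
Proof.
split=> *; rewrite ?bhomDE ?bhom_lE ?bhom_rE /=.
- by rewrite lactDl ractDl.
- by rewrite lactDr ractDl.
- by rewrite ractDr.
- by rewrite lactM.
- by rewrite ractM -lractA.
Qed.

Lemma ind_extendP : @is_bimod_hom _ _ ind_bimod N
  (ind_lift (fun e m c => ract (lact e (h m : N)) c)).
Proof.
have fb := ind_h_balanced; have fD := ind_liftD fb.
split=> [t u|e|+ e]; first exact: fD.
- apply: ind_ext => [t u|t u|a m c]; rewrite /=.
  + by rewrite ind_lactD fD.
  + by rewrite fD lactDr.
  + by rewrite ind_lactE !(ind_lift_gen _ _ _ fb) lactM lractA.
- apply: ind_ext => [t u|t u|a m c]; rewrite /=.
  + by rewrite ind_ractD fD.
  + by rewrite fD ractDl.
  + by rewrite ind_ractE !(ind_lift_gen _ _ _ fb) ractM.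
Qed.
Definition ind_extend : bimod_hom ind_bimod N := BimodHom ind_extendP.

Lemma ind_extend_gen e m c : ind_extend (ind_gen e m c) = ract (lact e (h m : N)) c.
Proof. exact: ind_lift_gen ind_h_balanced. Qed.
Lemma ind_extend_unit m : ind_extend (ind_unit m : ind_bimod) = h m.
Proof. by rewrite [LHS]ind_extend_gen lact1 ract1. Qed.

End Extension.

Lemma ind_hom_ext (N : bimodule E) (f g : bimod_hom ind_bimod N) :
  (forall m, f (ind_unit m : ind_bimod) = g (ind_unit m : ind_bimod)) -> f = g.
Proof.
move=> fg; apply: bhom_eq; apply: ind_ext => [t u|t u|e m c].
- exact: (bhomDE f).
- exact: (bhomDE g).
- by rewrite ind_genE !bhom_rE !bhom_lE fg.
Qed.

(** Induction is left adjoint to restriction, and restriction preserves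
    surjections. *)
Lemma ind_projective : bimod_projective M -> bimod_projective ind_bimod.
Proof.
move=> Mp N L g f gsurj.
have [h hP] := Mp _ _ (res_hom g) (bhom_comp (res_hom f) ind_unit) gsurj.
exists (ind_extend h) => t; move: t.
have -> : f = bhom_comp g (ind_extend h).
  by apply: ind_hom_ext => m; rewrite /= [ind_lift _ _](ind_extend_unit h) -[RHS]/(res_hom g (h m)) hP.
by [].
Qed.

Lemma ind_fg : bimod_fg M -> bimod_fg ind_bimod.
Proof.
move=> [gens gensP]; pose gens' := [seq (ind_unit m : ind_bimod) | m <- gens].
exists gens'; apply: ind_elim => [|t u|e m c].
- by exists [::]; rewrite big_nil.
- exact: (@in_spanD _ _ ind_bimod).
have [t ->] := gensP m.
have szE : size gens = size gens' by rewrite size_map.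
exists [seq (e * iota z.1.1, cast_ord szE z.1.2, iota z.2 * c) | z <- t].
have -> : ind_gen e (\sum_(z <- t) ract (lact z.1.1 gens`_z.1.2) z.2) c =
    \sum_(z <- t) ind_gen e (ract (lact z.1.1 gens`_z.1.2) z.2) c.
  apply: (big_morph (fun m => ind_gen e m c)); last exact: ind_gen0.
  by move=> m1 m2; exact: (ind_balDm gb).
rewrite big_map; apply: eq_bigr => z _ /=.
rewrite (nth_map 0) //= (ind_balr gb) -(ind_ball gb).
by rewrite ind_lactE ind_ractE mulr1 mul1r.
Qed.

Lemma ind_zero_bimod : bimod_zero M -> bimod_zero ind_bimod.
Proof.
move=> M0; apply: ind_elim => // [t u -> ->|e m c]; first exact: addr0.
by rewrite (M0 m) ind_gen0.
Qed.

End Obj.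

Definition ind_map (M N : bimodule A) (g : bimod_hom M N) :
  bimod_hom (ind_bimod M) (ind_bimod N) := ind_extend (bhom_comp (ind_unit N) g).

Lemma ind_map_gen (M N : bimodule A) (g : bimod_hom M N) e m c :
  ind_map g (ind_gen e m c) = ind_gen e (g m) c.
Proof. by rewrite [LHS]ind_extend_gen ind_genE. Qed.

Lemma ind_map_unit (M N : bimodule A) (g : bimod_hom M N) m :
  ind_map g (ind_unit M m : ind_bimod M) = ind_unit N (g m).
Proof. exact: ind_map_gen. Qed.

End Induction.

Section Bires.
Variables (k : comPzRingType) (B : pzAlgType k) (l r : alg_aut B).
Variables (M : bimodule B) (P : proj_resolution M).

Definition bitwist_res : proj_resolution (bitwist l r M) :=
  @ProjResolution _ _ (bitwist l r M) (fun n => bitwist l r (P n))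
    (fun n => bitwist_hom l r (res_d P n)) (bitwist_hom l r (res_aug P))
    (fun n => bitwist_projective (l := l) (r := r) (@res_proj _ _ _ P n))
    (@res_aug_surj _ _ _ P) (@res_exact0 _ _ _ P) (@res_exactS _ _ _ P).
End Bires.

(** * Induction to an Ore extension *)

Section OreInduction.
Variables (k : comPzRingType) (A : pzAlgType k) (sigma : alg_aut A) (delta : A -> A).
Hypothesis delta_der : is_skew_derivation sigma delta.
Variables (E : pzAlgType k) (iota : A -> E) (x : E).
Hypothesis E_ore : is_ore_extension sigma delta iota x.

Let iotaP := ore_hom E_ore.
Let sigmaP := aut_hom sigma.
Local Notation tau := (aut_inv sigma).
Local Notation F := (ind_bimod iotaP).
Local Notation Fmap := (ind_map iotaP).
Local Notation gen := (@ind_gen _ _ _ iota _).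

Section Coordinates.
Variable M : bimodule A.

Let gb := @ind_gen_balanced _ _ _ iota M.

Lemma ind_co_balanced i j :
  @ind_balanced _ _ _ iota M _ (fun e m c => ract (lact (rco E_ore i e) m) (lco E_ore j c)).
Proof.
split=> *.
- by rewrite rcoD lactDl ractDl.
- by rewrite lactDr ractDl.
- by rewrite lcoD ractDr.
- by rewrite rco_r lactM.
- by rewrite lco_l ractM -lractA.
Qed.

(** Coordinates in the decomposition of [F M] into the pieces [x^i M x^j]. On
    the left one has to expand along the basis of [E] as a right [A]-module, and
    on the right along its basis as a left one, to get a balanced map. *)
Definition ind_co i j : F M -> M :=
  ind_lift (fun e m c => ract (lact (rco E_ore i e) m) (lco E_ore j c)).

Lemma ind_coD i j : {morph ind_co i j : t u / t + u}.
Proof. exact: ind_liftD (ind_co_balanced i j). Qed.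
Lemma ind_co_gen i j e m c :
  ind_co i j (gen e m c) = ract (lact (rco E_ore i e) m) (lco E_ore j c).
Proof. exact: ind_lift_gen (ind_co_balanced i j). Qed.
Lemma ind_co0 i j : ind_co i j 0 = 0.
Proof. exact: morph_add0 (ind_coD i j). Qed.
Lemma ind_co_sum i j (I : Type) (r : seq I) (G : I -> F M) :
  ind_co i j (\sum_(z <- r) G z) = \sum_(z <- r) ind_co i j (G z).
Proof. exact: (big_morph _ (ind_coD i j) (ind_co0 i j)). Qed.

Lemma ind_gen_suml (I : Type) (r : seq I) (G : I -> E) (m : M) c :
  gen (\sum_(z <- r) G z) m c = \sum_(z <- r) gen (G z) m c.
Proof.
apply: (big_morph (fun e => gen e m c)) => [e e'|]; first exact: (ind_balDl gb).
by apply: (addrI (gen 0 m c)); rewrite -(ind_balDl gb) !addr0.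
Qed.
Lemma ind_gen_sumr (I : Type) (r : seq I) (G : I -> E) e (m : M) :
  gen e m (\sum_(z <- r) G z) = \sum_(z <- r) gen e m (G z).
Proof.
apply: (big_morph (fun c => gen e m c)) => [c c'|]; first exact: (ind_balDr gb).
by apply: (addrI (gen e m 0)); rewrite -(ind_balDr gb) !addr0.
Qed.

(** As an abelian group [F M] is the direct sum of the copies [x^i M x^j] of [M]. *)
Lemma ind_expand (t : F M) : exists n, forall n', (n <= n')%N ->
  t = \sum_(i < n') \sum_(j < n') gen (x ^+ i) (ind_co i j t) (x ^+ j).
Proof.
move: t; apply: ind_elim => [|t u [n tE] [n' uE]|e m c].
- exists 0%N => n _; rewrite big1 // => i _; rewrite big1 // => j _.
  by rewrite ind_co0 ind_gen0.
- exists (maxn n n') => q; rewrite geq_max => /andP[nq n'q].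
  rewrite {1}(tE _ nq) {1}(uE _ n'q) -big_split; apply: eq_bigr => i _.
  rewrite -big_split; apply: eq_bigr => j _.
  by rewrite ind_coD (ind_balDm gb).
have [n eE] := rco_expand E_ore e; have [n' cE] := lco_expand E_ore c.
exists (maxn n n') => q; rewrite geq_max => /andP[nq n'q].
rewrite {1}(eE _ nq) ind_gen_suml; apply: eq_bigr => i _.
rewrite {1}(cE _ n'q) ind_gen_sumr; apply: eq_bigr => j _.
by rewrite ind_co_gen (ind_balr gb) -(ind_ball gb).
Qed.

Lemma ind_co_eq0 (t : F M) : (forall i j, ind_co i j t = 0) -> t = 0.
Proof.
move=> t0; have [n /(_ n (leqnn n)) ->] := ind_expand t.
by rewrite big1 // => i _; rewrite big1 // => j _; rewrite t0 ind_gen0.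
Qed.

End Coordinates.

Lemma ind_co_map (M N : bimodule A) (g : bimod_hom M N) i j (t : F M) :
  ind_co i j (Fmap g t) = g (ind_co i j t).
Proof.
move: t; apply: ind_ext => [t u|t u|e m c].
- by rewrite bhomDE ind_coD.
- by rewrite ind_coD bhomDE.
- by rewrite ind_map_gen !ind_co_gen bhom_rE bhom_lE.
Qed.

Lemma ind_surj (M N : bimodule A) (g : bimod_hom M N) :
  (forall n, exists m, g m = n) -> forall u, exists t, Fmap g t = u.
Proof.
move=> gsurj; apply: ind_elim => [|u u' [t <-] [t' <-]|e n c].
- by exists 0; exact: bhom0.
- by exists (t + t'); rewrite bhomDE.
- by have [m <-] := gsurj n; exists (gen e m c); rewrite ind_map_gen.
Qed.

(** The coordinates are natural in the bimodule, so exactness can be checked on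
    each piece [x^i M x^j]. *)
Lemma ind_exact (M N L : bimodule A) (f : bimod_hom M N) (g : bimod_hom N L) :
  (forall n, g n = 0 <-> exists m, f m = n) ->
  forall t, Fmap g t = 0 <-> exists u, Fmap f u = t.
Proof.
move=> fg t; split=> [gt|[u <-]]; last first.
  apply: ind_co_eq0 => i j; rewrite !ind_co_map.
  by apply/fg; eexists.
have ex i j : exists m, f m = ind_co i j t.
  by apply/fg; rewrite -ind_co_map gt ind_co0.
have [n /(_ n (leqnn n)) tE] := ind_expand t.
exists (\sum_(i < n) \sum_(j < n) gen (x ^+ i) (sval (cid (ex i j))) (x ^+ j)).
rewrite bhom_sum [RHS]tE; apply: eq_bigr => i _.
rewrite bhom_sum; apply: eq_bigr => j _.
by rewrite ind_map_gen; case: cid => m /= ->.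
Qed.

Section IndRes.
Variables (M : bimodule A) (P : proj_resolution M).

Definition ind_res : proj_resolution (F M) :=
  @ProjResolution _ _ (F M) (fun n => F (P n)) (fun n => Fmap (res_d P n))
    (Fmap (res_aug P)) (fun n => @ind_projective _ _ _ _ iotaP _ (@res_proj _ _ _ P n))
    (ind_surj (@res_aug_surj _ _ _ P)) (ind_exact (@res_exact0 _ _ _ P))
    (fun n => ind_exact (@res_exactS _ _ _ P n)).
End IndRes.

(** ** Elements of degree at most one *)

Section DegreeOne.
Variable M : bimodule A.
Let gb := @ind_gen_balanced _ _ _ iota M.

Definition deg1 (p q r : M) : F M := gen x p 1 + gen 1 q 1 + gen 1 r x.

Let co (p q r : M) i j : ind_co i j (deg1 p q r) =
  ract (lact (rco E_ore i x) p) (lco E_ore j 1) +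
  ract (lact (rco E_ore i 1) q) (lco E_ore j 1) +
  ract (lact (rco E_ore i 1) r) (lco E_ore j x).
Proof. by rewrite !ind_coD !ind_co_gen. Qed.

Let rcox i : rco E_ore i x = if i == 1%N then 1 else 0.
Proof. exact: (rco_X E_ore i 1). Qed.
Let lcox i : lco E_ore i x = if i == 1%N then 1 else 0.
Proof. exact: (lco_X E_ore i 1). Qed.
Let rco1 i : rco E_ore i 1 = if i == 0%N then 1 else 0.
Proof. exact: (rco_X E_ore i 0). Qed.
Let lco1 i : lco E_ore i 1 = if i == 0%N then 1 else 0.
Proof. exact: (lco_X E_ore i 0). Qed.

Lemma deg1_co10 p q r : ind_co 1 0 (deg1 p q r) = p.
Proof.
by rewrite co rcox !rco1 lcox lco1 /= !(lact0l, lact1, ract1, ract0, ract0r, addr0, add0r).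
Qed.
Lemma deg1_co01 p q r : ind_co 0 1 (deg1 p q r) = r.
Proof.
by rewrite co rcox !rco1 lcox lco1 /= !(lact0l, lact1, ract1, ract0, ract0r, addr0, add0r).
Qed.
Lemma deg1_co00 p q r : ind_co 0 0 (deg1 p q r) = q.
Proof.
by rewrite co rcox !rco1 lcox lco1 /= !(lact0l, lact1, ract1, ract0, ract0r, addr0, add0r).
Qed.

Lemma deg1_inj p q r p' q' r' :
  deg1 p q r = deg1 p' q' r' -> [/\ p = p', q = q' & r = r'].
Proof.
move=> H; split.
- by rewrite -[p](deg1_co10 p q r) H deg1_co10.
- by rewrite -[q](deg1_co00 p q r) H deg1_co00.
- by rewrite -[r](deg1_co01 p q r) H deg1_co01.
Qed.

Lemma deg1B p q r p' q' r' :
  deg1 p q r - deg1 p' q' r' = deg1 (p - p') (q - q') (r - r').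
Proof.
rewrite /deg1 !opprD !(ind_balDm gb) !ind_genN.
by rewrite [LHS]addrACA; congr (_ + _); exact: addrACA.
Qed.
Lemma deg1D p q r p' q' r' :
  deg1 p q r + deg1 p' q' r' = deg1 (p + p') (q + q') (r + r').
Proof.
rewrite /deg1 !(ind_balDm gb).
by rewrite [LHS]addrACA; congr (_ + _); exact: addrACA.
Qed.
Lemma deg1_0 : deg1 0 0 0 = 0.
Proof. by rewrite /deg1 !ind_gen0 !addr0. Qed.

Lemma deg1_l a p q r : lact (iota a) (deg1 p q r) =
  deg1 (lact (tau a) p) (lact a q - lact (delta (tau a)) p) (lact a r).
Proof.
have gen1 (m : M) c b : gen (iota b) m c = gen 1 (lact b m) c.
  by rewrite -[iota b]mul1r (ind_ball gb).
rewrite /deg1 !lactDr /= !ind_lactE !mulr1 !gen1 (ore_comm_inv E_ore).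
rewrite (ind_balDl gb) (ind_ball gb) -(alg_homN iotaP) gen1 lactNl.
rewrite (ind_balDm gb); congr (_ + _).
by rewrite -addrA; congr (_ + _); rewrite addrC.
Qed.

Lemma deg1_r a p q r : ract (deg1 p q r) (iota a) =
  deg1 (ract p a) (ract q a + ract r (delta a)) (ract r (sigma a)).
Proof.
rewrite /deg1 !ractDl /= !ind_ractE !mul1r (ore_comm E_ore).
rewrite (ind_balDm gb) !(ind_balr gb) !mulr1 (ind_balDr gb).
by rewrite -!addrA; do 2!congr (_ + _); rewrite addrC.
Qed.

(** Multiplication by [A] does not raise the degree in [x]. *)
Lemma deg1_closed :
  [/\ exists p q r, (0 : res_bimod iotaP (F M)) = deg1 p q r,
      forall t u : res_bimod iotaP (F M), (exists p q r, t = deg1 p q r) ->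
        (exists p q r, u = deg1 p q r) -> exists p q r, t - u = deg1 p q r,
      forall a (t : res_bimod iotaP (F M)), (exists p q r, t = deg1 p q r) ->
        exists p q r, lact a t = deg1 p q r
    & forall (t : res_bimod iotaP (F M)) a, (exists p q r, t = deg1 p q r) ->
        exists p q r, ract t a = deg1 p q r].
Proof.
split.
- by exists 0, 0, 0; rewrite deg1_0.
- by move=> t u [p [q [r ->]]] [p' [q' [r' ->]]]; rewrite deg1B; do 3!eexists.
- by move=> a t [p [q [r ->]]]; rewrite [lact _ _]deg1_l; do 3!eexists.
- by move=> t a [p [q [r ->]]]; rewrite [ract _ _]deg1_r; do 3!eexists.
Qed.

Definition deg1_sub : sub_bimodule (res_bimod iotaP (F M)) :=
  @SubBimodule _ _ (res_bimod iotaP (F M)) (fun t => exists p q r, t = deg1 p q r)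
    (let: And4 s0 _ _ _ := deg1_closed in s0)
    (let: And4 _ sB _ _ := deg1_closed in sB)
    (let: And4 _ _ sl _ := deg1_closed in sl)
    (let: And4 _ _ _ sr := deg1_closed in sr).

Definition deg1_bimod := sub_bimod deg1_sub.

Lemma deg1_sub_elt p q r : deg1_sub (deg1 p q r).
Proof. by exists p, q, r. Qed.
Definition deg1_elt p q r : deg1_bimod :=
  @Defs.SubType _ _ _ deg1_sub _ (deg1_sub_elt p q r).

Lemma deg1_eltP (t : deg1_bimod) : exists p q r, t = deg1_elt p q r.
Proof.
case: t => t [p [q [r tE]]]; exists p, q, r; exact: sub_val_inj.
Qed.

End DegreeOne.

Lemma deg1_map (M N : bimodule A) (g : bimod_hom M N) p q r :
  Fmap g (deg1 p q r) = deg1 (g p) (g q) (g r).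
Proof. by rewrite /deg1 !bhomDE !ind_map_gen. Qed.

Section Deg1Map.
Variables (M N : bimodule A) (g : bimod_hom M N).

Lemma deg1_map_sub (t : deg1_bimod M) : deg1_sub N (Fmap g (sub_val t)).
Proof.
have [p [q [r ->]]] := deg1_eltP t.
by exists (g p), (g q), (g r); exact: deg1_map.
Qed.

Lemma deg1_homP : @is_bimod_hom _ _ (deg1_bimod M) (deg1_bimod N)
  (fun t => @Defs.SubType _ _ _ (deg1_sub N) _ (deg1_map_sub t)).
Proof.
have H := res_homP iotaP (Fmap g).
split=> *; apply: sub_val_inj.
- exact: (bhomD H).
- exact: (bhom_l H).
- exact: (bhom_r H).
Qed.
Definition deg1_hom : bimod_hom (deg1_bimod M) (deg1_bimod N) := BimodHom deg1_homP.

Lemma deg1_homE p q r : deg1_hom (deg1_elt p q r) = deg1_elt (g p) (g q) (g r).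
Proof. by apply: sub_val_inj; exact: deg1_map. Qed.

Lemma deg1_hom_eq0 p q r :
  deg1_hom (deg1_elt p q r) = 0 -> [/\ g p = 0, g q = 0 & g r = 0].
Proof.
rewrite deg1_homE => /(congr1 (fun t => sub_val t)) /= H.
by apply: deg1_inj; rewrite H deg1_0.
Qed.

Lemma deg1_hom_surj : (forall n, exists m, g m = n) ->
  forall u, exists t, deg1_hom t = u.
Proof.
move=> gs u; have [p [q [r ->]]] := deg1_eltP u.
have [p' <-] := gs p; have [q' <-] := gs q; have [r' <-] := gs r.
by exists (deg1_elt p' q' r'); rewrite deg1_homE.
Qed.

End Deg1Map.

Lemma deg1_exact (M N L : bimodule A) (f : bimod_hom M N) (g : bimod_hom N L) :
  (forall n, g n = 0 <-> exists m, f m = n) ->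
  forall t, deg1_hom g t = 0 -> exists u, deg1_hom f u = t.
Proof.
move=> fg t; have [p [q [r ->]]] := deg1_eltP t.
move=> /deg1_hom_eq0[/fg[p' <-] /fg[q' <-] /fg[r' <-]].
by exists (deg1_elt p' q' r'); rewrite deg1_homE.
Qed.

(** ** The Koszul sequence *)

Local Notation tw := (bitwist (inv_aut sigma) (id_aut A)).
Local Notation regA := (regular_bimod A).

Lemma deltaD a b : delta (a + b) = delta a + delta b.
Proof. by case: delta_der => dl _; rewrite -[a]scale1r dl !scale1r. Qed.
Lemma deltaM a b : delta (a * b) = delta a * b + sigma a * delta b.
Proof. by case: delta_der. Qed.
Lemma delta1 : delta 1 = 0.
Proof.
have := deltaM 1 1; rewrite !mulr1 (alg_hom1 sigmaP) mul1r.
by rewrite -[X in X = _]addr0 => /addrI.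
Qed.

(** In coordinates, [a |-> x (x) a - 1 (x) x a]; the left action of the twist
    makes this linear because [b x = x t(b) - delta(t(b))], with [t] the inverse
    of [sigma]. *)
Lemma koszul_homP : @is_bimod_hom _ _ (tw regA) (deg1_bimod regA)
  (fun a => @deg1_elt regA a (- delta a) (- sigma a)).
Proof.
split=> [a b|a m|m a]; apply: sub_val_inj.
- by rewrite /= deltaD (alg_homD sigmaP) [RHS](@deg1D regA) !opprD.
- rewrite [RHS](@deg1_l regA) /= deltaM (alg_homM sigmaP) autVK.
  by congr deg1; rewrite ?mulrN // opprD addrC.
- rewrite [RHS](@deg1_r regA) /= deltaM (alg_homM sigmaP).
  by congr deg1; rewrite ?mulNr // opprD.
Qed.
Definition koszul_hom : bimod_hom (tw regA) (deg1_bimod regA) := BimodHom koszul_homP.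

Lemma deg1_valP (M : bimodule A) :
  @is_bimod_hom _ _ (deg1_bimod M) (res_bimod iotaP (F M)) (fun t => sub_val t).
Proof. by []. Qed.
Definition deg1_val (M : bimodule A) := BimodHom (deg1_valP M).

Definition koszul : bimod_hom (F (tw regA)) (F regA) :=
  ind_extend (bhom_comp (deg1_val regA) koszul_hom).

Lemma mult_homP : @is_bimod_hom _ _ regA (res_bimod iotaP (regular_bimod E)) iota.
Proof.
by split=> *; rewrite /= ?(alg_homD iotaP) ?(alg_homM iotaP).
Qed.
Definition mult : bimod_hom (F regA) (regular_bimod E) := ind_extend (BimodHom mult_homP).

Let w0 : F (tw regA) := ind_unit iotaP (tw regA) (1 : A).
Let w : F regA := ind_unit iotaP regA (1 : A).

Lemma koszul_w0 : koszul w0 = lact (- 1) (ract w x) + lact x w.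
Proof.
rewrite [LHS]ind_extend_unit.
transitivity (@deg1 regA 1 (- delta 1) (- sigma 1)); first by [].
rewrite delta1 (alg_hom1 sigmaP) oppr0 /deg1 ind_gen0 addr0 ind_genN addrC.
congr (_ + _).
  by rewrite lactNl lact1 /w /= ind_ractE mul1r.
by rewrite /w /= ind_lactE mulr1.
Qed.

(** If [M] is cyclic as a left module, then [F M] is spanned over [E] by the
    [m0 x^j]: coefficients on the right of [m0] can be moved to its left. *)
Lemma ind_cyclic_span (M : bimodule A) (m0 : M) :
  (forall m, exists a, m = lact a m0) ->
  forall z, exists n, low (xmono x (ind_unit iotaP M m0 : F M)) n z.
Proof.
move=> mcyc; have D := @xmonoD _ _ x _ (ind_unit iotaP M m0 : F M).
apply: ind_elim => [|t u [n tl] [n' ul]|e m c].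
- by exists 0%N; exact: (low0 D).
- exists (maxn n n'); apply: (lowD D).
  + exact: (low_widen D (leq_maxl _ _) tl).
  + exact: (low_widen D (leq_maxr _ _) ul).
have [n /(_ n (leqnn n)) ->] := lco_expand E_ore c; exists n.
rewrite ind_gen_sumr; apply: (low_sum D) => j.
have gb := @ind_gen_balanced _ _ _ iota M.
have [a aE] := mcyc (ract m (lco E_ore j c)).
have -> : gen e m (iota (lco E_ore j c) * x ^+ j) =
    xmono x (ind_unit iotaP M m0 : F M) j (e * iota a).
  rewrite -(ind_balr gb) aE -(ind_ball gb).
  by rewrite /xmono /= ind_lactE ind_ractE mulr1 mul1r.
exact: (low_term D).
Qed.

Lemma ind_regular_free n c : gsum (xmono x w) n c = 0 ->
  forall i, (i < n)%N -> c i = 0.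
Proof.
move=> c0 j jn.
suff rc i : rco E_ore i (c j) = 0.
  have [q /(_ q (leqnn q)) ->] := rco_expand E_ore (c j).
  by apply: big1 => i _; rewrite rc (alg_hom0 iotaP) mulr0.
have := ind_co0 regA i j; rewrite -[X in ind_co _ _ X]c0 /gsum ind_co_sum.
rewrite (bigD1 (Ordinal jn)) //= big1 => [|j' j'j].
  rewrite addr0 /xmono /w /= ind_lactE ind_ractE mulr1 mul1r ind_co_gen /=.
  by rewrite lco_X eqxx !mulr1.
rewrite /xmono /w /= ind_lactE ind_ractE mulr1 mul1r ind_co_gen /=.
rewrite lco_X ifF ?mulr0 //; apply: contraNF j'j => /eqP jj'.
by apply/eqP/val_inj.
Qed.

Let span0 := @ind_cyclic_span (tw regA) (1 : A)
  (fun m => ex_intro _ (sigma m) (esym (etrans (mulr1 _) (autK sigma m)))).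
Let span := @ind_cyclic_span regA (1 : A)
  (fun m => ex_intro _ (m : A) (esym (mulr1 _))).

(** Both halves of the exactness of the Koszul sequence are instances of the
    division of [F A] by the leading term [- w x] of [koszul w0]. *)
Lemma koszul_inj z : koszul z = 0 -> z = 0.
Proof.
move=> z0; have N1 : (-1) * (-1) = 1 :> E by rewrite mulrNN mulr1.
have := @ore_cokernel_free _ _ x _ _ koszul w0 w _ _ _ N1 span0 ind_regular_free koszul_w0 z 0.
by rewrite lact0l => /(_ z0)[].
Qed.

Lemma mult_surj e : exists z, mult z = e.
Proof.
exists (lact e w); rewrite bhom_lE [mult w]ind_extend_unit /= (alg_hom1 iotaP).
exact: mulr1.
Qed.

Lemma mult_exact z : mult z = 0 <-> exists y, koszul y = z.
Proof.
have mw : mult w = 1 by rewrite [mult w]ind_extend_unit /= (alg_hom1 iotaP).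
have mk y : mult (koszul y) = 0.
  have -> : mult (koszul y) = bhom_comp mult koszul y by [].
  have -> : bhom_comp mult koszul = bhom_zero _ _; last by [].
  apply: ind_hom_ext => a.
  (* [w0] generates the source, and [koszul w0] multiplies to [x - x]. *)
  have -> : ind_unit iotaP (tw regA) a = lact (iota (sigma a)) w0 :> F (tw regA).
    rewrite [RHS]/= ind_lactE mulr1 -[iota _]mul1r (ind_ball (@ind_gen_balanced _ _ _ iota (tw regA))).
    by rewrite /= autK mulr1.
  rewrite bhom_lE /= -[ind_lift _ w0]/(koszul w0) -[X in _ * X]/(mult (koszul w0)) koszul_w0.
  rewrite bhomDE !bhom_lE bhom_rE mw /= mul1r mulr1 mulN1r addNr.
  exact: mulr0.
have N1 : (-1) * (-1) = 1 :> E by rewrite mulrNN mulr1.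
split=> [|[y <-] //].
have [y [e ->]] := @ore_cokernel_span _ _ x _ _ koszul w0 w _ _ _ N1 span koszul_w0 z.
have -> : mult (koszul y + lact e w) = e.
  by rewrite bhomDE mk add0r bhom_lE mw; exact: mulr1.
move=> ->.
by exists y; rewrite lact0l addr0.
Qed.

End OreInduction.

(** * Cochains with values in the enveloping algebra of an Ore extension *)

Section OreTensor.
Variables (k : comPzRingType) (A : pzAlgType k) (sigma : alg_aut A) (delta : A -> A).
Variables (E : pzAlgType k) (iota : A -> E) (x : E).
Hypothesis E_ore : is_ore_extension sigma delta iota x.

Let iotaP := ore_hom E_ore.
Local Notation F := (ind_bimod iotaP).
Local Notation lco := (lco E_ore).
Local Notation rco := (rco E_ore).
Local Notation AA := (tensor A A).
Local Notation EE := (tensor E E).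

Let tA := @tens_balanced k A A.
Let tE := @tens_balanced k E E.

Lemma tens_iota_balanced : balanced (fun m n : A => tens (iota m) (iota n) : EE).
Proof.
split=> *; rewrite ?(alg_homD iotaP) ?(alg_homZ iotaP).
- exact: (balancedDl tE).
- exact: (balancedDr tE).
- exact: (balancedZ tE).
Qed.
Definition tens_iota : AA -> EE := tensor_lift (fun m n : A => tens (iota m) (iota n) : EE).
Lemma tens_iotaE m n : tens_iota (tens m n) = tens (iota m) (iota n).
Proof. exact: tensor_lift_tens tens_iota_balanced. Qed.
Lemma tens_iotaD : {morph tens_iota : t u / t + u}.
Proof. by move=> t u; exact: tensor_liftD tens_iota_balanced. Qed.

Lemma tens_co_balanced i j : balanced (fun m n : E => tens (lco i m) (rco j n) : AA).
Proof.
split=> *; rewrite ?lcoD ?rcoD ?lcoZ ?rcoZ.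
- exact: (balancedDl tA).
- exact: (balancedDr tA).
- exact: (balancedZ tA).
Qed.
(** Coordinates in the decomposition of [E (x) E] into the pieces
    [A x^i (x) x^j A]. The bases are opposite to those of [ind_co], because here
    it is the outer action of [A] that has to be respected. *)
Definition tens_co i j : EE -> AA :=
  tensor_lift (fun m n : E => tens (lco i m) (rco j n) : AA).
Lemma tens_coE i j m n : tens_co i j (tens m n) = tens (lco i m) (rco j n).
Proof. exact: tensor_lift_tens (tens_co_balanced i j). Qed.
Lemma tens_coD i j : {morph tens_co i j : t u / t + u}.
Proof. by move=> t u; exact: tensor_liftD (tens_co_balanced i j). Qed.

Local Ltac by_tens :=
  apply: tensor_lift_uniq => [t u|t u|m n];
  [ by rewrite ?(tens_coD, tens_iotaD, tmullD, tmulrD, tnullD, tnulrD)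
  | by rewrite ?(tens_coD, tens_iotaD, tmullD, tmulrD, tnullD, tnulrD)
  | rewrite !(tens_coE, tens_iotaE, tmullE, tmulrE, tnullE, tnulrE) ].

Lemma tens_iota_mull a t : tens_iota (tmull a t) = tmull (iota a) (tens_iota t).
Proof.
move: t; by_tens; by rewrite (alg_homM iotaP).
Qed.
Lemma tens_iota_nulr a t : tens_iota (tnulr a t) = tnulr (iota a) (tens_iota t).
Proof. move: t; by_tens; by rewrite (alg_homM iotaP). Qed.
Lemma tens_iota_null a t : tens_iota (tnull a t) = tnull (iota a) (tens_iota t).
Proof. move: t; by_tens; by rewrite (alg_homM iotaP). Qed.
Lemma tens_iota_mulr a t : tens_iota (tmulr a t) = tmulr (iota a) (tens_iota t).
Proof. move: t; by_tens; by rewrite (alg_homM iotaP). Qed.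
Lemma tens_co_mull i j a t : tens_co i j (tmull (iota a) t) = tmull a (tens_co i j t).
Proof. move: t; by_tens; by rewrite lco_l. Qed.
Lemma tens_co_nulr i j a t : tens_co i j (tnulr (iota a) t) = tnulr a (tens_co i j t).
Proof. move: t; by_tens; by rewrite rco_r. Qed.

Lemma tens_co_place i j i' e t :
  tens_co i j (tmulr (x ^+ i') (tnull e (tens_iota t))) =
  if i == i' then tnull (rco j e) t else 0.
Proof.
move: t; apply: tensor_lift_uniq => [t u|t u|m n].
- by rewrite tens_iotaD tnullD tmulrD tens_coD.
- by case: eqP => _; rewrite ?tnullD ?addr0.
rewrite tens_iotaE !tnullE tmulrE tens_coE lco_mono rco_r; case: eqP => // _.
by apply: (addrI (tens 0 (rco j e * n))); rewrite -(balancedDl tA) !addr0.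
Qed.

Lemma tens_iota_homP :
  @is_bimod_hom _ _ (outer_bimod A) (res_bimod iotaP (outer_bimod E)) tens_iota.
Proof. by split=> [t u|a t|t a]; [exact: tens_iotaD|exact: tens_iota_mull|exact: tens_iota_nulr]. Qed.
Definition tens_iota_hom := BimodHom tens_iota_homP.
Lemma tens_co_homP i j :
  @is_bimod_hom _ _ (res_bimod iotaP (outer_bimod E)) (outer_bimod A) (tens_co i j).
Proof. by split=> [t u|a t|t a]; [exact: tens_coD|exact: tens_co_mull|exact: tens_co_nulr]. Qed.
Definition tens_co_hom i j := BimodHom (tens_co_homP i j).

Definition tens_expand n (t : EE) : EE :=
  \sum_(i < n) \sum_(j < n) tmulr (x ^+ i) (tnull (x ^+ j) (tens_iota (tens_co i j t))).

Lemma tens_expandD n : {morph tens_expand n : t u / t + u}.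
Proof.
move=> t u; rewrite /tens_expand -big_split; apply: eq_bigr => i _.
rewrite -big_split; apply: eq_bigr => j _.
by rewrite tens_coD tens_iotaD tnullD tmulrD.
Qed.

Lemma tmull_sum (a : E) n (G : 'I_n -> EE) :
  tmull a (\sum_i G i) = \sum_i tmull a (G i).
Proof.
by apply: (big_morph _ (tmullD a)); exact: morph_add0 (tmullD a).
Qed.
Lemma tnulr_sum (a : E) n (G : 'I_n -> EE) :
  tnulr a (\sum_i G i) = \sum_i tnulr a (G i).
Proof.
by apply: (big_morph _ (tnulrD a)); exact: morph_add0 (tnulrD a).
Qed.

Lemma tens_expand_mull n a t : tens_expand n (tmull (iota a) t) = tmull (iota a) (tens_expand n t).
Proof.
rewrite /tens_expand tmull_sum; apply: eq_bigr => i _.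
rewrite tmull_sum; apply: eq_bigr => j _.
by rewrite tens_co_mull tens_iota_mull tmull_tmulr tmull_tnull.
Qed.
Lemma tens_expand_nulr n a t : tens_expand n (tnulr (iota a) t) = tnulr (iota a) (tens_expand n t).
Proof.
rewrite /tens_expand tnulr_sum; apply: eq_bigr => i _.
rewrite tnulr_sum; apply: eq_bigr => j _.
by rewrite tens_co_nulr tens_iota_nulr tnulr_tmulr tnulr_tnull.
Qed.

(** The outer [A]-bimodule [E (x) E] is the direct sum of the copies
    [A x^i (x) x^j A] of [A (x) A]. *)
Lemma tens_expandE t : exists n, forall n', (n <= n')%N -> t = tens_expand n' t.
Proof.
rewrite -[t]reprK pi_tensorE.
apply: (big_ind (fun t => exists n, forall n', (n <= n')%N -> t = tens_expand n' t)).
- by exists 0%N => n _; rewrite (morph_add0 (tens_expandD n)).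
- move=> u v [n uE] [n' vE]; exists (maxn n n') => q; rewrite geq_max => /andP[nq n'q].
  by rewrite tens_expandD -uE // -vE.
move=> [m n] _ /=.
have [q mE] := lco_expand E_ore m; have [q' nE] := rco_expand E_ore n.
exists (maxn q q') => p; rewrite geq_max => /andP[qp q'p].
have Dl c := fun a b => balancedDl tE a b c.
have Dr c := fun a b => balancedDr tE c a b.
rewrite {1}(mE _ qp) (big_morph (fun a => tens a n) (Dl n) (morph_add0 (Dl n))).
apply: eq_bigr => i _.
rewrite {1}(nE _ q'p) (big_morph _ (Dr _) (morph_add0 (Dr _))).
by apply: eq_bigr => j _; rewrite tens_coE tens_iotaE tnullE tmulrE.
Qed.

Section Resolution.
Variables (M : bimodule A) (T : proj_resolution M).
Local Notation FT := (ind_res E_ore T).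

Lemma dual_sumE n (I : Type) (r : seq I) (G : I -> dual_bimod (FT n)) p :
  (\sum_(i <- r) G i) p = \sum_(i <- r) G i p.
Proof. exact: (big_morph (fun f : dual_bimod (FT n) => f p)). Qed.

(** The two operations compare cochains of [T] with values in [A (x) A] and
    cochains of the induced resolution with values in [E (x) E]: extension of
    scalars, and the component in the piece [A x^i (x) x^j A]. *)
Definition extend_cochain n (g : dual_bimod (T n)) : dual_bimod (FT n) :=
  ind_extend (bhom_comp tens_iota_hom g).

Definition cochain_co i j n (f : dual_bimod (FT n)) : dual_bimod (T n) :=
  bhom_comp (tens_co_hom i j) (bhom_comp (res_hom iotaP f) (ind_unit iotaP (T n))).

Lemma extend_cochain_unit n (g : dual_bimod (T n)) p :
  extend_cochain g (ind_unit iotaP (T n) p : F (T n)) = tens_iota (g p).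
Proof. exact: ind_extend_unit. Qed.

Lemma dual_ext n (f g : dual_bimod (FT n)) :
  (forall p, f (ind_unit iotaP (T n) p : F (T n)) =
             g (ind_unit iotaP (T n) p : F (T n))) -> f = g.
Proof. exact: ind_hom_ext. Qed.

Lemma extend_cochainD n (g h : dual_bimod (T n)) :
  extend_cochain (g + h) = extend_cochain g + extend_cochain h.
Proof.
apply: dual_ext => p; rewrite extend_cochain_unit tens_iotaD.
by rewrite -!extend_cochain_unit.
Qed.
Lemma extend_cochainB n (g h : dual_bimod (T n)) :
  extend_cochain (g - h) = extend_cochain g - extend_cochain h.
Proof. by apply: (addIr (extend_cochain h)); rewrite -extend_cochainD !subrK. Qed.
Lemma extend_cochain_l n a (g : dual_bimod (T n)) :
  extend_cochain (lact a g) = lact (iota a) (extend_cochain g).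
Proof.
apply: dual_ext => p; rewrite extend_cochain_unit.
transitivity (tnull (iota a) (extend_cochain g (ind_unit iotaP (T n) p : F (T n)))); last by [].
by rewrite extend_cochain_unit -tens_iota_null.
Qed.
Lemma extend_cochain_r n a (g : dual_bimod (T n)) :
  extend_cochain (ract g a) = ract (extend_cochain g) (iota a).
Proof.
apply: dual_ext => p; rewrite extend_cochain_unit.
transitivity (tmulr (iota a) (extend_cochain g (ind_unit iotaP (T n) p : F (T n)))); last by [].
by rewrite extend_cochain_unit -tens_iota_mulr.
Qed.

Lemma extend_cochain_comp n (g : dual_bimod (T n)) :
  extend_cochain (bhom_comp g (res_d T n)) = bhom_comp (extend_cochain g) (res_d FT n).
Proof.
apply: dual_ext => p; rewrite extend_cochain_unit.
transitivity (extend_cochain g (res_d FT n (ind_unit iotaP (T n.+1) p : F (T n.+1)))); last by [].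
by rewrite [res_d FT n _]ind_map_unit extend_cochain_unit.
Qed.

Lemma extend_cochain_cocycle n (g : dual_bimod (T n)) : is_cocycle g -> is_cocycle (extend_cochain g).
Proof.
move=> gz p; rewrite -[LHS]/(bhom_comp (extend_cochain g) (res_d FT n) p) -extend_cochain_comp.
have -> : bhom_comp g (res_d T n) = (0 : dual_bimod (T n.+1)) by apply: bhom_eq => q; exact: gz.
have -> : extend_cochain (0 : dual_bimod (T n.+1)) = 0; last by [].
by apply: (addrI (extend_cochain 0)); rewrite -extend_cochainD !addr0.
Qed.

Lemma extend_cochain_coboundary n (g : dual_bimod (T n)) :
  is_coboundary g -> is_coboundary (extend_cochain g).
Proof.
rewrite /is_coboundary; case: n g => [g ->|n g [h ->]].
  by apply: (addrI (extend_cochain 0)); rewrite -extend_cochainD !addr0.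
by exists (extend_cochain h); exact: extend_cochain_comp.
Qed.

Lemma cochain_co_comp i j n (f : dual_bimod (FT n)) :
  cochain_co i j (bhom_comp f (res_d FT n)) = bhom_comp (cochain_co i j f) (res_d T n).
Proof.
apply: bhom_eq => p.
transitivity (tens_co i j (f (res_d FT n (ind_unit iotaP (T n.+1) p : F (T n.+1))))); first by [].
by rewrite [res_d FT n _]ind_map_unit.
Qed.

Lemma cochain_co_cocycle i j n (f : dual_bimod (FT n)) :
  is_cocycle f -> is_cocycle (cochain_co i j f).
Proof.
move=> fz p; rewrite -[LHS]/(bhom_comp (cochain_co i j f) (res_d T n) p) -cochain_co_comp.
rewrite -[RHS](morph_add0 (tens_coD i j)).
transitivity (tens_co i j (f (res_d FT n (ind_unit iotaP (T n.+1) p : F (T n.+1))))); first by [].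
by rewrite fz.
Qed.

Lemma cochain_coD i j n (f g : dual_bimod (FT n)) :
  cochain_co i j (f + g) = cochain_co i j f + cochain_co i j g.
Proof. by apply: bhom_eq => p; exact: tens_coD. Qed.
Lemma cochain_co0 i j n : cochain_co i j (0 : dual_bimod (FT n)) = 0.
Proof. by apply: (addrI (cochain_co i j 0)); rewrite -cochain_coD !addr0. Qed.

Lemma cochain_co_coboundary i j n (f : dual_bimod (FT n)) :
  is_coboundary f -> is_coboundary (cochain_co i j f).
Proof.
rewrite /is_coboundary; case: n f => [f ->|n f [h ->]]; first exact: cochain_co0.
by exists (cochain_co i j h); exact: cochain_co_comp.
Qed.

Lemma cochain_co_place i j i' e n (g : dual_bimod (T n)) :
  cochain_co i j (xmono x (extend_cochain g) i' e) = if i == i' then lact (rco j e) g else 0.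
Proof.
apply: bhom_eq => p.
transitivity (tens_co i j (tmulr (x ^+ i') (tnull e
  (extend_cochain g (ind_unit iotaP (T n) p : F (T n)))))); first by [].
by rewrite extend_cochain_unit tens_co_place; case: eqP.
Qed.

(** The bound [q] exists because a cochain on a finitely generated bimodule is
    determined by finitely many values, each of which has finitely many nonzero
    coordinates. *)
Lemma cochain_co_expand n (f : dual_bimod (FT n)) : bimod_fg (T n) -> exists q,
  f = \sum_(i < q) \sum_(j < q) xmono x (extend_cochain (cochain_co i j f)) i (x ^+ j).
Proof.
move=> [gens gensP].
pose h := bhom_comp (res_hom iotaP f) (ind_unit iotaP (T n)).
have [q qP] : exists q, forall q', (q <= q')%N -> forall g, g \in gens ->
    h g = tens_expand q' (h g).
  elim: gens {gensP} => [|g gens [q qP]]; first by exists 0%N.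
  have [q' q'P] := tens_expandE (h g).
  exists (maxn q q') => s; rewrite geq_max => /andP[qs q's] g'.
  rewrite inE => /orP[/eqP->|]; [exact: q'P | exact: qP].
exists q; apply: dual_ext => p.
transitivity (h p); first by [].
have -> : h p = tens_expand q (h p).
  have [t ->] := gensP p; rewrite bhom_sum.
  rewrite (big_morph _ (tens_expandD q) (morph_add0 (tens_expandD q))).
  apply: eq_bigr => z _; rewrite bhom_rE bhom_lE [RHS]tens_expand_nulr tens_expand_mull.
  by rewrite -qP // mem_nth.
rewrite dual_sumE; apply: eq_bigr => i _.
rewrite dual_sumE; apply: eq_bigr => j _.
symmetry; transitivity (tmulr (x ^+ i) (tnull (x ^+ j)
  (extend_cochain (cochain_co i j f) (ind_unit iotaP (T n) p : F (T n))))); first by [].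
by rewrite extend_cochain_unit.
Qed.

(** Every component of a cocycle is a cocycle of [T]. *)
Lemma ind_ext_vanish n : bimod_fg (T n) ->
  (forall g : dual_bimod (T n), is_cocycle g -> is_coboundary g) ->
  forall f : dual_bimod (FT n), is_cocycle f -> is_coboundary f.
Proof.
move=> fg vanish f fz; have [q ->] := cochain_co_expand f fg.
apply: is_coboundary_sum => i; apply: is_coboundary_sum => j.
apply/is_coboundary_r/is_coboundary_l/extend_cochain_coboundary/vanish.
exact: cochain_co_cocycle.
Qed.

Section Generator.
Variables (d : nat) (w : dual_bimod (T d)).
Hypothesis Td_fg : bimod_fg (T d).
Hypothesis wz : is_cocycle w.
Hypothesis w_span : forall g : dual_bimod (T d), is_cocycle g ->
  exists a, is_coboundary (g - lact a w).
Hypothesis w_free : forall a, is_coboundary (lact a w) -> a = 0.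

Local Notation W := (ext_cls (extend_cochain_cocycle wz)).

Lemma xmono_cls_sum n c : exists fz,
  gsum (xmono x W) n c = @ext_cls _ _ _ FT d (gsum (xmono x (extend_cochain w)) n c) fz.
Proof.
elim: n => [|n [fz IH]].
  have z0 : is_cocycle (0 : dual_bimod (FT d)) by exact: is_cocycle0.
  by rewrite !gsum0; exists z0; symmetry; apply/ext_cls0; exact: is_coboundary0.
rewrite !gsum_recr IH.
have pz : is_cocycle (xmono x (extend_cochain w) n (c n)).
  exact: (is_cocycle_r _ (is_cocycle_l _ (extend_cochain_cocycle wz))).
have -> : xmono x W n (c n) = ext_cls pz.
  rewrite /xmono (ext_cls_l _ (is_cocycle_l (c n) (extend_cochain_cocycle wz))).
  rewrite (ext_cls_r _ (is_cocycle_r (x ^+ n) (is_cocycle_l (c n) (extend_cochain_cocycle wz)))).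
  by apply/ext_cls_eq; rewrite subrr; exact: is_coboundary0.
have sz := is_cocycleD fz pz.
by exists sz; rewrite (ext_clsD _ _ sz).
Qed.

(** Each component [g_ij] of a cocycle is cohomologous to some [a_ij w]; the
    coefficient of [W x^i] is then the sum over [j] of the [x^j a_ij]. *)
Lemma ind_ext_span z : exists n, low (xmono x W) n z.
Proof.
have [f [fz ->]] := ext_clsP z; have [q fE] := cochain_co_expand f Td_fg.
have aP i j := w_span (cochain_co_cocycle i j fz).
pose a i j := sval (cid (aP i j)).
exists q, (fun i => \sum_(j < q) x ^+ j * iota (a i j)).
have [gz ->] := xmono_cls_sum q (fun i => \sum_(j < q) x ^+ j * iota (a i j)).
apply/ext_cls_eq; rewrite {1}fE /gsum -sumrB; apply: is_coboundary_sum => i.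
have D := @xmonoD _ _ x _ (extend_cochain w) i.
rewrite (big_morph _ D (morph_add0 D)) -sumrB; apply: is_coboundary_sum => j.
have -> : xmono x (extend_cochain w) i (x ^+ j * iota (a i j)) =
    ract (lact (x ^+ j) (extend_cochain (lact (a i j) w))) (x ^+ i).
  by rewrite /xmono lactM extend_cochain_l.
rewrite /xmono -ractB -lactB -extend_cochainB.
apply/is_coboundary_r/is_coboundary_l/extend_cochain_coboundary.
exact: (svalP (cid (aP i j))).
Qed.

(** The component at [(i, j)] of a combination of the [W x^i] recovers the
    coefficient of [x^j] in the multiplier of [W x^i]. *)
Lemma ind_ext_free n c : gsum (xmono x W) n c = 0 ->
  forall i, (i < n)%N -> c i = 0.
Proof.
have [fz ->] := xmono_cls_sum n c; move/ext_cls0 => fb i ni.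
suff rc j : rco j (c i) = 0.
  have [q /(_ q (leqnn q)) ->] := rco_expand E_ore (c i).
  by apply: big1 => j _; rewrite rc (alg_hom0 iotaP) mulr0.
apply: w_free.
have := cochain_co_coboundary i j fb.
rewrite /gsum (big_morph (@cochain_co i j d) (@cochain_coD i j d) (@cochain_co0 i j d)).
rewrite (bigD1 (Ordinal ni)) //= cochain_co_place eqxx big1 ?addr0 // => i' i'i.
rewrite cochain_co_place ifF //; apply: contraNF i'i => /eqP ii'.
by apply/eqP/val_inj.
Qed.

End Generator.

End Resolution.

End OreTensor.

(** * Twists of the regular bimodule *)

Section FreeRankOne.
Variables (k : comPzRingType) (B : pzAlgType k).

Lemma bimod_iso_sym (M N : bimodule B) : bimod_iso M N -> bimod_iso N M.
Proof.
move=> [f [g fK gK]].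
have gP : is_bimod_hom g.
  split=> [m n|a m|m a]; apply: (can_inj fK); rewrite gK.
  - by rewrite bhomDE !gK.
  - by rewrite bhom_lE gK.
  - by rewrite bhom_rE gK.
by exists (BimodHom gP); exists f.
Qed.

Section Generator.
Variables (L : bimodule B) (om : L).
Hypothesis om_bij : bijective (fun e : B => lact e om).

Let om_inj (e e' : B) : lact e om = lact e' om -> e = e'.
Proof. exact: (bij_inj om_bij). Qed.

(** If [L] is free of rank one on [om] as a left module, then writing the right
    action in terms of the left one defines an algebra endomorphism, with no
    relations to be checked. *)
Lemma right_action_endo : exists nu : B -> B, is_alg_hom nu /\
  forall e, ract om e = lact (nu e) om.
Proof.
have [g gK Kg] := om_bij.
pose nu e := g (ract om e).
have nuE e : ract om e = lact (nu e) om by rewrite [RHS]Kg.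
exists nu; split=> //; split=> [c a b|]; last split=> [|a b]; apply: om_inj.
- rewrite -nuE ractDr nuE lactDl -!nuE; congr (_ + _).
  have -> : c *: nu a = (c *: (1 : B)) * nu a by rewrite -pz_scalerAl mul1r.
  rewrite lactM -nuE -lractA bimod_central -ractM.
  by rewrite -pz_scalerAl mul1r.
- by rewrite -nuE ract1 lact1.
- by rewrite -nuE ractM nuE lractA nuE -lactM.
Qed.

Lemma twist_iso (nu : alg_aut B) : (forall e, ract om e = lact (nu e) om) ->
  bimod_iso L (twist_bimod (regular_bimod B) nu).
Proof.
move=> nuE; apply: bimod_iso_sym.
have gP : @is_bimod_hom _ _ (twist_bimod (regular_bimod B) nu) L
    (fun e : B => lact e om).
  split=> [m n|a m|m a].
  - exact: lactDl.
  - exact: lactM.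
  - by rewrite [LHS]lactM -nuE lractA.
by exists (BimodHom gP).
Qed.

End Generator.

(** [w] represents the image of [1] under the isomorphism of [B^nu] with Ext. *)
Lemma CY_cocycle (P : proj_resolution (regular_bimod B)) d (nu : alg_aut B) :
  bimod_iso (Ext_env P d) (twist_bimod (regular_bimod B) nu) ->
  exists w : dual_bimod (P d), [/\ is_cocycle w,
    forall g : dual_bimod (P d), is_cocycle g ->
      exists a, is_coboundary (g - lact a w),
    forall a, is_coboundary (lact a w) -> a = 0
  & forall b, is_coboundary (ract w b - lact (nu b) w)].
Proof.
move=> [f [g fK gK]].
have [w [wz wE]] := ext_clsP (g (1 : B)).
have fw : f (ext_cls wz) = 1 by rewrite -wE gK.
have fl a : f (lact a (ext_cls wz)) = a by rewrite bhom_lE fw; exact: mulr1.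
have lE a := ext_cls_l wz (is_cocycle_l a wz).
have rE a := ext_cls_r wz (is_cocycle_r a wz).
exists w; split=> // [h hz|a|b].
- exists (f (ext_cls hz)); apply/(ext_cls_eq hz (is_cocycle_l _ wz)).
  by apply: (can_inj fK); rewrite -lE fl.
- by move/(ext_cls0 (is_cocycle_l a wz)); rewrite -lE => H; rewrite -[a]fl H bhom0.
- apply/(ext_cls_eq (is_cocycle_r b wz) (is_cocycle_l _ wz)).
  rewrite -lE -rE; apply: (can_inj fK); rewrite fl bhom_rE fw; exact: mul1r.
Qed.

End FreeRankOne.

(** * Transport of cochains *)

Section Transport.
Variables (k : comPzRingType) (A : pzAlgType k) (M N : bimodule A).
Variables (S : proj_resolution M) (T : proj_resolution N).
Variable ga : forall n, T n -> S n.
Variable th : tensor A A -> tensor A A.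
Hypothesis ga_chain : forall n p, ga (res_d T n p) = res_d S n (ga p).
Hypothesis thD : {morph th : t u / t + u}.
Hypothesis th_hom : forall n (g : dual_bimod (S n)),
  @is_bimod_hom _ _ (T n) (outer_bimod A) (fun p => th (g (ga p))).

Definition transport n (g : dual_bimod (S n)) : dual_bimod (T n) := BimodHom (th_hom g).

Lemma transportD n (g h : dual_bimod (S n)) :
  transport (g + h) = transport g + transport h.
Proof. by apply: bhom_eq => p; exact: thD. Qed.
Lemma transport0 n : transport (0 : dual_bimod (S n)) = 0.
Proof. by apply: (addrI (transport 0)); rewrite -transportD !addr0. Qed.
Lemma transportB n (g h : dual_bimod (S n)) :
  transport (g - h) = transport g - transport h.
Proof. by apply: (addIr (transport h)); rewrite -transportD !subrK. Qed.
Lemma transport_cocycle n (g : dual_bimod (S n)) :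
  is_cocycle g -> is_cocycle (transport g).
Proof. by move=> gz p; rewrite /= ga_chain gz; exact: morph_add0 thD. Qed.
Lemma transport_coboundary n (g : dual_bimod (S n)) :
  is_coboundary g -> is_coboundary (transport g).
Proof.
rewrite /is_coboundary; case: n g => [g ->|n g [h ->]]; first exact: transport0.
by exists (transport h); apply: bhom_eq => p /=; rewrite ga_chain.
Qed.
End Transport.

Section TensorAut.
Variables (k : comPzRingType) (A : pzAlgType k).

Lemma tensor_mapl_additive (f : A -> A) : linear f ->
  {morph tensor_map f (fun n : A => n) : t u / t + u}.
Proof. by move=> fl; exact: tensor_mapD fl (@id_linear _ _). Qed.
Lemma tensor_mapr_additive (f : A -> A) : linear f ->
  {morph tensor_map (fun m : A => m) f : t u / t + u}.
Proof. by move=> fl; exact: tensor_mapD (@id_linear _ _) fl. Qed.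

Variable f : alg_aut A.
Let fl : linear f := (aut_hom f).1.
Definition tens_autl := tensor_map f (fun n : A => n).
Definition tens_autr := tensor_map (fun m : A => m) f.

Lemma tens_autlD : {morph tens_autl : t u / t + u}.
Proof. exact: tensor_mapl_additive. Qed.
Lemma tens_autrD : {morph tens_autr : t u / t + u}.
Proof. exact: tensor_mapr_additive. Qed.
Lemma tens_autlE m n : tens_autl (tens m n) = tens (f m) n.
Proof. exact: tensor_mapE fl (@id_linear _ _). Qed.
Lemma tens_autrE m n : tens_autr (tens m n) = tens m (f n).
Proof. exact: tensor_mapE (@id_linear _ _) fl. Qed.

Local Ltac by_tens :=
  apply: tensor_lift_uniq => [t u|t u|m n];
  [ by rewrite ?(tens_autlD, tens_autrD, tmullD, tmulrD, tnullD, tnulrD)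
  | by rewrite ?(tens_autlD, tens_autrD, tmullD, tmulrD, tnullD, tnulrD)
  | by rewrite !(tens_autlE, tens_autrE, tmullE, tmulrE, tnullE, tnulrE) ?(alg_homM (aut_hom f)) ].

Lemma tens_autl_mull a t : tens_autl (tmull a t) = tmull (f a) (tens_autl t).
Proof. by move: t; by_tens. Qed.
Lemma tens_autl_nulr a t : tens_autl (tnulr a t) = tnulr a (tens_autl t).
Proof. by move: t; by_tens. Qed.
Lemma tens_autl_null a t : tens_autl (tnull a t) = tnull a (tens_autl t).
Proof. by move: t; by_tens. Qed.
Lemma tens_autr_mull a t : tens_autr (tmull a t) = tmull a (tens_autr t).
Proof. by move: t; by_tens. Qed.
Lemma tens_autr_mulr a t : tens_autr (tmulr a t) = tmulr a (tens_autr t).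
Proof. by move: t; by_tens. Qed.
Lemma tens_autr_null a t : tens_autr (tnull a t) = tnull (f a) (tens_autr t).
Proof. by move: t; by_tens. Qed.
Lemma tens_autr_nulr a t : tens_autr (tnulr a t) = tnulr (f a) (tens_autr t).
Proof. by move: t; by_tens. Qed.
End TensorAut.

Section TensorAutK.
Variables (k : comPzRingType) (A : pzAlgType k) (f g : alg_aut A).
Hypothesis fK : cancel f g.
Lemma tens_autlK : cancel (tens_autl f) (tens_autl g).
Proof.
apply: tensor_lift_uniq => [t u|t u|m n]; rewrite ?tens_autlD //.
by rewrite !tens_autlE fK.
Qed.
Lemma tens_autrK : cancel (tens_autr f) (tens_autr g).
Proof.
apply: tensor_lift_uniq => [t u|t u|m n]; rewrite ?tens_autrD //.
by rewrite !tens_autrE fK.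
Qed.
End TensorAutK.

(** * The chain map lifting the Koszul map *)

Section KoszulLift.
Variables (k : comPzRingType) (A : pzAlgType k) (sigma : alg_aut A) (delta : A -> A).
Hypothesis delta_der : is_skew_derivation sigma delta.
Variables (E : pzAlgType k) (iota : A -> E) (x : E).
Hypothesis E_ore : is_ore_extension sigma delta iota x.
Variable P : proj_resolution (regular_bimod A).

Let iotaP := ore_hom E_ore.
Local Notation tau := (aut_inv sigma).
Local Notation itau := (inv_aut sigma).
Local Notation F := (ind_bimod iotaP).
Local Notation T := (bitwist_res itau (id_aut A) P).
Local Notation FP := (ind_res E_ore P).
Local Notation FT := (ind_res E_ore T).
Local Notation J := (tens_iota iota).
Local Notation hat := (extend_cochain E_ore).

(** Lifting the Koszul map within the elements of degree at most one gives
    control over the form of the chain map. *)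
Lemma deg1_lift_exists : exists phi : forall n, bimod_hom (T n) (deg1_bimod E_ore (P n)),
  (forall p, deg1_hom E_ore (res_aug P) (phi 0%N p) =
             koszul_hom delta_der E_ore (res_aug T p)) /\
  chain_map (res_d T) (fun n => deg1_hom E_ore (res_d P n)) phi.
Proof.
apply: chain_lift.
- exact: deg1_hom_surj (@res_aug_surj _ _ _ P).
- exact: deg1_exact (@res_exact0 _ _ _ P).
- by move=> n; exact: deg1_exact (@res_exactS _ _ _ P n).
Qed.

Variable phi : forall n, bimod_hom (T n) (deg1_bimod E_ore (P n)).
Hypothesis phi_aug : forall p, deg1_hom E_ore (res_aug P) (phi 0%N p) =
  koszul_hom delta_der E_ore (res_aug T p).
Hypothesis phi_chain :
  chain_map (res_d T) (fun n => deg1_hom E_ore (res_d P n)) phi.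

Local Notation ind_co := (@ind_co _ _ _ _ _ _ _ E_ore _).
(** The components of [phi p = x alpha(p) + gamma(p) - beta(p) x]. *)
Definition alpha_fun n (p : P n) : P n := ind_co 1 0 (sub_val (phi n p)).
Definition gamma_fun n (p : P n) : P n := ind_co 0 0 (sub_val (phi n p)).
Definition beta_fun n (p : P n) : P n := - ind_co 0 1 (sub_val (phi n p)).

Lemma phiE n (p : P n) :
  phi n p = deg1_elt E_ore (alpha_fun p) (gamma_fun p) (- beta_fun p).
Proof.
rewrite /alpha_fun /beta_fun /gamma_fun.
have [a [b [c ->]]] := deg1_eltP (phi n p).
by rewrite /= opprK deg1_co10 deg1_co00 deg1_co01.
Qed.

(** The left action on the source is twisted; written with the untwisted action,
    [alpha] is linear while [beta] is semilinear over [sigma]. *)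
Lemma phi_l n a (p : P n) :
  alpha_fun (lact a p) = lact a (alpha_fun p) /\
  beta_fun (lact a p) = lact (sigma a) (beta_fun p).
Proof.
have := bhom_lE (phi n) (sigma a) p.
have -> : lact (sigma a) (p : T n) = lact a p :> T n by rewrite /= autK.
rewrite !phiE => /(congr1 (fun t => sub_val t)) /=.
rewrite [RHS](deg1_l E_ore) autK => /deg1_inj[-> _].
by rewrite lactN => /oppr_inj.
Qed.

Lemma phi_r n a (p : P n) :
  alpha_fun (ract p a) = ract (alpha_fun p) a /\
  beta_fun (ract p a) = ract (beta_fun p) (sigma a).
Proof.
have := bhom_rE (phi n) a p.
rewrite !phiE => /(congr1 (fun t => sub_val t)) /=.
rewrite [RHS](deg1_r E_ore) => /deg1_inj[-> _].
by rewrite ractN => /oppr_inj.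
Qed.

Lemma phi_add n (p q : P n) :
  alpha_fun (p + q) = alpha_fun p + alpha_fun q /\
  beta_fun (p + q) = beta_fun p + beta_fun q.
Proof.
rewrite /alpha_fun /beta_fun -opprD.
have -> : phi n (p + q) = phi n p + phi n q by exact: (bhomDE (phi n)).
by rewrite /= !ind_coD.
Qed.

Lemma alphaP n : @is_bimod_hom _ _ (P n) (P n) (@alpha_fun n).
Proof.
split=> [p q|a p|p a]; first by case: (phi_add p q).
  by case: (phi_l a p).
by case: (phi_r a p).
Qed.
Definition alpha n := BimodHom (alphaP n).

Lemma betaP n : @is_bimod_hom _ _ (P n) (bitwist sigma sigma (P n)) (@beta_fun n).
Proof.
split=> [p q|a p|p a]; first by case: (phi_add p q).
  by case: (phi_l a p).
by case: (phi_r a p).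
Qed.
Definition beta n : bimod_hom (P n) (bitwist sigma sigma (P n)) := BimodHom (betaP n).

Lemma phi_components_chain n (p : P n.+1) :
  res_d P n (alpha n.+1 p) = alpha n (res_d P n p) /\
  res_d P n (beta n.+1 p) = beta n (res_d P n p).
Proof.
have := phi_chain p; rewrite !phiE deg1_homE => /(congr1 (fun t => sub_val t)) /=.
case/deg1_inj => H1 _; rewrite bhomN => /oppr_inj H2; split; [exact: H1 | exact: H2].
Qed.

Lemma phi_components_aug (p : P 0%N) :
  res_aug P (alpha 0 p) = res_aug P p /\
  res_aug P (beta 0 p) = sigma (res_aug P p).
Proof.
have := phi_aug p; rewrite phiE deg1_homE => /(congr1 (fun t => sub_val t)) /=.
case/deg1_inj => H1 _; rewrite bhomN => /oppr_inj H2; split; [exact: H1 | exact: H2].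
Qed.

(** A lift [beta'] of the inverse of [sigma] is a homotopy inverse of [beta],
    since both composites lift the identity. *)
Lemma tau_homP : @is_bimod_hom _ _ (regular_bimod A)
  (bitwist itau itau (regular_bimod A)) tau.
Proof.
have tP := aut_inv_hom sigma.
by split=> *; rewrite /= ?(alg_homD tP) ?(alg_homM tP).
Qed.

Lemma beta_inv_exists : exists beta' : forall n, bimod_hom (P n) (bitwist itau itau (P n)),
  (forall p, res_aug P (beta' 0%N p) = tau (res_aug P p)) /\
  (forall n p, res_d P n (beta' n.+1 p) = beta' n (res_d P n p)).
Proof.
have [b [ba bc]] := @chain_lift _ _ _ _ P
  (bitwist_res itau itau P) _ (res_aug (bitwist_res itau itau P))
  (@res_aug_surj _ _ _ (bitwist_res itau itau P))
  (fun t => (@res_exact0 _ _ _ (bitwist_res itau itau P) t).1)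
  (fun n t => (@res_exactS _ _ _ (bitwist_res itau itau P) n t).1)
  (BimodHom tau_homP).
by exists b.
Qed.

Variable beta' : forall n, bimod_hom (P n) (bitwist itau itau (P n)).
Hypothesis beta'_aug : forall p, res_aug P (beta' 0%N p) = tau (res_aug P p).
Hypothesis beta'_chain :
  forall n p, res_d P n (beta' n.+1 p) = beta' n (res_d P n p).

Lemma beta_beta'P n : @is_bimod_hom _ _ (P n) (P n) (fun p => beta n (beta' n p)).
Proof.
split=> [p q|a p|p a].
- by rewrite (bhomDE (beta' n)) (bhomDE (beta n)).
- by rewrite (bhom_lE (beta' n)) (bhom_lE (beta n)) /= autVK.
- by rewrite (bhom_rE (beta' n)) (bhom_rE (beta n)) /= autVK.
Qed.
Lemma beta'_betaP n : @is_bimod_hom _ _ (T n) (T n) (fun p => beta' n (beta n p)).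
Proof.
have H : @is_bimod_hom _ _ (P n) (P n) (fun p => beta' n (beta n p)).
  split=> [p q|a p|p a].
  - by rewrite (bhomDE (beta n)) (bhomDE (beta' n)).
  - by rewrite (bhom_lE (beta n)) (bhom_lE (beta' n)) /= autK.
  - by rewrite (bhom_rE (beta n)) (bhom_rE (beta' n)) /= autK.
exact: (bitwist_homP itau (id_aut A) (BimodHom H)).
Qed.

Lemma pull_alpha n (g : dual_bimod (P n)) : is_cocycle g ->
  is_coboundary (dual_pull (alpha n) g - g).
Proof.
move=> gz.
have := @pull_homotopic _ _ _ _ P P alpha (fun n => bhom_id (P n)) n g.
have -> : dual_pull (bhom_id (P n)) g = g by apply: bhom_eq.
apply=> // [m p|p].
  by case: (phi_components_chain p).
by case: (phi_components_aug p).
Qed.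

Lemma pull_beta_beta' n (g : dual_bimod (P n)) : is_cocycle g ->
  is_coboundary (dual_pull (BimodHom (beta_beta'P n)) g - g).
Proof.
move=> gz.
have := @pull_homotopic _ _ _ _ P P (fun n => BimodHom (beta_beta'P n)) (fun n => bhom_id (P n)) n g.
have -> : dual_pull (bhom_id (P n)) g = g by apply: bhom_eq.
apply=> // [m p|p].
  by rewrite -[RHS]/(beta m (beta' m _)) -beta'_chain; case: (phi_components_chain (beta' m.+1 p)).
by rewrite -[LHS]/(res_aug P (beta 0 (beta' 0 p))) (phi_components_aug _).2 beta'_aug autVK.
Qed.

Lemma pull_beta'_beta n (g : dual_bimod (T n)) : is_cocycle g ->
  is_coboundary (dual_pull (BimodHom (beta'_betaP n)) g - g).
Proof.
move=> gz.
have := @pull_homotopic _ _ _ _ T T (fun n => BimodHom (beta'_betaP n)) (fun n => bhom_id (T n)) n g.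
have -> : dual_pull (bhom_id (T n)) g = g by apply: bhom_eq.
apply=> // [m p|p].
  rewrite -[LHS]/(res_d P m (beta' m.+1 (beta m.+1 p))) beta'_chain.
  by rewrite (phi_components_chain _).2.
by rewrite -[LHS]/(res_aug P (beta' 0 (beta 0 p))) beta'_aug (phi_components_aug _).2 autK.
Qed.

(** ** Identifications of the cochains on [P] with the cochains on its twist *)

Lemma twist1_homP n (g : dual_bimod (P n)) :
  @is_bimod_hom _ _ (T n) (outer_bimod A) (fun p => tens_autl sigma (g (p : P n))).
Proof.
split=> [p q|a p|p a].
- by rewrite [LHS](congr1 (tens_autl sigma) (bhomDE g p q)); exact: tens_autlD.
- by rewrite [LHS](congr1 (tens_autl sigma) (bhom_lE g (tau a) p)) /= tens_autl_mull autVK.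
- by rewrite [LHS](congr1 (tens_autl sigma) (bhom_rE g a p)) /= tens_autl_nulr.
Qed.
Lemma untwist1_homP n (g : dual_bimod (T n)) :
  @is_bimod_hom _ _ (P n) (outer_bimod A) (fun p => tens_autl itau (g (p : T n))).
Proof.
split=> [p q|a p|p a].
- by rewrite [LHS](congr1 (tens_autl itau) (bhomDE g p q)); exact: tens_autlD.
- have := bhom_lE g (sigma a) p; rewrite /= autK => ->.
  by rewrite tens_autl_mull /= autK.
- by rewrite [LHS](congr1 (tens_autl itau) (bhom_rE g a p)) /= tens_autl_nulr.
Qed.
Lemma twist2_homP n (g : dual_bimod (P n)) :
  @is_bimod_hom _ _ (T n) (outer_bimod A) (fun p => tens_autr itau (g (beta n (p : P n)))).
Proof.
split=> [p q|a p|p a].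
- have -> : beta n (p + q) = beta n p + beta n q :> P n by exact: (bhomDE (beta n)).
  by rewrite bhomDE; exact: tens_autrD.
- have -> : beta n (lact a (p : T n)) = lact a (beta n p : P n) :> P n.
    by rewrite [LHS](bhom_lE (beta n) (tau a) p) /= autVK.
  by rewrite bhom_lE /= tens_autr_mull.
- have -> : beta n (ract (p : T n) a) = ract (beta n p : P n) (sigma a) :> P n.
    exact: (bhom_rE (beta n) a p).
  by rewrite bhom_rE /= tens_autr_nulr /= autK.
Qed.
Lemma untwist2_homP n (g : dual_bimod (T n)) :
  @is_bimod_hom _ _ (P n) (outer_bimod A) (fun p => tens_autr sigma (g (beta' n p : T n))).
Proof.
split=> [p q|a p|p a].
- have -> : beta' n (p + q) = beta' n p + beta' n q :> T n by exact: (bhomDE (beta' n)).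
  by rewrite bhomDE; exact: tens_autrD.
- have -> : beta' n (lact a p) = @lact _ _ (T n) a (beta' n p) by exact: (bhom_lE (beta' n) a p).
  by rewrite bhom_lE /= tens_autr_mull.
- have -> : beta' n (ract p a) = @ract _ _ (T n) (beta' n p) (tau a).
    exact: (bhom_rE (beta' n) a p).
  by rewrite bhom_rE /= tens_autr_nulr autVK.
Qed.

(** A cochain on [P] becomes one on its twist either by applying [sigma] to the
    left tensor factor, or by precomposing with [beta] and applying the inverse
    of [sigma] to the right factor. Both operations are invertible, the first
    strictly and the second up to homotopy. *)
Let twist1 := @transport _ _ _ _ P T (fun n p => p) (tens_autl sigma) twist1_homP.
Let untwist1 := @transport _ _ _ _ T P (fun n p => p) (tens_autl itau) untwist1_homP.
Let twist2 := @transport _ _ _ _ P T (fun n p => beta n p) (tens_autr itau) twist2_homP.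
Let untwist2 := @transport _ _ _ _ T P (fun n p => beta' n p) (tens_autr sigma) untwist2_homP.

Lemma twist1_cob n (g : dual_bimod (P n)) : is_coboundary g -> is_coboundary (twist1 g).
Proof. by apply: transport_coboundary => //; exact: tens_autlD. Qed.
Lemma untwist1_cob n (g : dual_bimod (T n)) : is_coboundary g -> is_coboundary (untwist1 g).
Proof. by apply: transport_coboundary => //; exact: tens_autlD. Qed.
Lemma twist2_cob n (g : dual_bimod (P n)) : is_coboundary g -> is_coboundary (twist2 g).
Proof.
apply: transport_coboundary; last exact: tens_autrD.
by move=> m p; rewrite (phi_components_chain _).2.
Qed.
Lemma untwist2_cob n (g : dual_bimod (T n)) : is_coboundary g -> is_coboundary (untwist2 g).
Proof.
apply: transport_coboundary; last exact: tens_autrD.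
by move=> m p; rewrite -beta'_chain.
Qed.
Lemma twist1_z n (g : dual_bimod (P n)) : is_cocycle g -> is_cocycle (twist1 g).
Proof. by apply: transport_cocycle => //; exact: tens_autlD. Qed.
Lemma untwist1_z n (g : dual_bimod (T n)) : is_cocycle g -> is_cocycle (untwist1 g).
Proof. by apply: transport_cocycle => //; exact: tens_autlD. Qed.
Lemma twist2_z n (g : dual_bimod (P n)) : is_cocycle g -> is_cocycle (twist2 g).
Proof.
apply: transport_cocycle; last exact: tens_autrD.
by move=> m p; rewrite (phi_components_chain _).2.
Qed.
Lemma untwist2_z n (g : dual_bimod (T n)) : is_cocycle g -> is_cocycle (untwist2 g).
Proof.
apply: transport_cocycle; last exact: tens_autrD.
by move=> m p; rewrite -beta'_chain.
Qed.

Lemma twist1_l n a (g : dual_bimod (P n)) : twist1 (lact a g) = lact a (twist1 g).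
Proof. by apply: bhom_eq => p; exact: tens_autl_null. Qed.
Lemma twist2_l n a (g : dual_bimod (P n)) : twist2 (lact a g) = lact (tau a) (twist2 g).
Proof. by apply: bhom_eq => p; exact: (tens_autr_null itau). Qed.
Lemma untwist2_l n a (g : dual_bimod (T n)) :
  untwist2 (lact a g) = lact (sigma a) (untwist2 g).
Proof. by apply: bhom_eq => p; exact: tens_autr_null. Qed.
Lemma twist2_r n a (g : dual_bimod (P n)) : twist2 (ract g a) = ract (twist2 g) a.
Proof. by apply: bhom_eq => p; exact: tens_autr_mulr. Qed.

Lemma twist1K n (g : dual_bimod (P n)) : untwist1 (twist1 g) = g.
Proof. by apply: bhom_eq => p; exact: (tens_autlK (f := sigma) (g := itau) (autK sigma)). Qed.
Lemma untwist1K n (g : dual_bimod (T n)) : twist1 (untwist1 g) = g.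
Proof. by apply: bhom_eq => p; exact: (tens_autlK (f := itau) (g := sigma) (autVK sigma)). Qed.
Lemma twist2K n (g : dual_bimod (P n)) :
  untwist2 (twist2 g) = dual_pull (BimodHom (beta_beta'P n)) g.
Proof. by apply: bhom_eq => p; exact: (tens_autrK (f := itau) (g := sigma) (autVK sigma)). Qed.
Lemma untwist2K n (g : dual_bimod (T n)) :
  twist2 (untwist2 g) = dual_pull (BimodHom (beta'_betaP n)) g.
Proof. by apply: bhom_eq => p; exact: (tens_autrK (f := sigma) (g := itau) (autK sigma)). Qed.

Lemma twisted_vanish n :
  (forall g : dual_bimod (P n), is_cocycle g -> is_coboundary g) ->
  forall g : dual_bimod (T n), is_cocycle g -> is_coboundary g.
Proof.
move=> v g gz; rewrite -[g]untwist1K.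
exact/twist1_cob/v/untwist1_z.
Qed.

Section Generators.
Variables (d : nat) (w : dual_bimod (P d)).
Hypothesis wz : is_cocycle w.
Hypothesis w_span : forall g : dual_bimod (P d), is_cocycle g ->
  exists a, is_coboundary (g - lact a w).
Hypothesis w_free : forall a, is_coboundary (lact a w) -> a = 0.

(** The pullbacks of the generator [w] along [alpha] and along [beta], made
    linear over [A] by an automorphism of one of the tensor factors. *)
Definition lgen : dual_bimod (T d) := twist1 (dual_pull (alpha d) w).
Definition rgen : dual_bimod (T d) := twist2 w.

Lemma lgen_cocycle : is_cocycle lgen.
Proof.
apply: twist1_z; rewrite -[dual_pull _ _](subrK w).
exact: is_cocycleD (coboundary_cocycle (pull_alpha wz)) wz.
Qed.
Lemma rgen_cocycle : is_cocycle rgen.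
Proof. exact: twist2_z. Qed.

Lemma cohomologous_trans n (M : bimodule A) (S : proj_resolution M) (f g h : dual_bimod (S n)) :
  is_coboundary (f - g) -> is_coboundary (g - h) -> is_coboundary (f - h).
Proof.
by move=> fg gh; rewrite -[f](subrK g) -addrA; exact: is_coboundaryD.
Qed.
Lemma cohomologous_sym n (M : bimodule A) (S : proj_resolution M) (f g : dual_bimod (S n)) :
  is_coboundary (f - g) -> is_coboundary (g - f).
Proof. by move=> fg; rewrite -opprB; exact: is_coboundaryN. Qed.

Lemma lgen_span (g : dual_bimod (T d)) : is_cocycle g ->
  exists a, is_coboundary (g - lact a lgen).
Proof.
move=> gz; have [a ga] := w_span (untwist1_z gz); exists a.
rewrite -{1}[g]untwist1K /lgen -twist1_l -[_ - _](transportB (@tens_autlD _ _ sigma)).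
apply: twist1_cob; apply: cohomologous_trans ga _.
by rewrite -lactB; apply: is_coboundary_l; apply/cohomologous_sym/pull_alpha.
Qed.

Lemma lgen_free a : is_coboundary (lact a lgen) -> a = 0.
Proof.
rewrite /lgen -twist1_l => /untwist1_cob; rewrite twist1K => wb; apply: w_free.
rewrite -[lact a w]subr0; apply: (cohomologous_trans (g := lact a (dual_pull (alpha d) w))).
  by rewrite -lactB; apply: is_coboundary_l; apply/cohomologous_sym/pull_alpha.
by rewrite subr0.
Qed.

Lemma rgen_span (g : dual_bimod (T d)) : is_cocycle g ->
  exists a, is_coboundary (g - lact a rgen).
Proof.
move=> gz; have [a ga] := w_span (untwist2_z gz); exists (tau a).
apply: (cohomologous_trans (g := twist2 (untwist2 g))).
  by rewrite untwist2K; apply/cohomologous_sym/pull_beta'_beta.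
by rewrite /rgen -twist2_l -[_ - _](transportB (@tens_autrD _ _ itau)); exact: twist2_cob.
Qed.

Lemma rgen_free a : is_coboundary (lact a rgen) -> a = 0.
Proof.
move=> /untwist2_cob; rewrite untwist2_l twist2K => wb.
have : sigma a = 0.
  apply: w_free; rewrite -[lact _ w]subr0.
  apply: (cohomologous_trans (g := lact (sigma a) (dual_pull (BimodHom (beta_beta'P d)) w))).
    by rewrite -lactB; apply: is_coboundary_l; apply/cohomologous_sym/pull_beta_beta'.
  by rewrite subr0.
by move/(congr1 tau); rewrite autK (alg_hom0 (aut_inv_hom sigma)).
Qed.

(** The right inner action takes place on the left tensor factor, which [twist2]
    leaves alone, and the left one on the right factor, to which [twist2] applies
    the inverse of [sigma]. *)
Lemma rgen_comm (nu : A -> A) :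
  (forall b, is_coboundary (ract w b - lact (nu b) w)) ->
  forall b, is_coboundary (ract rgen b - lact (tau (nu b)) rgen).
Proof.
move=> wb b; rewrite /rgen -twist2_l -twist2_r -[_ - _](transportB (@tens_autrD _ _ itau)).
exact: twist2_cob.
Qed.

(** Each of the two classes is a free generator of the same left [A]-module. *)
Lemma lgen_rgen_unit : exists u v : A,
  [/\ u * v = 1, v * u = 1 & is_coboundary (lgen - lact u rgen)].
Proof.
have [u uP] := rgen_span lgen_cocycle; have [v vP] := lgen_span rgen_cocycle.
exists u, v; split=> //; symmetry; apply: subr0_eq.
- apply: lgen_free; rewrite lactBl lact1 lactM; apply: cohomologous_trans uP _.
  by rewrite -lactB; exact: is_coboundary_l.
- apply: rgen_free; rewrite lactBl lact1 lactM; apply: cohomologous_trans vP _.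
  by rewrite -lactB; exact: is_coboundary_l.
Qed.

(** ** The induced chain map *)

Definition Phi n : bimod_hom (FT n) (FP n) :=
  ind_extend (bhom_comp (deg1_val E_ore (P n)) (phi n)).

Lemma Phi_unit n (p : T n) :
  Phi n (ind_unit iotaP (T n) p : F (T n)) = sub_val (phi n p).
Proof. exact: ind_extend_unit. Qed.

Lemma Phi_chain : chain_map (res_d FT) (res_d FP) Phi.
Proof.
move=> n t; suff H : bhom_comp (res_d FP n) (Phi n.+1) = bhom_comp (Phi n) (res_d FT n).
  exact: (congr1 (fun f : bimod_hom _ _ => f t) H).
apply: ind_hom_ext => p.
transitivity (res_d FP n (Phi n.+1 (ind_unit iotaP (T n.+1) p : F (T n.+1)))); first by [].
rewrite Phi_unit.
transitivity (Phi n (res_d FT n (ind_unit iotaP (T n.+1) p : F (T n.+1)))); last by [].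
rewrite [res_d FT n _]ind_map_unit Phi_unit -phi_chain.
by [].
Qed.

Lemma Phi_aug t : res_aug FP (Phi 0 t) = koszul delta_der E_ore (res_aug FT t).
Proof.
suff H : bhom_comp (res_aug FP) (Phi 0) = bhom_comp (koszul delta_der E_ore) (res_aug FT).
  exact: (congr1 (fun f : bimod_hom _ _ => f t) H).
apply: ind_hom_ext => p.
transitivity (res_aug FP (Phi 0 (ind_unit iotaP (T 0%N) p : F (T 0%N)))); first by [].
rewrite Phi_unit.
transitivity (koszul delta_der E_ore (res_aug FT (ind_unit iotaP (T 0%N) p : F (T 0%N)))); last by [].
rewrite [res_aug FT _]ind_map_unit [koszul _ _ _]ind_extend_unit.
exact: (congr1 (fun t => sub_val t) (phi_aug p)).
Qed.

Lemma tmull_x_tens_iota t : tmull x (J t) =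
  tmulr x (J (tens_autl sigma t)) +
  J (tensor_map delta (fun n : A => n) t).
Proof.
have dl := delta_der.1; have D := tensor_mapl_additive dl.
move: t; apply: tensor_lift_uniq => [t u|t u|m n].
- by rewrite (tens_iotaD E_ore) tmullD.
- by rewrite tens_autlD D !(tens_iotaD E_ore) tmulrD addrACA.
rewrite (tens_iotaE E_ore) tmullE (ore_comm E_ore) (balancedDl (@tens_balanced k E E)).
by rewrite tens_autlE !(tens_iotaE E_ore) tmulrE (tensor_mapE _ _ dl (@id_linear _ _)) (tens_iotaE E_ore).
Qed.

Lemma delta_tau_linear : linear (fun a => - delta (tau a)).
Proof.
move=> c a b; have [tl _] := aut_inv_hom sigma; have [dl _] := delta_der.
by rewrite tl dl opprD scalerN.
Qed.

Lemma tnulr_x_tens_iota t : tnulr x (J t) =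
  tnull x (J (tens_autr itau t)) +
  J (tensor_map (fun m : A => m) (fun a => - delta (tau a)) t).
Proof.
have dl := delta_tau_linear; have D := tensor_mapr_additive dl.
move: t; apply: tensor_lift_uniq => [t u|t u|m n].
- by rewrite (tens_iotaD E_ore) tnulrD.
- by rewrite tens_autrD D !(tens_iotaD E_ore) tnullD addrACA.
rewrite (tens_iotaE E_ore) tnulrE (ore_comm_inv E_ore) -(alg_homN iotaP).
rewrite (balancedDr (@tens_balanced k E E)).
by rewrite tens_autrE !(tens_iotaE E_ore) tnullE (tensor_mapE _ _ (@id_linear _ _) dl) (tens_iotaE E_ore).
Qed.

(** On [p] the pulled back cochain takes the value
    [x w(alpha p) + w(gamma p) - w(beta p) x] for the outer structure. Moving
    [x] inwards past [A] turns the outer terms into the inner products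
    [lgen x] and [x rgen], up to a remainder with values in [A (x) A]; that
    remainder is [w3]. *)
Lemma pull_generator : exists w3 : dual_bimod (T d), is_cocycle w3 /\
  dual_pull (Phi d) (hat w) =
  ract (hat lgen) x - lact x (hat rgen) + hat w3.
Proof.
pose D : dual_bimod (FT d) := dual_pull (Phi d) (hat w) -
  (ract (hat lgen) x - lact x (hat rgen)).
have Dz : is_cocycle D.
  apply: is_cocycleB; first exact/(pull_cocycle Phi_chain)/extend_cochain_cocycle.
  apply: is_cocycleB; first exact/is_cocycle_r/extend_cochain_cocycle/lgen_cocycle.
  exact/is_cocycle_l/extend_cochain_cocycle/rgen_cocycle.
(* [D] takes values in [A (x) A], which is the piece with index [(0, 0)]. *)
exists (cochain_co 0 0 D); split; first exact: cochain_co_cocycle.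
suff -> : hat (cochain_co 0 0 D) = D by rewrite addrC subrK.
apply: dual_ext => p; rewrite extend_cochain_unit.
suff [s Ds] : exists s, D (ind_unit iotaP (T d) p : F (T d)) = J s.
  transitivity (J (tens_co E_ore 0 0 (D (ind_unit iotaP (T d) p : F (T d))))); first by [].
  rewrite Ds; congr tens_iota.
  have := tens_co_place E_ore 0 0 0 1 s.
  by rewrite expr0 tmulr1 tnull1 => ->; rewrite (rco_X E_ore 0 0) tnull1.
have JN t : J (- t) = - J t.
  have J0 := morph_add0 (tens_iotaD E_ore).
  by apply: (addrI (J t)); rewrite -(tens_iotaD E_ore) !subrr J0.
exists (tensor_map delta (fun n : A => n) (w (alpha d p)) + w (gamma_fun p) -
  tensor_map (fun m : A => m) (fun a => - delta (tau a)) (w (beta d p))).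
transitivity (hat w (Phi d (ind_unit iotaP (T d) p : F (T d))) -
  (tmulr x (hat lgen (ind_unit iotaP (T d) p : F (T d))) -
   tnull x (hat rgen (ind_unit iotaP (T d) p : F (T d))))); first by [].
rewrite Phi_unit !extend_cochain_unit phiE.
have -> : hat w (deg1 E_ore (alpha_fun p) (gamma_fun p) (- beta_fun p)) =
    tmull x (J (w (alpha d p))) + J (w (gamma_fun p))
    - tnulr x (J (w (beta d p))).
  rewrite /deg1 !bhomDE ind_genN bhomN ![hat w _]ind_extend_gen.
  by rewrite !lact1 !ract1.
rewrite tmull_x_tens_iota tnulr_x_tens_iota.
rewrite -[J (lgen p)]/(J (tens_autl sigma (w (alpha d p)))).
rewrite -[J (rgen p)]/(J (tens_autr itau (w (beta d p)))).
rewrite !(tens_iotaD E_ore) JN.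
have cancel (G : zmodType) (a b c e f : G) :
    a + c + e - (b + f) - (a - b) = c + e - f.
  rewrite opprB [X in X = _]addrC -2![a + _ + _]addrA.
  have -> : b - a + (a + (c + e - (b + f))) = b + (c + e - (b + f)).
    by rewrite addrA subrK.
  by rewrite opprD addrCA addNKr.
exact: cancel.
Qed.

(** ** The Ext groups of the cone *)

Hypothesis P_fg : forall n, bimod_fg (P n).
Hypothesis P_vanish : forall n (g : dual_bimod (P n)),
  n <> d -> is_cocycle g -> is_coboundary g.

Lemma T_fg n : bimod_fg (T n).
Proof. exact: bitwist_fg. Qed.

Lemma FP_vanish n (f : dual_bimod (FP n)) :
  n <> d -> is_cocycle f -> is_coboundary f.
Proof.
by move=> nd; apply: ind_ext_vanish => // g; exact: P_vanish.
Qed.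

Lemma FT_vanish n (f : dual_bimod (FT n)) :
  n <> d -> is_cocycle f -> is_coboundary f.
Proof.
move=> nd; apply: ind_ext_vanish; first exact: T_fg.
by apply: twisted_vanish => g; exact: P_vanish.
Qed.

Local Notation hat_cocycle := (@extend_cochain_cocycle _ _ _ _ _ _ _ E_ore _ _ _ _).
Local Notation W0 := (ext_cls (hat_cocycle wz)).
Local Notation W := (ext_cls (hat_cocycle rgen_cocycle)).

(** In cohomology [lgen] is [u rgen] and the remainder [w3] is [c rgen]. *)
Lemma pull_generator_class (psi : bimod_hom (Ext_env FP d) (Ext_env FT d)) :
  (forall f (fz : is_cocycle f), psi (ext_cls fz) = ext_cls (pull_cocycle Phi_chain fz)) ->
  exists u v c : A, [/\ u * v = 1, v * u = 1 &
    psi W0 = lact (iota u) (ract W x) + lact (iota c - x) W].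
Proof.
move=> psiE; have [u [v [uv vu uP]]] := lgen_rgen_unit.
have [w3 [w3z w3P]] := pull_generator; have [c cP] := rgen_span w3z.
exists u, v, c; split=> //; rewrite psiE.
have hz := hat_cocycle rgen_cocycle.
have rz := is_cocycle_r x hz; have lz := is_cocycle_l (iota u) rz.
have cz := is_cocycle_l (iota c - x) hz.
rewrite (ext_cls_r _ rz) (ext_cls_l _ lz) (ext_cls_l _ cz).
have sz := is_cocycleD lz cz.
rewrite (ext_clsD _ _ sz); apply/ext_cls_eq; rewrite w3P.
have -> : ract (hat lgen) x - lact x (hat rgen) + hat w3 -
    (lact (iota u) (ract (hat rgen) x) + lact (iota c - x) (hat rgen)) =
    ract (hat (lgen - lact u rgen)) x + hat (w3 - lact c rgen).
  rewrite !extend_cochainB !extend_cochain_l ractB lactBl lractA.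
  have cancel (G : zmodType) (a b e f g : G) :
      a - b + e - (f + (g - b)) = a - f + (e - g).
    by rewrite [a - b + e]addrAC addrA opprB addrA subrK opprD addrACA.
  exact: cancel.
apply: is_coboundaryD; last exact: extend_cochain_coboundary.
exact/is_coboundary_r/extend_cochain_coboundary.
Qed.

Local Notation Q := (cone (@koszul_inj _ _ _ _ delta_der _ _ _ E_ore) (@mult_surj _ _ _ _ _ _ _ E_ore)
  (@mult_exact _ _ _ _ delta_der _ _ _ E_ore) Phi_chain Phi_aug).

(** Ext in degree [d + 1] is the cokernel of [psi], which is [E om] with [om] the
    image of [W]. The relation [psi W0 = 0] in the cokernel, multiplied by the
    inverse [v] of [u], expresses [om x] as [(v x - v c) om]. *)
Lemma cone_generator (nu : A -> A) :
  (forall b, is_coboundary (ract w b - lact (nu b) w)) ->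
  (forall n, n <> d.+1 -> bimod_zero (Ext_env Q n)) /\
  exists om : Ext_env Q d.+1, [/\ bijective (fun e : E => lact e om),
    forall b, ract om (iota b) = lact (iota (tau (nu b))) om
  & exists u v c : A, [/\ u * v = 1, v * u = 1
    & ract om x = lact (iota u * x + iota c) om]].
Proof.
move=> w_comm; have [psi psiE] := ext_pull Phi_chain d.
have [u [v [c [uv vu psiW]]]] := pull_generator_class psiE.
have iuv : iota u * iota v = 1 by rewrite -(alg_homM iotaP) uv (alg_hom1 iotaP).
have ivu : iota v * iota u = 1 by rewrite -(alg_homM iotaP) vu (alg_hom1 iotaP).
have span0 := ind_ext_span (E_ore := E_ore) (P_fg d) wz w_span.
have span := ind_ext_span (E_ore := E_ore) (T_fg d) rgen_cocycle rgen_span.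
have free := ind_ext_free (E_ore := E_ore) (wz := rgen_cocycle) rgen_free.
have ofree := @ore_cokernel_free _ _ x _ _ psi W0 W _ _ _ iuv span0 free psiW.
have ospan := @ore_cokernel_span _ _ x _ _ psi W0 W _ _ _ ivu span psiW.
have pull_inj (f : dual_bimod (FP d)) : is_cocycle f ->
    is_coboundary (dual_pull (Phi d) f) -> is_coboundary f.
  move=> fz fb; apply/(ext_cls0 fz); apply: (ofree (ext_cls fz) 0 _).1.
  by rewrite psiE lact0l; apply/ext_cls0.
split.
  move=> n nd; apply/ext_zeroP => f.
  exact: (cone_vanish FP_vanish FT_vanish pull_inj nd).
have [dl [dl_surj dl_ker]] : exists dl : bimod_hom (Ext_env FT d) (Ext_env Q d.+1),
  (forall t, exists s, dl s = t) /\
  forall f1 (f1z : is_cocycle f1), dl (ext_cls f1z) = 0 <->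
    exists f0 : dual_bimod (FP d), is_cocycle f0 /\
      is_coboundary (f1 - dual_pull (Phi d) f0).
  exact: cone_connecting FP_vanish.
have ker z : dl z = 0 <-> exists y, psi y = z.
  have [f1 [f1z ->]] := ext_clsP z; rewrite dl_ker; split.
    move=> [f0 [f0z f1b]]; exists (ext_cls f0z); rewrite psiE.
    by apply/ext_cls_eq; rewrite -opprB; exact: is_coboundaryN.
  move=> [y]; have [f0 [f0z ->]] := ext_clsP y; rewrite psiE.
  move/ext_cls_eq => f1b; exists f0; split=> //.
  by rewrite -opprB; exact: is_coboundaryN.
have omE e : lact e (dl W) = dl (lact e W) by rewrite bhom_lE.
exists (dl W); split.
- have om_surj t : exists e, lact e (dl W) = t.
    have [z <-] := dl_surj t; have [y [e ->]] := ospan z.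
    exists e; rewrite omE bhomDE.
    by have -> : dl (psi y) = 0 by [apply/ker; exists y]; rewrite add0r.
  have om_inj e e' : lact e' (dl W) = lact e (dl W) -> e' = e.
    move=> H; apply: subr0_eq.
    have : dl (lact (e' - e) W) = 0 by rewrite -omE lactBl H subrr.
    by move/ker => [y yE]; case: (ofree _ _ yE).
  exists (fun t => sval (cid (om_surj t))) => [e|t]; last exact: (svalP (cid (om_surj t))).
  by apply: om_inj; exact: (svalP (cid (om_surj _))).
- move=> b; rewrite omE -bhom_rE; congr (bhom_fun dl _).
  have hz := hat_cocycle rgen_cocycle.
  rewrite (ext_cls_r _ (is_cocycle_r (iota b) hz)).
  rewrite (ext_cls_l _ (is_cocycle_l (iota (tau (nu b))) hz)).
  apply/ext_cls_eq; rewrite -extend_cochain_l -extend_cochain_r -extend_cochainB.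
  apply: extend_cochain_coboundary.
  exact: rgen_comm.
- exists v, u, (- (v * c)); split=> //.
  have : dl (psi W0) = 0 by apply/ker; exists W0.
  rewrite psiW bhomDE !bhom_lE bhom_rE => /(congr1 (lact (iota v))).
  rewrite lact0 lactDr -!lactM ivu lact1 => /eqP; rewrite addr_eq0 => /eqP->.
  rewrite -lactNl; congr lact.
  by rewrite mulrBr opprB (alg_homN iotaP) (alg_homM iotaP).
Qed.

End Generators.

End KoszulLift.

Theorem theorem0p2 (k : comPzRingType) (A : pzAlgType k)
    (A_proj : projective_lmod A)
    (sigma : alg_aut A) (delta : A -> A)
    (delta_der : is_skew_derivation sigma delta)
    (E : pzAlgType k) (iota : A -> E) (x : E)
    (E_ore : is_ore_extension sigma delta iota x)
    (nu : alg_aut A) (d : nat)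
    (A_CY : twisted_CY nu d) :
  exists nu' : alg_aut E,
    [/\ twisted_CY nu' d.+1,
        forall a : A, nu' (iota a) = iota (aut_inv sigma (nu a))
      & exists u v b : A,
          [/\ u * v = 1, v * u = 1 & nu' x = iota u * x + iota b]].
Proof.
have [[P [[N P_bounded] P_fg]] A_ext] := A_CY.
have [P_zero P_iso] := A_ext P.
have [w [wz w_span w_free w_comm]] := CY_cocycle P_iso.
have P_vanish n (g : dual_bimod (P n)) : n <> d -> is_cocycle g -> is_coboundary g.
  by move=> nd; exact: ((ext_zeroP P n).1 (P_zero n nd)).
have [phi [phi_aug phi_chain]] := deg1_lift_exists delta_der E_ore P.
have [beta' [beta'_aug beta'_chain]] := beta_inv_exists sigma P.
have := cone_generator phi_aug phi_chain beta'_aug beta'_chain wz w_span w_free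
  P_fg P_vanish w_comm.
set Q := cone _ _ _ _ _; move=> [Q_zero [om [om_bij om_iota [u [v [c [uv vu om_x]]]]]]].
have [nu' [nu'P nu'E]] := right_action_endo om_bij.
have nu'_iota a : nu' (iota a) = iota (aut_inv sigma (nu a)).
  exact: (bij_inj om_bij (etrans (esym (nu'E _)) (om_iota a))).
have nu'_x : nu' x = iota u * x + iota c.
  exact: (bij_inj om_bij (etrans (esym (nu'E _)) om_x)).
have rhoP : is_alg_hom (fun a => aut_inv sigma (nu a)).
  have tP := aut_inv_hom sigma; have nP := aut_hom nu.
  split=> [e a b|]; last split=> [|a b].
  - by rewrite nP.1 tP.1.
  - by rewrite (alg_hom1 nP) (alg_hom1 tP).
  - by rewrite (alg_homM nP) (alg_homM tP).
have rhoK : cancel (fun a => aut_inv sigma (nu a)) (fun a => aut_inv nu (sigma a)).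
  by move=> a; rewrite autVK autK.
have rhoVK : cancel (fun a => aut_inv nu (sigma a)) (fun a => aut_inv sigma (nu a)).
  by move=> a; rewrite autVK autK.
have nu'_bij := @ore_endo_bij _ _ _ _ _ _ _ E_ore nu' (AlgAut rhoP rhoK rhoVK)
  u v c nu'P nu'_iota uv vu nu'_x.
have [g nu'K gK] : {g | cancel nu' g & cancel g nu'}.
  have /cid[g gP] : exists g, cancel nu' g /\ cancel g nu'.
    by case: nu'_bij => g ? ?; exists g.
  by exists g; case: gP.
exists (AlgAut nu'P nu'K gK); split=> //; last by exists u, v, c.
split.
  exists Q; split.
    exists N.+1; apply: cone_bounded => n Nn; apply: ind_zero_bimod; exact: P_bounded.
  apply: cone_fg => n; apply: ind_fg; first exact: P_fg.
  by apply: bitwist_fg; exact: P_fg.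
move=> R; split=> [i id|].
  exact: (bimod_zero_iso (Ext_env_unique Q R i)) (Q_zero i id).
apply: bimod_iso_trans (Ext_env_unique R Q d.+1) _.
exact: (twist_iso om_bij (nu := AlgAut nu'P nu'K gK) nu'E).
Qed.
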